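(* Let $\theta\in\mathfrak{gl}(2,\mathbb{R})$, let $\mathcal{E}_\theta$ be the set of all rank two simple almost-Riemannian structures on $G(\theta)$, and let $\mathcal{E}^1_\theta,\mathcal{E}^2_\theta,\mathcal{E}^3_\theta\subset\mathcal{E}_\theta$ be the classes defined in the context. Up to a rescaling, it holds that: (i) $\mathcal{E}_{\theta}=\mathcal{E}^1_{\theta}$ if $\theta=\begin{pmatrix}1&0\\0&1\end{pmatrix}$ or $\theta=\begin{pmatrix}\gamma&-1\\1&\gamma\end{pmatrix}$ with $\gamma\in\mathbb{R}$; (ii) $\mathcal{E}_{\theta}=\mathcal{E}^1_{\theta}\cup\mathcal{E}^3_{\theta}$, a disjoint union, if $\theta=\begin{pmatrix}1&1\\0&1\end{pmatrix}$ or $\theta=\begin{pmatrix}1&0\\0&-1\end{pmatrix}$; (iii) $\mathcal{E}_{\theta}=\mathcal{E}^1_{\theta}\cup\mathcal{E}^2_{\theta}\cup\mathcal{E}^3_{\theta}$, a (pairwise) disjoint union, if $\theta=\begin{pmatrix}1&0\\0&\gamma\end{pmatrix}$ with $\gamma\in(-1,1)$. Here ''up to a rescaling'' means: for every $\Sigma=\{\mathcal{X},\Delta^L\}\in\mathcal{E}_\theta$ there is a constant $c>0$ such that the structure obtained from $\Sigma$ by multiplying the inner product of $\Delta$ by $c$ (keeping $\mathcal{X}$ and $\Delta$) belongs to the union on the right-hand side; the disjointness is disjointness of the sets $\mathcal{E}^i_\theta$ involved.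
   Context: Group and algebra. $\mathfrak{g}(\theta)=\mathbb{R}\times\mathbb{R}^2$ is the Lie algebra with $\{0\}\times\mathbb{R}^2$ abelian and $[(a,0),(0,w)]=(0,a\theta w)$. $G(\theta)=\mathbb{R}\times\mathbb{R}^2$ is the connected, simply connected Lie group with product $(t_1,v_1)(t_2,v_2)=(t_1+t_2,\,v_1+\rho_{t_1}v_2)$, where $\rho_t=e^{t\theta}$; its identity is $(0,0)$ and its Lie algebra is $\mathfrak{g}(\theta)$. $L_{(t,v)}$ denotes left translation, so $(dL_{(t,v)})(\alpha,\eta)=(\alpha,\rho_t\eta)$; for $Y=(\alpha,\eta)\in\mathfrak{g}(\theta)$, the left-invariant vector field is $Y^L(t,v)=(\alpha,\rho_t\eta)$. Linear vector fields. For $\xi\in\mathbb{R}^2$ and $A\in\mathfrak{gl}(2,\mathbb{R})$ with $A\theta=\theta A$, the linear vector field $\mathcal{X}=(\xi,A)$ is $\mathcal{X}(t,v)=(0,\,Av+\Lambda_t^{\theta}\xi)$, where $\Lambda_t^{\theta}\xi=\int_0^t e^{s\theta}\xi\,ds$. Its associated derivation is $\mathcal{D}(a,w)=(0,\,a\xi+Aw)$ on $\mathfrak{g}(\theta)$. $\mathcal{X}$ is of rank two if $\mathcal{D}$ has rank two, equivalently $\mathbb{R}^2=\mathrm{Im}A+\mathbb{R}\xi$. Simple almost-Riemannian structures (ARS). A simple ARS on $G(\theta)$ is $\Sigma=\{\mathcal{X},\Delta^L\}$, where $\mathcal{X}$ is a linear vector field, $\Delta\subset\mathfrak{g}(\theta)$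 is a 2-dimensional vector subspace endowed with an inner product, and $\Delta^L(t,v)=(dL_{(t,v)})_{(0,0)}\Delta$ carries the corresponding left-invariant metric, such that: (i) $\{(t,v):\mathcal{X}(t,v)\notin\Delta^L(t,v)\}\neq\emptyset$; (ii) (Lie algebra rank condition) either $\Delta$ is not a subalgebra of $\mathfrak{g}(\theta)$, or $\Delta$ is a subalgebra and $\mathcal{D}\Delta\not\subset\Delta$. $\Sigma$ is of rank two if $\mathcal{X}$ is. Norm and isometries. With $\{Y_1,Y_2\}$ an orthonormal basis of $\Delta$, the almost-Riemannian norm of a tangent vector $X$ at $(t,v)$ is $\|X\|_{\Sigma,(t,v)}=\min\{\sqrt{\alpha_0^2+\alpha_1^2+\alpha_2^2}:\ \alpha_0\mathcal{X}(t,v)+\alpha_1Y_1^L(t,v)+\alpha_2Y_2^L(t,v)=X\}$, equal to $\infty$ if no such $\alpha_i$ exist. An isometry between ARSs $\Sigma_1$ and $\Sigma_2$ is a diffeomorphism $\psi:G(\theta)\to G(\theta)$ with $\|(d\psi)_{(t,v)}Z\|_{\Sigma_2,\psi(t,v)}=\|Z\|_{\Sigma_1,(t,v)}$ for all $(t,v)\in G(\theta)$ and $Z\in T_{(t,v)}G(\theta)$. $\mathrm{Iso}(\Sigma_1;\Sigma_2)_0$ is the set of such isometries with $\psi(0,0)=(0,0)$. The classes $\mathcal{E}^i_\theta$. Let $\mathbf{e}_1,\mathbf{e}_2$ be the canonical basis of $\mathbb{R}^2$. For real $\sigma>0$ put $\alpha_1=\{(1,0),(\sigma,\mathbf{e}_1)\}$,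 $\alpha_2=\{(1,0),(\sigma,\mathbf{e}_2)\}$, $\alpha_3=\{(1,0),(\sigma,\mathbf{e}_1+\mathbf{e}_2)\}$, and let $\Delta_{i,\sigma}$ be the span of $\alpha_i$ with the inner product making $\alpha_i$ an orthonormal basis. For a rank two linear vector field $\mathcal{X}$, write $\Sigma^i_{\mathcal{X},\sigma}=\{\mathcal{X},\Delta^L_{i,\sigma}\}$ (considered whenever it is a simple ARS). Then $\mathcal{E}^i_\theta$ is the set of $\Sigma\in\mathcal{E}_\theta$ such that $\mathrm{Iso}(\Sigma;\Sigma^i_{\mathcal{X},\sigma})_0\neq\emptyset$ for some such $\Sigma^i_{\mathcal{X},\sigma}$. *)

(* Defs.v *)
From HB Require Import structures.
From mathcomp Require Import all_boot all_order all_algebra.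
From mathcomp Require Import all_classical all_reals all_analysis.

Set Implicit Arguments.
Unset Strict Implicit.
Unset Printing Implicit Defensive.

Import Order.TTheory GRing.Theory Num.Theory.
Import numFieldNormedType.Exports.

Local Open Scope classical_set_scope.
Local Open Scope ring_scope.

(** R x R^2.  It is the underlying set of the group G(theta), the Lie algebra
    g(theta), and every tangent space of G(theta), which has a global chart. *)
Notation RxR2 R := (R * 'cV[R]_2)%type.

Definition mx2 (R : realType) (a b c d : R) : 'M[R]_2 :=
  \matrix_(i, j) if i == 0 then (if j == 0 then a else b)
                 else (if j == 0 then c else d).

Definition expmx (R : realType) (M : 'M[R]_2) : 'M[R]_2 :=
  limn (series (fun k : nat => (k`!%:R)^-1 *: M ^+ k)).

Definition rho (R : realType) (theta : 'M[R]_2) (t : R) : 'M[R]_2 :=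
  expmx (t *: theta).

Definition gmul (R : realType) (theta : 'M[R]_2) (g h : RxR2 R) : RxR2 R :=
  (g.1 + h.1, g.2 + rho theta g.1 *m h.2).

(** The bilinear skew-symmetric extension of [(a,0),(0,w)] = (0, a theta w)
    with {0} x R^2 abelian. *)
Definition bracket (R : realType) (theta : 'M[R]_2) (X Y : RxR2 R) : RxR2 R :=
  (0, X.1 *: (theta *m Y.2) - Y.1 *: (theta *m X.2)).

Definition left_invariant (R : realType) (theta : 'M[R]_2) (Y p : RxR2 R) :
    RxR2 R :=
  'd (gmul theta p) (0 : RxR2 R) Y.

(** The integral from a to b, for a and b in either order. *)
Definition oriented_integral (R : realType) (a b : R) (f : R -> R) : R :=
  if a <= b then \int[lebesgue_measure]_(s in `[a, b]) f s
  else - \int[lebesgue_measure]_(s in `[b, a]) f s.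

Definition Lambda (R : realType) (theta : 'M[R]_2) (t : R) (xi : 'cV[R]_2) :
    'cV[R]_2 :=
  \col_i oriented_integral 0 t (fun s => (rho theta s *m xi) i 0).

Definition linear_field (R : realType) (theta : 'M[R]_2) (xi : 'cV[R]_2)
    (A : 'M[R]_2) (p : RxR2 R) : RxR2 R :=
  (0, A *m p.2 + Lambda theta p.1 xi).

Definition derivation (R : realType) (xi : 'cV[R]_2) (A : 'M[R]_2)
    (Y : RxR2 R) : RxR2 R :=
  (0, Y.1 *: xi + A *m Y.2).

Lemma derivation_is_linear (R : realType) (xi : 'cV[R]_2) (A : 'M[R]_2) :
  linear (derivation xi A).
Proof.
move=> a [x v] [y w]; congr pair => /=; first by rewrite scaler0 addr0.
rewrite mulmxDr -scalemxAr scalerDl scalerDr scalerA !addrA; congr (_ + _).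
by rewrite -!addrA; congr (_ + _); rewrite addrC.
Qed.

HB.instance Definition _ (R : realType) (xi : 'cV[R]_2) (A : 'M[R]_2) :=
  GRing.isLinear.Build R (RxR2 R) (RxR2 R) *:%R (derivation xi A)
    (derivation_is_linear xi A).

Definition rank_two (R : realType) (xi : 'cV[R]_2) (A : 'M[R]_2) : Prop :=
  \dim (limg (linfun (derivation xi A))) = 2.

(** The data (xi, A), Delta and the inner product of Delta; the conditions on
    them are in [simple_ARS]. *)
Record ARS (R : realType) := MkARS {
  ars_xi : 'cV[R]_2 ;
  ars_A : 'M[R]_2 ;
  ars_Delta : {vspace RxR2 R} ;
  ars_ip : subvs_of ars_Delta -> subvs_of ars_Delta -> R }.
Arguments MkARS {R}.

Definition inner_product (R : realType) (U : lmodType R) (b : U -> U -> R) :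
    Prop :=
  exists f : {dot U for idfun}, b = f.

Lemma inner_productP (R : realType) (U : lmodType R) (b : U -> U -> R) :
  inner_product b <->
  [/\ forall v, linear_for *%R (b^~ v), forall u v, b u v = b v u
    & forall u, u != 0 -> 0 < b u u].
Proof.
split=> [[f ->]|[lin sym pos]].
  split=> [v a x y|u v|u]; last exact: neq0_dnorm_gt0.
    by rewrite linearPl.
  by rewrite hermitian_subproof expr0 mul1r.
have bil : bilinear_for *%R *%R b.
  by split=> // u a x y /=; rewrite !(sym u) lin.
pose m1 := bilinear_isBilinear.Build R U U R *%R (idfun \; *%R) b bil.
pose B : Bilinear.type U U *%R (idfun \; *%R) := HB.pack b m1.
have her : forall x y, b x y = (-1) ^+ false * idfun (b y x).
  by move=> x y; rewrite expr0 mul1r sym.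
pose m2 := isHermitianSesquilinear.Build R U false idfun b her.
pose m3 := isDotProduct.Build R U b pos.
pose D : {dot U for idfun} := HB.pack b m1 m2 m3.
by exists D.
Qed.

Definition vector_field (R : realType) (theta : 'M[R]_2) (S : ARS R) :
    RxR2 R -> RxR2 R :=
  linear_field theta (ars_xi S) (ars_A S).

Definition distribution (R : realType) (theta : 'M[R]_2) (S : ARS R)
    (p : RxR2 R) : set (RxR2 R) :=
  [set left_invariant theta Y p | Y in [set` ars_Delta S]].

Definition subalgebra (R : realType) (theta : 'M[R]_2)
    (Delta : {vspace RxR2 R}) : Prop :=
  forall X Y, X \in Delta -> Y \in Delta -> bracket theta X Y \in Delta.

Definition derivation_invariant (R : realType) (S : ARS R) : Prop :=
  forall Y, Y \in ars_Delta S ->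
    derivation (ars_xi S) (ars_A S) Y \in ars_Delta S.

Record simple_ARS (R : realType) (theta : 'M[R]_2) (S : ARS R) : Prop := {
  ars_comm : ars_A S *m theta = theta *m ars_A S ;
  ars_dim : \dim (ars_Delta S) = 2 ;
  ars_inner : inner_product (@ars_ip R S) ;
  ars_generic : exists p, ~ distribution theta S p (vector_field theta S p) ;
  ars_LARC : ~ subalgebra theta (ars_Delta S) \/
             (subalgebra theta (ars_Delta S) /\ ~ derivation_invariant S) }.

Definition rank_two_simple_ARS (R : realType) (theta : 'M[R]_2) :
    set (ARS R) :=
  [set S | simple_ARS theta S /\ rank_two (ars_xi S) (ars_A S)].

Definition rescale (R : realType) (c : R) (S : ARS R) : ARS R :=
  MkARS (ars_xi S) (ars_A S) (ars_Delta S) (fun u v => c * ars_ip u v).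

Definition orthonormal_basis (R : realType) (S : ARS R)
    (Y1 Y2 : subvs_of (ars_Delta S)) : Prop :=
  [/\ basis_of (ars_Delta S) [:: vsval Y1; vsval Y2],
      ars_ip Y1 Y1 = 1, ars_ip Y2 Y2 = 1 & ars_ip Y1 Y2 = 0].

Definition lengths (R : realType) (theta : 'M[R]_2) (S : ARS R)
    (Y1 Y2 : subvs_of (ars_Delta S)) (p X : RxR2 R) : set (\bar R) :=
  [set r | exists a0 a1 a2 : R,
     a0 *: vector_field theta S p + a1 *: left_invariant theta (vsval Y1) p
       + a2 *: left_invariant theta (vsval Y2) p = X /\
     r = (Num.sqrt (a0 ^+ 2 + a1 ^+ 2 + a2 ^+ 2))%:E].

(** The infimum of the empty set is +oo; otherwise the infimum is a minimum.
    The orthonormal basis may be any one, see [ar_normE]. *)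
Definition ar_norm (R : realType) (theta : 'M[R]_2) (S : ARS R)
    (p X : RxR2 R) : \bar R :=
  ereal_inf [set r | exists Y1 Y2 : subvs_of (ars_Delta S),
    orthonormal_basis Y1 Y2 /\ lengths theta Y1 Y2 p X r].

Lemma lengths_sub (R : realType) (theta : 'M[R]_2) (S : ARS R)
    (Y1 Y2 Z1 Z2 : subvs_of (ars_Delta S)) (p X : RxR2 R) :
  inner_product (@ars_ip R S) ->
  orthonormal_basis Y1 Y2 -> orthonormal_basis Z1 Z2 ->
  lengths theta Y1 Y2 p X `<=` lengths theta Z1 Z2 p X.
Proof.
set ip := @ars_ip R S => /inner_productP[lin sym _] [_ y1 y2 y12].
move=> [bZ z1 z2 z12].
have ipD (u v w : subvs_of (ars_Delta S)) : ip (u + v) w = ip u w + ip v w.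
  by have := lin w 1 u v; rewrite scale1r mul1r.
have ip0 (w : subvs_of (ars_Delta S)) : ip 0 w = 0.
  by apply: (addrI (ip 0 w)); rewrite -ipD !addr0.
have ipZ a (u w : subvs_of (ars_Delta S)) : ip (a *: u) w = a * ip u w.
  by have := lin w a u 0; rewrite !addr0 ip0 addr0.
have ipDr (u v w : subvs_of (ars_Delta S)) : ip w (u + v) = ip w u + ip w v.
  by rewrite !(sym w) ipD.
have ipZr a (u w : subvs_of (ars_Delta S)) : ip w (a *: u) = a * ip w u.
  by rewrite !(sym w) ipZ.
have sq (U1 U2 : subvs_of (ars_Delta S)) a b : ip U1 U1 = 1 ->
    ip U2 U2 = 1 -> ip U1 U2 = 0 ->
    ip (a *: U1 + b *: U2) (a *: U1 + b *: U2) = a ^+ 2 + b ^+ 2.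
  move=> h1 h2 h12.
  rewrite !ipD !ipDr !ipZ !ipZr h1 h2 (sym U2) h12 !mulr0 !mulr1.
  by rewrite addr0 add0r !expr2.
move=> _ [a0 [a1 [a2 [<- ->]]]].
pose W := a1 *: Y1 + a2 *: Y2.
have [b1 [b2 WE]] : exists b1 b2, W = b1 *: Z1 + b2 *: Z2.
  have : vsval W \in <<[:: vsval Z1; vsval Z2]>>%VS.
    by rewrite (span_basis bZ) subvsP.
  rewrite span_cons span_seq1 => /memv_addP[_ /vlineP[b1 ->] [_ /vlineP[b2 ->] e]].
  by exists b1, b2; apply: val_inj; exact: e.
exists a0, b1, b2; split.
  rewrite -!addrA; congr (_ + _); rewrite /left_invariant -!linearZ -!linearD.
  by congr ('d _ _ _); have /(congr1 vsval) := WE; rewrite /W /= => ->.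
by congr (Num.sqrt _)%:E; rewrite -!addrA -(sq Y1 Y2)// -(sq Z1 Z2)// -/W WE.
Qed.

Lemma ar_normE (R : realType) (theta : 'M[R]_2) (S : ARS R)
    (Y1 Y2 : subvs_of (ars_Delta S)) (p X : RxR2 R) :
  inner_product (@ars_ip R S) -> orthonormal_basis Y1 Y2 ->
  ar_norm theta S p X = ereal_inf (lengths theta Y1 Y2 p X).
Proof.
move=> ip onY; congr ereal_inf; apply/seteqP; split=> [r [Z1 [Z2 [onZ]]]|r].
  exact: (lengths_sub ip onZ onY).
by exists Y1, Y2.
Qed.

Fixpoint Ck (R : realType) (V W : normedModType R) (k : nat) (f : V -> W) :
    Prop :=
  if k is k'.+1
  then (forall x, differentiable f x) /\ (forall v, Ck k' ('D_v f))
  else continuous f.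

Definition smooth (R : realType) (V W : normedModType R) (f : V -> W) : Prop :=
  forall k, Ck k f.

Definition diffeomorphism (R : realType) (V W : normedModType R)
    (f : V -> W) : Prop :=
  smooth f /\ exists g : W -> V, [/\ cancel f g, cancel g f & smooth g].

Definition isometry (R : realType) (theta : 'M[R]_2) (S1 S2 : ARS R)
    (psi : RxR2 R -> RxR2 R) : Prop :=
  diffeomorphism psi /\
  forall p Z, ar_norm theta S2 (psi p) ('d psi p Z) = ar_norm theta S1 p Z.

Definition Iso0 (R : realType) (theta : 'M[R]_2) (S1 S2 : ARS R) :
    set (RxR2 R -> RxR2 R) :=
  [set psi | isometry theta S1 S2 psi /\ psi 0 = 0].

Definition ev1 (R : realType) : 'cV[R]_2 := delta_mx 0 0.
Definition ev2 (R : realType) : 'cV[R]_2 := delta_mx 1 0.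

Definition frame (R : realType) (w : 'cV[R]_2) (sigma : R) : 2.-tuple (RxR2 R) :=
  [tuple (1, 0); (sigma, w)].

(** The inner product is the one for which [frame w sigma] is an orthonormal
    basis of its span. *)
Definition model (R : realType) (xi : 'cV[R]_2) (A : 'M[R]_2) (w : 'cV[R]_2)
    (sigma : R) : ARS R :=
  @MkARS R xi A <<frame w sigma>>%VS (fun u v =>
    \sum_(k < 2) coord (frame w sigma) k (vsval u)
               * coord (frame w sigma) k (vsval v)).

Definition model_class (R : realType) (theta : 'M[R]_2) (w : 'cV[R]_2) :
    set (ARS R) :=
  [set S | rank_two_simple_ARS theta S /\
     exists (xi : 'cV[R]_2) (A : 'M[R]_2) (sigma : R),
       [/\ 0 < sigma,
           rank_two_simple_ARS theta (model xi A w sigma)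
         & Iso0 theta S (model xi A w sigma) !=set0]].

Definition E1 (R : realType) (theta : 'M[R]_2) : set (ARS R) :=
  model_class theta (ev1 R).
Definition E2 (R : realType) (theta : 'M[R]_2) : set (ARS R) :=
  model_class theta (ev2 R).
Definition E3 (R : realType) (theta : 'M[R]_2) : set (ARS R) :=
  model_class theta (ev1 R + ev2 R).

(** The inclusion of [U] in the set of rank two structures is not repeated: it
    is part of the definition of the classes that [U] is a union of. *)
Definition all_up_to_rescaling (R : realType) (theta : 'M[R]_2)
    (U : set (ARS R)) : Prop :=
  forall S, rank_two_simple_ARS theta S -> exists2 c : R, 0 < c & U (rescale c S).

Lemma mulmx_cV_continuous (R : realType) (M : 'M[R]_2) :
  continuous (mulmx M : 'cV[R]_2 -> 'cV[R]_2).
Proof.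
have -> : mulmx M = (fun v : 'cV[R]_2 => v 0 0 *: col 0 M + v 1 0 *: col 1 M).
  apply/funext => v; apply/matrixP => i k; rewrite (ord1 k) !mxE.
  rewrite !big_ord_recl big_ord0 addr0 ![M _ _ * _]mulrC.
  by congr (_ * M _ _ + _ * M _ _); try congr (v _ _); apply: val_inj.
have h (i : 'I_2) : continuous (fun v : 'cV[R]_2 => v i 0 *: col i M).
  pose c (u : 'cV[R]_2) : R := u i 0; move=> v.
  apply: (continuous_comp (f := c) (g := fun k : R => k *: col i M)).
    exact: coord_continuous.
  exact: scalel_continuous.
by move=> v; apply: (continuousD (h 0 v) (h 1 v)).
Qed.

Lemma left_invariantE (R : realType) (theta : 'M[R]_2) (Y p : RxR2 R) :
  left_invariant theta Y p = (Y.1, rho theta p.1 *m Y.2).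
Proof.
pose L (h : RxR2 R) : RxR2 R := (h.1, rho theta p.1 *m h.2).
have Llin : linear L.
  move=> a [x v] [y w]; congr pair => //=.
  by rewrite mulmxDr -scalemxAr.
pose mL := GRing.isLinear.Build R (RxR2 R) (RxR2 R) *:%R L Llin.
pose LL : {linear RxR2 R -> RxR2 R} := HB.pack L mL.
have Lcont : continuous LL.
  move=> h; pose f (u : RxR2 R) := u.1; pose g (u : RxR2 R) := rho theta p.1 *m u.2.
  have fc : f u @[u --> h] --> f h by exact: cvg_fst.
  have gc : g u @[u --> h] --> g h.
    have sc : u.2 @[u --> h] --> h.2 by exact: cvg_snd.
    refine (cvg_comp _ _ sc (@mulmx_cV_continuous _ (rho theta p.1) h.2)).
  exact: (cvg_pair fc gc).
have Ld : is_diff (0 : RxR2 R) LL LL.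
  by apply: DiffDef; [exact: linear_differentiable|exact: diff_lin].
have -> : left_invariant theta Y p = 'd (cst p + LL) (0 : RxR2 R) Y.
  by congr ('d _ _ _); apply/funext.
by rewrite diff_val add0r.
Qed.

Lemma model_orthonormal (R : realType) (xi : 'cV[R]_2) (A : 'M[R]_2)
    (w : 'cV[R]_2) (sigma : R) : w != 0 ->
  exists Y1 Y2 : subvs_of (ars_Delta (model xi A w sigma)),
    [/\ orthonormal_basis Y1 Y2, vsval Y1 = (1, 0) & vsval Y2 = (sigma, w)].
Proof.
move=> w0; have fr : free (frame w sigma).
  rewrite free_cons free_cons nil_free span_nil andbT span_seq1.
  apply/andP; split.
    apply/vlineP => -[k [e1 e2]]; move: e1.
    move/esym/eqP: e2; rewrite scaler_eq0 (negPf w0) orbF => /eqP ->.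
    by rewrite scale0r => /eqP; rewrite oner_eq0.
  by rewrite memv0; apply/eqP => -[_] /eqP; rewrite (negPf w0).
have m1 : (1, 0) \in <<frame w sigma>>%VS by apply: memv_span; rewrite !inE eqxx.
have m2 : (sigma, w) \in <<frame w sigma>>%VS.
  by apply: memv_span; rewrite !inE eqxx orbT.
pose Y1 : subvs_of (ars_Delta (model xi A w sigma)) := Subvs m1.
pose Y2 : subvs_of (ars_Delta (model xi A w sigma)) := Subvs m2.
have c1 k : coord (frame w sigma) k (vsval Y1) = (k == 0)%:R.
  by rewrite eq_sym; exact: (coord_free 0 k fr).
have c2 k : coord (frame w sigma) k (vsval Y2) = (k == 1)%:R.
  by rewrite eq_sym; exact: (coord_free 1 k fr).
exists Y1, Y2; split=> //; split.
- by rewrite /basis_of /= fr andbT.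
- by rewrite /= !big_ord_recl big_ord0 !c1 /= !mulr0 mulr1 !addr0.
- by rewrite /= !big_ord_recl big_ord0 !c2 /= !mulr0 mulr1 add0r addr0.
- by rewrite /= !big_ord_recl big_ord0 !c1 !c2 /= !mulr0 mul0r !addr0.
Qed.

(* Main.v *)
(** The dual quadratic form of the almost-Riemannian norm, the cometric
    X^2 + Y1^2 + Y2^2, is smooth across the singular locus and is preserved by
    isometries. An isometry psi with psi(0) = 0 is studied through the Taylor
    expansion at 0 of the identity between cometrics. At first order, since X(0) = 0,
    it shows that the property of Delta of being a subalgebra is preserved,
    that is, of the line w of Delta inside R^2 being an eigenline of theta; this
    separates the class of e1 + e2 from the other two. When Delta is a subalgebra,
    the next orders show that the eigenvalues of theta on w and on R^2 / w are
    preserved up to a common factor, which separates e1 from e2 if theta has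
    eigenvalues 1 and gamma with gamma^2 different from 1.

    Conversely, (t, v) |-> (e t, P v + Lambda_{et} zeta), with e = 1 or -1 and
    P theta = e theta P, is an automorphism. It carries an orthonormal basis of
    Delta, once the inner product is scaled, to (1, 0), (1, w), where w may be
    chosen in each orbit of such P on the nonzero vectors of R^2. *)

Require Import Defs.
From HB Require Import structures.
From mathcomp Require Import all_boot all_order all_algebra.
From mathcomp Require Import all_classical all_reals all_analysis.
From mathcomp Require Import ring lra.
Set Implicit Arguments.
Unset Strict Implicit.
Unset Printing Implicit Defensive.
Import Order.TTheory GRing.Theory Num.Theory.
Import numFieldNormedType.Exports.
Local Open Scope classical_set_scope.
Local Open Scope ring_scope.

(** * The one-parameter group rho and its primitive Lambda *)

(** The norm is +oo off the span of the fields, and that span drops rank on the singular locus, so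
    the isometry condition itself cannot be differentiated there. No rigidity of isometries is used
    either: psi is never shown to be an automorphism, and only its derivatives at 0 and along one
    line through 0 enter. What they reveal about theta comes from commutators: for an orthonormal
    basis Y1 = (0, w), Y2 = (s, eta) of Delta, [Y2, Y1] is (0, s theta w), and [Y2, X] is the
    left-invariant field of D Y2. The common factor of the eigenvalues is left undetermined, so only
    their ratio is compared; exchanging two eigenvalues up to a factor forces their squares to
    agree. For the eigenvalues 1 and -1 the exchange does occur, through the swap of the two axes
    with e = -1, and this is why e2 is absent from the list there. *)

Lemma sum_ord2 (V : nmodType) (F : 'I_2 -> V) : \sum_i F i = F 0 + F 1.
Proof. by rewrite !big_ord_recl big_ord0 addr0; congr (_ + F _); apply: val_inj. Qed.

Lemma mulmx_cV2 (R : pzRingType) (M : 'M[R]_2) (v : 'cV[R]_2) (i : 'I_2) :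
  (M *m v) i 0 = M i 0 * v 0 0 + M i 1 * v 1 0.
Proof. by rewrite mxE sum_ord2. Qed.

(** This growth makes the exponential generating function entire, and it survives shifts, sums,
    multiples and integration. *)
Definition exp_bounded (R : realType) (d : nat -> R) : Prop :=
  exists C B : R, forall k, `|d k| <= C * B ^+ k.

(* [egf d] is the exponential generating function of [d]; differentiating it
   shifts [d], which gives the derivatives of rho and Lambda entrywise. *)
Definition egf_coef (R : realType) (d : nat -> R) (k : nat) : R :=
  (k`!%:R)^-1 * d k.

Definition egf (R : realType) (d : nat -> R) (t : R) : R :=
  limn (pseries (egf_coef d) t).

Lemma is_cvg_egf (R : realType) (d : nat -> R) (t : R) :
  exp_bounded d -> cvgn (pseries (egf_coef d) t).
Proof.
move=> [C [B dCB]].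
(* [C] and [B] carry no sign condition; the comparison series is that of |C| exp(|B| |t|). *)
have B0 k : `|d k| <= `|C| * `|B| ^+ k.
  by rewrite (le_trans (dCB k))// (le_trans (ler_norm _))// normrM normrX.
apply: normed_cvg.
apply: (@series_le_cvg _ _ (fun k => `|C| * exp_coeff (`|B| * `|t|) k)).
- by move=> k /=.
- by move=> k; rewrite mulr_ge0// exp_coeff_ge0// mulr_ge0.
- move=> k; rewrite /egf_coef /exp_coeff /= !normrM normfV normr_nat exprMn.
  rewrite normrX.
  have -> : `|C| * (`|B| ^+ k * `|t| ^+ k / k`!%:R) =
      (k`!%:R)^-1 * (`|C| * `|B| ^+ k) * `|t| ^+ k by ring.
  by rewrite ler_wpM2r// ler_wpM2l// invr_ge0.
- exact/is_cvg_seriesZ/is_cvg_series_exp_coeff.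
Qed.

Lemma exp_bounded_shift (R : realType) (d : nat -> R) :
  exp_bounded d -> exp_bounded (fun k => d k.+1).
Proof.
move=> [C [B dCB]]; exists (C * B), B => k.
by rewrite -mulrA -exprS; exact: dCB.
Qed.

Lemma egf_coef_diffs (R : realType) (d : nat -> R) :
  pseries_diffs (egf_coef d) = egf_coef (fun k => d k.+1).
Proof.
apply/funext => k; rewrite /pseries_diffs /egf_coef factS natrM invfM.
by rewrite mulrA mulrA divff ?mul1r// pnatr_eq0.
Qed.

Lemma is_derive_egf (R : realType) (d : nat -> R) (t : R) :
  exp_bounded d -> is_derive t 1 (egf d) (egf (fun k => d k.+1) t).
Proof.
move=> db; have db1 := exp_bounded_shift db; have db2 := exp_bounded_shift db1.
rewrite /egf -egf_coef_diffs.
(* Any radius larger than |t| would do. *)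
apply: (@pseries_snd_diffs _ _ (`|t| + 1)); rewrite ?egf_coef_diffs.
- exact: is_cvg_egf.
- exact: is_cvg_egf.
- exact: is_cvg_egf.
- by rewrite [ltRHS]ger0_norm ?ltrDl// addr_ge0.
Qed.

Lemma egf0 (R : realType) (d : nat -> R) : egf d 0 = d 0%N.
Proof.
apply: lim_near_cst => //.
exists 1%N => // n /= n0; rewrite /pseries /series /=.
rewrite big_ltn// big_nat_cond big1 ?addr0.
  by rewrite /egf_coef expr0 mulr1 invr1 mul1r.
by move=> [|k]//= _; rewrite expr0n/= mulr0.
Qed.

Lemma egfD (R : realType) (c d : nat -> R) (t : R) :
  exp_bounded c -> exp_bounded d ->
  egf (fun k => c k + d k) t = egf c t + egf d t.
Proof.
move=> cb db; apply: cvg_lim => //.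
have -> : pseries (egf_coef (fun k => c k + d k)) t =
    pseries (egf_coef c) t + pseries (egf_coef d) t.
  apply/funext => n; rewrite /pseries /series !fctE /= -big_split /=.
  by apply: eq_bigr => k _; rewrite /egf_coef mulrDr mulrDl.
by apply: cvgD; exact: is_cvg_egf.
Qed.

Lemma egfZ (R : realType) (a : R) (d : nat -> R) (t : R) :
  exp_bounded d -> egf (fun k => a * d k) t = a * egf d t.
Proof.
move=> db; apply: cvg_lim => //.
have -> : pseries (egf_coef (fun k => a * d k)) t =
    (fun n => a * pseries (egf_coef d) t n).
  apply/funext => n; rewrite /pseries /series /= mulr_sumr.
  by apply: eq_bigr => k _; rewrite /egf_coef; ring.
by apply: cvgM; [exact: cvg_cst|exact: is_cvg_egf].
Qed.

Lemma exp_boundedD (R : realType) (c d : nat -> R) :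
  exp_bounded c -> exp_bounded d -> exp_bounded (fun k => c k + d k).
Proof.
move=> [C [B cb]] [C' [B' db]].
exists (`|C| + `|C'|), (Num.max `|B| `|B'|) => k.
rewrite (le_trans (ler_normD _ _))// mulrDl lerD//.
  apply: (le_trans (cb k)); apply: (le_trans (ler_norm _)).
  by rewrite normrM normrX ler_wpM2l// lerXn2r// ?nnegrE// le_max lexx.
apply: (le_trans (db k)); apply: (le_trans (ler_norm _)).
rewrite normrM normrX ler_wpM2l// lerXn2r// ?nnegrE ?le_max ?lexx ?orbT//.
by rewrite normr_ge0.
Qed.

Lemma exp_boundedZ (R : realType) (a : R) (d : nat -> R) :
  exp_bounded d -> exp_bounded (fun k => a * d k).
Proof.
move=> [C [B db]]; exists (`|a| * C), B => k.
by rewrite normrM -mulrA ler_wpM2l.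
Qed.

Lemma exp_bounded_expmx (R : realType) (M : 'M[R]_2) (i j : 'I_2) :
  exp_bounded (fun k => (M ^+ k) i j).
Proof.
(* The sum over all entries dominates every row sum, so one more factor [M] costs one more factor
   [B]. *)
pose B := \sum_a \sum_b `|M a b|; exists 1, B => k; rewrite mul1r.
have B0 : 0 <= B by apply: sumr_ge0 => a _; apply: sumr_ge0.
have row a : \sum_b `|M a b| <= B.
  rewrite /B [leRHS](bigD1 a)//= lerDl; apply: sumr_ge0 => c _; exact: sumr_ge0.
elim: k i j => [|k IH] i j.
  by rewrite !expr0 !mxE; case: (i == j); rewrite ?normr1 ?normr0.
rewrite exprS mxE (le_trans (ler_norm_sum _ _ _))// exprS.
apply: (@le_trans _ _ (\sum_b `|M i b| * B ^+ k)).
  by apply: ler_sum => b _; rewrite normrM ler_wpM2l.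
by rewrite -mulr_suml ler_wpM2r// exprn_ge0.
Qed.

Lemma cvg_mx_entries (R : realType) (m n : nat) (u : nat -> 'M[R]_(m, n))
    (l : 'M[R]_(m, n)) :
  (forall i j, (fun k => u k i j) @ \oo --> l i j) -> u @ \oo --> l.
Proof.
move=> ul A [P Pl PA]; apply: (filterS (P := fun k => forall i j, P i j (u k i j))).
  by move=> k Pk; apply: PA.
apply: (@filter_forall nat 'I_m (fun i k => forall j, P i j (u k i j)) \oo _) => i.
apply: (@filter_forall nat 'I_n (fun j k => P i j (u k i j)) \oo _) => j.
have := ul i j _ (Pl i j); apply: filterS => k; exact.
Qed.

Lemma rhoE (R : realType) (theta : 'M[R]_2) (t : R) (i j : 'I_2) :
  rho theta t i j = egf (fun k => (theta ^+ k) i j) t.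
Proof.
suff h : series (fun k : nat => (k`!%:R)^-1 *: (t *: theta) ^+ k) @ \oo -->
    (\matrix_(i, j) egf (fun k => (theta ^+ k) i j) t).
  by rewrite /rho /expmx (cvg_lim _ h)// mxE.
apply: cvg_mx_entries => a b; rewrite mxE.
have := @is_cvg_egf _ _ t (exp_bounded_expmx theta a b).
rewrite /egf; set s := pseries _ _; set s' := (fun k => _).
suff -> : s = s' by [].
apply/funext => k; rewrite /s /s' /pseries /series /= summxE.
apply: eq_bigr => c _; rewrite mxE /egf_coef.
by rewrite exprZn !mxE; ring.
Qed.

(** The successive derivatives at t = 0 of the i-th coordinate of [rho theta t *m z]. *)
Definition vseq (R : realType) (theta : 'M[R]_2) (z : 'cV[R]_2) (i : 'I_2)
  (k : nat) : R := (theta ^+ k *m z) i 0.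

Lemma vseq_bounded (R : realType) (theta : 'M[R]_2) (z : 'cV[R]_2) (i : 'I_2) :
  exp_bounded (vseq theta z i).
Proof.
have -> : vseq theta z i =
    fun k => z 0 0 * (theta ^+ k) i 0 + z 1 0 * (theta ^+ k) i 1.
  by apply/funext => k; rewrite /vseq mulmx_cV2 !(mulrC (z _ _)).
by apply: exp_boundedD; apply: exp_boundedZ; exact: exp_bounded_expmx.
Qed.

Lemma rho_vE (R : realType) (theta : 'M[R]_2) (t : R) (z : 'cV[R]_2)
    (i : 'I_2) :
  (rho theta t *m z) i 0 = egf (vseq theta z i) t.
Proof.
rewrite (_ : vseq theta z i =
    fun k => z 0 0 * (theta ^+ k) i 0 + z 1 0 * (theta ^+ k) i 1); last first.
  by apply/funext => k; rewrite /vseq mulmx_cV2 !(mulrC (z _ _)).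
rewrite egfD; try by apply: exp_boundedZ; exact: exp_bounded_expmx.
rewrite !egfZ; try exact: exp_bounded_expmx.
by rewrite -!rhoE mulmx_cV2 !(mulrC (z _ _)).
Qed.

Lemma rho0 (R : realType) (theta : 'M[R]_2) : rho theta 0 = 1%:M.
Proof. by apply/matrixP => i j; rewrite rhoE egf0 expr0. Qed.

Lemma is_derive_rho (R : realType) (theta : 'M[R]_2) (z : 'cV[R]_2) (i : 'I_2)
    (t : R) :
  is_derive t 1 (fun s => (rho theta s *m z) i 0)
    ((rho theta t *m (theta *m z)) i 0).
Proof.
have -> : (fun s => (rho theta s *m z) i 0) = egf (vseq theta z i).
  by apply/funext => s; rewrite rho_vE.
rewrite rho_vE.
have -> : vseq theta (theta *m z) i = fun k => vseq theta z i k.+1.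
  by apply/funext => k; rewrite /vseq mulmxA -[theta ^+ k *m theta]exprSr.
exact/is_derive_egf/vseq_bounded.
Qed.

(** Delaying the coefficients by one integrates the generating function from 0. *)
Definition int_seq (R : realType) (d : nat -> R) (k : nat) : R :=
  if k is k'.+1 then d k' else 0.

Lemma int_seq_bounded (R : realType) (d : nat -> R) :
  exp_bounded d -> exp_bounded (int_seq d).
Proof.
(* The entry of index k + 1 is only bounded by the k-th power, so the ratio is taken at least 1. *)
move=> [C [B db]]; exists `|C|, (Num.max 1 `|B|) => -[|k].
  by rewrite normr0 mulr_ge0// exprn_ge0// le_max ler01.
apply: (le_trans (db k)); apply: (le_trans (ler_norm _)).
rewrite normrM normrX ler_wpM2l//.
apply: (@le_trans _ _ (Num.max 1 `|B| ^+ k)).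
  by rewrite lerXn2r ?nnegrE ?le_max ?lexx ?normr_ge0 ?ler01 ?orbT.
by rewrite ler_weXn2l// le_max lexx.
Qed.

Lemma oriented_integral_primitive (R : realType) (f F : R -> R) (t : R) :
  (forall s : R, is_derive s 1 F (f s)) -> (forall s : R, derivable f s 1) ->
  oriented_integral 0 t f = F t - F 0.
Proof.
move=> dF df.
have cf : continuous f.
  by move=> s; apply/differentiable_continuous/derivable1_diffP.
have cF : continuous F.
  by move=> s; apply/differentiable_continuous/derivable1_diffP; case: (dF s).
have main a b : a < b -> \int[lebesgue_measure]_(s in `[a, b]) f s = F b - F a.
  move=> ab; rewrite /Rintegral (@continuous_FTC2 _ f F a b)//.
  - exact: continuous_subspaceT.
  - split.
    + by move=> s _; case: (dF s).
    + exact/cvg_at_right_filter/cF.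
    + exact/cvg_at_left_filter/cF.
  - by move=> s _; rewrite derive1E; case: (dF s).
rewrite /oriented_integral; case: ltrgtP => [t0|t0|<-].
- exact: main.
- by rewrite main// opprB.
- by rewrite set_itv1 Rintegral_set1 subrr.
Qed.

(** Both sides are primitives of the same function vanishing at 0. This trades the integral for a
    power series once and for all. *)
Lemma LambdaE (R : realType) (theta : 'M[R]_2) (t : R) (z : 'cV[R]_2)
    (i : 'I_2) :
  Lambda theta t z i 0 = egf (int_seq (vseq theta z i)) t.
Proof.
have dF (s : R) : is_derive s 1 (egf (int_seq (vseq theta z i)))
    ((rho theta s *m z) i 0).
  rewrite rho_vE.
  exact: (is_derive_egf s (int_seq_bounded (vseq_bounded theta z i))).
rewrite mxE (oriented_integral_primitive t dF) ?egf0 ?subr0//.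
by move=> s; case: (is_derive_rho theta z i s).
Qed.

Lemma is_derive_Lambda (R : realType) (theta : 'M[R]_2) (z : 'cV[R]_2)
    (i : 'I_2) (t : R) :
  is_derive t 1 (fun s => Lambda theta s z i 0) ((rho theta t *m z) i 0).
Proof.
have -> : (fun s => Lambda theta s z i 0) = egf (int_seq (vseq theta z i)).
  by apply/funext => s; rewrite LambdaE.
rewrite rho_vE.
exact: (is_derive_egf t (int_seq_bounded (vseq_bounded theta z i))).
Qed.

Lemma Lambda0 (R : realType) (theta : 'M[R]_2) (z : 'cV[R]_2) :
  Lambda theta 0 z = 0.
Proof. by apply/matrixP => i j; rewrite (ord1 j) LambdaE egf0 mxE. Qed.

Lemma egf_scale_arg (R : realType) (e : R) (d : nat -> R) (t : R) :
  egf d (e * t) = egf (fun k => e ^+ k * d k) t.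
Proof.
rewrite /egf; congr (limn _); apply/funext => n; rewrite /pseries /series /=.
by apply: eq_bigr => k _; rewrite exprMn /egf_coef; ring.
Qed.

(** Each passage of [P] through theta costs a factor e, so in the exponential series e is absorbed
    into the time. The case e = 1 covers matrices commuting with theta, e = -1 the automorphisms
    that reverse time. *)
Lemma mulmx_expr_intertwine (R : comPzRingType) (theta P : 'M[R]_2) (e : R) (k : nat) :
  P *m theta = e *: (theta *m P) ->
  P *m theta ^+ k = e ^+ k *: (theta ^+ k *m P).
Proof.
move=> Pt; elim: k => [|k IH]; first by rewrite !expr0 mulmx1 mul1mx scale1r.
have -> : theta ^+ k.+1 = theta ^+ k *m theta by rewrite exprSr.
rewrite mulmxA IH -scalemxAl -mulmxA Pt -scalemxAr scalerA mulmxA.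
by congr (_ *: _); rewrite exprSr.
Qed.

Lemma rho_intertwine (R : realType) (theta P : 'M[R]_2) (e t : R)
    (z : 'cV[R]_2) :
  P *m theta = e *: (theta *m P) ->
  P *m (rho theta t *m z) = rho theta (e * t) *m (P *m z).
Proof.
move=> Pt; apply/matrixP => i j; rewrite (ord1 j) rho_vE egf_scale_arg.
rewrite mulmx_cV2 !rho_vE.
rewrite -(egfZ _ _ (vseq_bounded theta z 0)) -(egfZ _ _ (vseq_bounded theta z 1)).
rewrite -egfD; try
  by apply: exp_boundedZ; exact: vseq_bounded.
congr (egf _ t); apply/funext => k.
rewrite /vseq [in RHS]mulmxA.
have -> : e ^+ k * (theta ^+ k *m P *m z) i 0 = (P *m (theta ^+ k *m z)) i 0.
  by rewrite mulmxA (mulmx_expr_intertwine k Pt) -scalemxAl [RHS]mxE.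
by rewrite [RHS]mulmx_cV2.
Qed.

(** The coefficient of index k + 1 of a primitive contains only theta^k; the power of e left over is
    the factor in front, as in the substitution s -> e s under the integral. *)
Lemma Lambda_intertwine (R : realType) (theta P : 'M[R]_2) (e t : R)
    (z : 'cV[R]_2) :
  P *m theta = e *: (theta *m P) ->
  Lambda theta (e * t) (P *m z) = e *: (P *m Lambda theta t z).
Proof.
move=> Pt; apply/matrixP => i j; rewrite (ord1 j) LambdaE egf_scale_arg.
have b k := int_seq_bounded (vseq_bounded theta z k).
rewrite [RHS]mxE mulmx_cV2 !LambdaE -(egfZ _ _ (b 0)) -(egfZ _ _ (b 1)).
rewrite -egfD; try exact: exp_boundedZ.
rewrite -egfZ; last by apply: exp_boundedD; exact: exp_boundedZ.
congr (egf _ t); apply/funext => -[|k] /=; first by rewrite !mulr0 addr0 mulr0.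
rewrite exprS -mulrA; congr (_ * _).
rewrite /vseq [in LHS]mulmxA.
have -> : e ^+ k * (theta ^+ k *m P *m z) i 0 = (P *m (theta ^+ k *m z)) i 0.
  by rewrite mulmxA (mulmx_expr_intertwine k Pt) -scalemxAl [RHS]mxE.
by rewrite [LHS]mulmx_cV2.
Qed.
(** * Smooth maps *)

Lemma smooth_coind (R : realType) (V W : normedModType R)
    (P : (V -> W) -> Prop) :
  (forall f, P f -> (forall x, differentiable f x) /\
                    (forall v, P ('D_v f))) ->
  forall f, P f -> smooth f.
Proof.
move=> Pd f Pf k; elim: k f Pf => [|k IH] f Pf /=.
  by move=> x; apply/differentiable_continuous; case: (Pd f Pf) => df _; exact: df.
by have [df PD] := Pd f Pf; split=> // v; apply: IH; exact: PD.
Qed.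

Lemma smooth_differentiable (R : realType) (V W : normedModType R)
    (f : V -> W) (x : V) : smooth f -> differentiable f x.
Proof. by move=> sf; case: (sf 1%N). Qed.

Lemma smooth_D (R : realType) (V W : normedModType R) (f : V -> W) (v : V) :
  smooth f -> smooth ('D_v f).
Proof. by move=> sf k; have [_] := sf k.+1; apply. Qed.

Lemma smooth_of_D (R : realType) (V W : normedModType R) (f : V -> W) :
  (forall x, differentiable f x) -> (forall v, smooth ('D_v f)) -> smooth f.
Proof.
move=> df sD [|k]; last by split=> // v; exact: sD.
by move=> x; exact/differentiable_continuous.
Qed.

Lemma smooth_cst (R : realType) (V W : normedModType R) (c : W) :
  smooth (fun _ : V => c).
Proof.
apply: (@smooth_coind _ _ _ (fun f => exists c, f = fun=> c)); last by exists c.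
move=> _ [d ->]; split=> [x|v]; first exact: differentiable_cst.
by exists 0; apply/funext => x; rewrite derive_cst.
Qed.

Lemma CkS (R : realType) (V W : normedModType R) (k : nat) (f : V -> W) :
  Ck k.+1 f -> Ck k f.
Proof.
elim: k f => [|k IH] f [df Df].
  by move=> x; exact/differentiable_continuous.
by split=> // v; apply: IH; exact: Df.
Qed.

Lemma CkD (R : realType) (V W : normedModType R) (k : nat) (f g : V -> W) :
  Ck k f -> Ck k g -> Ck k (f + g).
Proof.
elim: k f g => [|k IH] f g /=; first by move=> cf cg x; apply: continuousD; [exact: cf|exact: cg].
move=> [df Df] [dg Dg]; split=> [x|v]; first exact: differentiableD.
rewrite (_ : 'D_v (f + g) = 'D_v f + 'D_v g); first exact: IH.
by apply/funext => x; rewrite deriveD//; exact: diff_derivable.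
Qed.

Lemma CkM (R : realType) (V : normedModType R) (k : nat) (f g : V -> R) :
  Ck k f -> Ck k g -> Ck k (f * g).
Proof.
elim: k f g => [|k IH] f g; first by move=> cf cg x; apply: continuousM; [exact: cf|exact: cg].
move=> Cf Cg; have [df Df] := Cf; have [dg Dg] := Cg.
split=> [x|v]; first exact: differentiableM.
rewrite (_ : 'D_v (f * g) = f * 'D_v g + g * 'D_v f).
  by apply: CkD; apply: IH; [exact: CkS|exact: Dg|exact: CkS|exact: Df].
by apply/funext => x; rewrite deriveM//; exact: diff_derivable.
Qed.

Lemma smoothD (R : realType) (V W : normedModType R) (f g : V -> W) :
  smooth f -> smooth g -> smooth (fun x => f x + g x).
Proof. by move=> sf sg k; exact: CkD. Qed.

Lemma smoothM (R : realType) (V : normedModType R) (f g : V -> R) :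
  smooth f -> smooth g -> smooth (fun x => f x * g x).
Proof. by move=> sf sg k; exact: CkM. Qed.

Lemma smooth_linear (R : realType) (V W : normedModType R)
    (f : {linear V -> W}) : continuous f -> smooth f.
Proof.
move=> cf; apply: smooth_of_D => [x|v]; first exact: linear_differentiable.
rewrite (_ : 'D_v f = fun=> f v); first exact: smooth_cst.
apply/funext => x; rewrite deriveE; last exact: linear_differentiable.
by rewrite diff_lin.
Qed.

Lemma diff_comp_linear (R : realType) (U V W : normedModType R)
    (b : {linear V -> W}) (f : U -> V) (x : U) :
  continuous b -> differentiable f x ->
  differentiable (b \o f) x /\ forall v, 'd (b \o f) x v = b ('d f x v).
Proof.
move=> cb df; have db : differentiable b (f x) by exact: linear_differentiable.
split=> [|v]; first exact: differentiable_comp.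
by rewrite diff_comp//= diff_lin.
Qed.

Lemma smooth_linear_comp (R : realType) (U V W : normedModType R)
    (b : {linear V -> W}) (f : U -> V) :
  continuous b -> smooth f -> smooth (b \o f).
Proof.
move=> cb sf; apply: (@smooth_coind _ _ _ (fun h => exists2 g, smooth g & h = b \o g)).
  move=> _ [g sg ->]; split=> [x|v].
    exact: (diff_comp_linear cb (smooth_differentiable x sg)).1.
  exists ('D_v g); first exact: smooth_D.
  apply/funext => x; have [db E] := diff_comp_linear cb (smooth_differentiable x sg).
  by rewrite deriveE// E /= deriveE//; exact: smooth_differentiable.
by exists f.
Qed.

Lemma is_derive_line (R : realType) (V W : normedModType R) (g : V -> W)
    (p u : V) (s : R) :
  differentiable g (p + s *: u) ->
  is_derive s 1 (fun s : R => g (p + s *: u)) ('D_u g (p + s *: u)).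
Proof.
move=> dg; pose l (s : R) := p + s *: u.
have dl : is_diff s l (fun s : R => s *: u).
  have := is_diffD (is_diff_cst p s) (is_diff_scalel s u).
  by rewrite add0r.
have dgl : is_diff s (g \o l) ('d g (l s) \o (fun s : R => s *: u)).
  have dgd : is_diff (l s) g ('d g (l s)) by apply: DiffDef.
  exact: is_diff_comp.
have d1 : derivable (g \o l) s 1 by apply: diff_derivable.
apply: DeriveDef => //.
rewrite (@deriveE _ _ _ (g \o l))// diff_val /= scale1r deriveE//.
Qed.

Lemma MVT_is_derive (R : realType) (f df : R -> R) (a b : R) :
  a < b -> (forall s : R, is_derive s 1 f (df s)) ->
  exists2 c, a < c < b & f b - f a = df c * (b - a).
Proof.
move=> ab dF; have [//|c] := @MVT _ f df a b ab (fun s _ => dF s).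
  apply: continuous_subspaceT => s.
  by apply/differentiable_continuous/derivable1_diffP; case: (dF s).
by rewrite in_itv /= => cab E; exists c.
Qed.

(** Mean value points are known only to be close to [p]; this compares two limits without naming the
    points as functions of the step. *)
Lemma continuous_common_value (R : realType) (V : normedModType R)
    (f g : V -> R) (p : V) :
  continuous f -> continuous g ->
  (forall d : R, 0 < d -> exists x y, [/\ `|p - x| < d, `|p - y| < d & f x = g y]) ->
  f p = g p.
Proof.
move=> cf cg h; apply/eqP; rewrite -subr_eq0 -normr_le0.
apply/ler_addgt0Pl => e e0; rewrite addr0.
have e2 : 0 < e / 2 by rewrite divr_gt0.
have Nf : \forall x \near p, `|f p - f x| < e / 2.
  by move/cvgrPdist_lt: (cf p); apply.
have Ng : \forall x \near p, `|g p - g x| < e / 2.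
  by move/cvgrPdist_lt: (cg p); apply.
have [d1 /= d10 D1] := proj1 (nbhs_ballP _ _) Nf.
have [d2 /= d20 D2] := proj1 (nbhs_ballP _ _) Ng.
have [|x [y [px py fxy]]] := h (Num.min d1 d2); first by rewrite lt_min d10.
have /D1 B1 : ball p d1 x.
  by rewrite -ball_normE; apply: lt_le_trans px _; rewrite ge_min lexx.
have /D2 B2 : ball p d2 y.
  by rewrite -ball_normE; apply: lt_le_trans py _; rewrite ge_min lexx orbT.
rewrite -fxy in B2.
by rewrite (splitr e) (le_trans (ler_distD (f x) _ _))// lerD ?(ltW B1)// distrC ltW.
Qed.

Lemma derive_comm (R : realType) (V : normedModType R) (g : V -> R) (u v p : V) :
  smooth g -> 'D_u ('D_v g) p = 'D_v ('D_u g) p.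
Proof.
move=> sg.
(* Two mean value theorems turn the second difference into a mixed derivative
   at a nearby point, in either order. *)
have mv a b (h : R) : 0 < h -> exists s s' : R,
    [/\ 0 < s < h, 0 < s' < h & g (p + h *: a + h *: b) - g (p + h *: a)
       - (g (p + h *: b) - g p) = h * (h * 'D_b ('D_a g) (p + s *: a + s' *: b))].
  move=> h0.
  pose phi (s : R) := g (p + h *: b + s *: a) - g (p + s *: a).
  pose phi' (s : R) := 'D_a g (p + h *: b + s *: a) - 'D_a g (p + s *: a).
  have dphi (s : R) : is_derive s 1 phi (phi' s).
    by apply: is_deriveB; apply: is_derive_line; exact: smooth_differentiable.
  have [s sh E1] := MVT_is_derive h0 dphi.
  rewrite subr0 in E1.
  pose chi (r : R) := 'D_a g (p + s *: a + r *: b).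
  pose chi' (r : R) := 'D_b ('D_a g) (p + s *: a + r *: b).
  have dchi (r : R) : is_derive r 1 chi (chi' r).
    by apply: is_derive_line; apply: smooth_differentiable; exact: smooth_D.
  have [s' s'h E2] := MVT_is_derive h0 dchi.
  rewrite subr0 in E2; exists s, s'; split=> //.
  move: E2; rewrite /chi scale0r addr0 -/(chi' s') => E2.
  move: E1; rewrite /phi /phi' !scale0r !addr0 (addrAC p) => ->.
  by rewrite (addrAC p) E2 mulrC [_ * h]mulrC.
have sD a b : continuous ('D_a ('D_b g)).
  by move=> x; apply/differentiable_continuous/smooth_differentiable; do 2 apply: smooth_D.
apply: (continuous_common_value (sD u v) (sD v u)) => d d0.
(* The 1 keeps [n] positive when both directions vanish; with step h, all points used lie within h *
   n = d / 2 of [p]. *)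
pose n := 1 + `|u| + `|v|.
have uv : `|u| + `|v| <= n by rewrite /n -addrA lerDr ler01.
have n0 : 0 < n by rewrite /n -addrA ltr_wpDr// addr_ge0.
pose h := d / (2 * n).
have h0 : 0 < h by rewrite divr_gt0 ?mulr_gt0.
have near a b s s' : 0 < s < h -> 0 < s' < h -> `|a| + `|b| <= n ->
    `|p - (p + s *: a + s' *: b)| < d.
  move=> /andP[s0 sh] /andP[s'0 s'h] abn.
  rewrite -addrA opprD addNKr normrN.
  apply: (@le_lt_trans _ _ (h * n)).
    rewrite (le_trans (ler_normD _ _))// !normrZ !gtr0_norm//.
    apply: (@le_trans _ _ (h * (`|a| + `|b|))); last by rewrite ler_wpM2l// ltW.
    by rewrite mulrDr lerD// ler_wpM2r// ltW.
  have -> : h * n = d / 2 by rewrite /h invfM mulrA mulfVK// gt_eqF.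
  by rewrite ltr_pdivrMr// ltr_pMr ?ltr1n.
have [s [s' [sh s'h E]]] := mv u v h h0.
have [r [r' [rh r'h F]]] := mv v u h h0.
exists (p + r *: v + r' *: u), (p + s *: u + s' *: v); split.
- by apply: near => //; rewrite addrC; exact: uv.
- exact: near.
(* The second difference is symmetric in the two directions, so after two divisions by h the two
   mixed derivatives agree. *)
have hn : h != 0 by rewrite gt_eqF.
apply: (mulfI hn); apply: (mulfI hn); rewrite (addrAC p (h *: v)) in F.
apply: (etrans (esym F)); apply: etrans E.
move: (g _) (g _) (g _) (g _) => x y z t.
ring.
Qed.
(** * Lie derivatives along fields on R x R^2 *)

(** Serves both as a constant covector, applied to tangent vectors, and as a linear function on the
    chart; a pulled back covector is then a Lie derivative of [covec a b c \o psi]. *)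
Definition covec (R : realType) (a b c : R) (p : RxR2 R) : R :=
  a * p.1 + b * p.2 0 0 + c * p.2 1 0.

Lemma covec_is_linear (R : realType) (a b c : R) : linear (covec a b c : RxR2 R -> R^o).
Proof.
by move=> k [x v] [y w]; rewrite /covec /= !mxE /= /GRing.scale /=; ring.
Qed.

HB.instance Definition _ (R : realType) (a b c : R) :=
  GRing.isLinear.Build R (RxR2 R) R^o *:%R (covec a b c) (covec_is_linear a b c).

Lemma covec_continuous (R : realType) (a b c : R) :
  continuous (covec a b c : RxR2 R -> R).
Proof.
move=> p.
have c1 : (fun q : RxR2 R => q.1) @ p --> p.1 by exact: cvg_fst.
have c2 i : (fun q : RxR2 R => q.2 i 0) @ p --> p.2 i 0.
  have s2 : (fun q : RxR2 R => q.2) @ p --> p.2 by exact: cvg_snd.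
  exact: (cvg_comp _ _ s2 (@coord_continuous _ _ _ i 0 p.2)).
by apply: cvgD; [apply: cvgD|]; apply: cvgM; (exact: cvg_cst || exact: c1 || exact: c2).
Qed.

Lemma smooth_covec (R : realType) (a b c : R) :
  smooth (covec a b c : RxR2 R -> R).
Proof. exact/smooth_linear/covec_continuous. Qed.

Lemma cV2_eq (R : pzRingType) (v w : 'cV[R]_2) :
  v 0 0 = w 0 0 -> v 1 0 = w 1 0 -> v = w.
Proof.
move=> v0 v1; apply/matrixP => i j; rewrite (ord1 j).
case: i => -[|[|//]] Hi.
  by rewrite (_ : Ordinal Hi = 0)//; apply: val_inj.
by rewrite (_ : Ordinal Hi = 1)//; apply: val_inj.
Qed.

Definition basis_t (R : realType) : RxR2 R := (1, 0).
Definition basis_x (R : realType) : RxR2 R := (0, ev1 R).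
Definition basis_y (R : realType) : RxR2 R := (0, ev2 R).

Lemma RxR2_basis (R : realType) (p : RxR2 R) :
  p = p.1 *: basis_t R + p.2 0 0 *: basis_x R + p.2 1 0 *: basis_y R.
Proof.
case: p => x v; congr pair => /=.
  by rewrite /GRing.scale /=; ring.
by apply: cV2_eq; rewrite !mxE /=; ring.
Qed.

Lemma diff_basis (R : realType) (V : normedModType R) (g : RxR2 R -> V)
    (p u : RxR2 R) : differentiable g p ->
  'd g p u = u.1 *: 'D_(basis_t R) g p + u.2 0 0 *: 'D_(basis_x R) g p
             + u.2 1 0 *: 'D_(basis_y R) g p.
Proof.
by move=> dg; rewrite {1}(RxR2_basis u) !linearD !linearZ !deriveE.
Qed.

HB.lock Definition lie (R : realType) (F : RxR2 R -> RxR2 R) (g : RxR2 R -> R)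
  (p : RxR2 R) : R := 'd g p (F p).

Definition smooth_field (R : realType) (F : RxR2 R -> RxR2 R) : Prop :=
  [/\ smooth (fun p => (F p).1), smooth (fun p => (F p).2 0 0)
    & smooth (fun p => (F p).2 1 0)].

Lemma lieE (R : realType) (F : RxR2 R -> RxR2 R) (g : RxR2 R -> R) :
  smooth g ->
  lie F g = (fun p => (F p).1 * 'D_(basis_t R) g p + (F p).2 0 0 * 'D_(basis_x R) g p
             + (F p).2 1 0 * 'D_(basis_y R) g p).
Proof.
by move=> sg; apply/funext => p; rewrite lie.unlock diff_basis//; exact: smooth_differentiable.
Qed.

Lemma smooth_lie (R : realType) (F : RxR2 R -> RxR2 R) (g : RxR2 R -> R) :
  smooth_field F -> smooth g -> smooth (lie F g).
Proof.
move=> [F0 F1 F2] sg; rewrite lieE//.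
by apply: smoothD; [apply: smoothD|]; apply: smoothM => //; exact: smooth_D.
Qed.

Lemma lieD (R : realType) (F : RxR2 R -> RxR2 R) (g h : RxR2 R -> R) :
  smooth g -> smooth h ->
  lie F (fun p => g p + h p) = (fun p => lie F g p + lie F h p).
Proof.
move=> sg sh; apply/funext => p.
by rewrite lie.unlock (diffD (smooth_differentiable p sg) (smooth_differentiable p sh)).
Qed.

Lemma lieM (R : realType) (F : RxR2 R -> RxR2 R) (g h : RxR2 R -> R) :
  smooth g -> smooth h ->
  lie F (fun p => g p * h p) = (fun p => g p * lie F h p + h p * lie F g p).
Proof.
move=> sg sh; apply/funext => p.
by rewrite lie.unlock (diffM (smooth_differentiable p sg) (smooth_differentiable p sh)).
Qed.

Lemma lie_cst (R : realType) (F : RxR2 R -> RxR2 R) (a : R) :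
  lie F (fun=> a) = fun=> 0.
Proof. by apply/funext => p; rewrite lie.unlock diff_cst. Qed.

Lemma diff_comp_real (R : realType) (V : normedModType R) (g : V -> R)
    (phi : R -> R) (dphi : R) (p : V) :
  differentiable g p -> is_derive (g p) 1 phi dphi ->
  differentiable (fun q => phi (g q)) p /\
  forall v, 'd (fun q => phi (g q)) p v = dphi * 'd g p v.
Proof.
move=> dg [df E]; have dphi' : differentiable phi (g p) by exact/derivable1_diffP.
split=> [|v]; first exact: (@differentiable_comp _ _ _ _ g phi).
rewrite (@diff_comp _ _ _ _ g phi)//= deriv1E//= derive1E E.
by rewrite /GRing.scale /= mulrC.
Qed.

Lemma lie_comp (R : realType) (F : RxR2 R -> RxR2 R) (g : RxR2 R -> R)
    (phi phi' : R -> R) :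
  smooth g -> (forall t : R, is_derive t 1 phi (phi' t)) ->
  lie F (fun p => phi (g p)) = (fun p => phi' (g p) * lie F g p).
Proof.
move=> sg dphi; apply/funext => p.
by rewrite lie.unlock (diff_comp_real (smooth_differentiable p sg) (dphi _)).2.
Qed.

Lemma smooth_fst (R : realType) : smooth (fun p : RxR2 R => p.1).
Proof.
have -> : (fun p : RxR2 R => p.1) = covec 1 0 0.
  by apply/funext => p; rewrite /covec; ring.
exact: smooth_covec.
Qed.

Lemma diff_fst (R : realType) (p v : RxR2 R) : 'd (fun p : RxR2 R => p.1) p v = v.1.
Proof.
have -> : (fun p : RxR2 R => p.1) = covec 1 0 0.
  by apply/funext => q; rewrite /covec; ring.
by rewrite diff_lin; [rewrite /= /covec; ring|exact: covec_continuous].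
Qed.

(** Differentiation replaces [z] by [theta *m z], so the induction on the order has to run over all
    [z]. *)
Lemma smooth_rho_comp (R : realType) (V : normedModType R) (g : V -> R)
    (theta : 'M[R]_2) (z : 'cV[R]_2) (i : 'I_2) :
  smooth g -> smooth (fun p => (rho theta (g p) *m z) i 0).
Proof.
move=> sg k.
have d (w : 'cV[R]_2) p := diff_comp_real (smooth_differentiable p sg)
  (is_derive_rho theta w i (g p)).
elim: k z => [|k IH] z; first by move=> p; exact: (differentiable_continuous (d z p).1).
split=> [p|v]; first exact: (d z p).1.
rewrite (_ : 'D_v _ = (fun p => (rho theta (g p) *m (theta *m z)) i 0) * 'D_v g).
  by apply: CkM; [exact: IH|exact: smooth_D].
apply/funext => p; rewrite deriveE; last exact: (d z p).1.
by rewrite (d z p).2 -(deriveE v (smooth_differentiable p sg)).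
Qed.

Lemma smooth_Lambda_comp (R : realType) (V : normedModType R) (g : V -> R)
    (theta : 'M[R]_2) (z : 'cV[R]_2) (i : 'I_2) :
  smooth g -> smooth (fun p => Lambda theta (g p) z i 0).
Proof.
move=> sg; have d p := diff_comp_real (smooth_differentiable p sg)
  (is_derive_Lambda theta z i (g p)).
apply: smooth_of_D => [p|v]; first exact: (d p).1.
rewrite (_ : 'D_v _ = fun p => (rho theta (g p) *m z) i 0 * 'D_v g p).
  by apply: smoothM; [exact: smooth_rho_comp|exact: smooth_D].
apply/funext => p; rewrite deriveE; last exact: (d p).1.
by rewrite (d p).2 -(deriveE v (smooth_differentiable p sg)).
Qed.

Lemma lie_covec_comp (R : realType) (a b c : R) (F psi : RxR2 R -> RxR2 R) :
  smooth psi ->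
  lie F (covec a b c \o psi) = fun p => covec a b c ('d psi p (F p)).
Proof.
move=> sp; apply/funext => p; rewrite lie.unlock.
by rewrite (diff_comp_linear (@covec_continuous R a b c) (smooth_differentiable p sp)).2.
Qed.

Lemma smooth_covec_comp (R : realType) (a b c : R) (psi : RxR2 R -> RxR2 R) :
  smooth psi -> smooth (covec a b c \o psi).
Proof. by apply: smooth_linear_comp; exact: covec_continuous. Qed.

Lemma lie_fst (R : realType) (F : RxR2 R -> RxR2 R) :
  lie F (fun p => p.1) = (fun p => (F p).1).
Proof. by apply/funext => p; rewrite lie.unlock diff_fst. Qed.

Lemma lie_covec (R : realType) (a b c : R) (F : RxR2 R -> RxR2 R) :
  lie F (covec a b c) = (fun p => covec a b c (F p)).
Proof.
by apply/funext => p; rewrite lie.unlock diff_lin//; exact: covec_continuous.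
Qed.

Lemma lie_at0 (R : realType) (F : RxR2 R -> RxR2 R) (g : RxR2 R -> R) (p : RxR2 R) :
  F p = 0 -> lie F g p = 0.
Proof. by move=> F0; rewrite lie.unlock F0 linear0. Qed.

Lemma lie_rho_comp (R : realType) (theta : 'M[R]_2) (z : 'cV[R]_2) (i : 'I_2)
    (F : RxR2 R -> RxR2 R) (g : RxR2 R -> R) :
  smooth g ->
  lie F (fun p => (rho theta (g p) *m z) i 0) =
  (fun p => (rho theta (g p) *m (theta *m z)) i 0 * lie F g p).
Proof. by move=> sg; rewrite (lie_comp _ sg (is_derive_rho theta z i)). Qed.

Lemma lie_Lambda_comp (R : realType) (theta : 'M[R]_2) (z : 'cV[R]_2) (i : 'I_2)
    (F : RxR2 R -> RxR2 R) (g : RxR2 R -> R) :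
  smooth g ->
  lie F (fun p => Lambda theta (g p) z i 0) =
  (fun p => (rho theta (g p) *m z) i 0 * lie F g p).
Proof. by move=> sg; rewrite (lie_comp _ sg (is_derive_Lambda theta z i)). Qed.

Lemma lie_rho (R : realType) (theta : 'M[R]_2) (z : 'cV[R]_2) (i : 'I_2)
    (F : RxR2 R -> RxR2 R) :
  lie F (fun p => (rho theta p.1 *m z) i 0) =
  (fun p => (rho theta p.1 *m (theta *m z)) i 0 * (F p).1).
Proof. by rewrite (lie_rho_comp _ _ _ _ (smooth_fst R)) lie_fst. Qed.

Lemma lie_Lambda (R : realType) (theta : 'M[R]_2) (z : 'cV[R]_2) (i : 'I_2)
    (F : RxR2 R -> RxR2 R) :
  lie F (fun p => Lambda theta p.1 z i 0) =
  (fun p => (rho theta p.1 *m z) i 0 * (F p).1).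
Proof.
by rewrite (lie_Lambda_comp _ _ _ _ (smooth_fst R)) lie_fst.
Qed.

Lemma smooth_left_invariant (R : realType) (theta : 'M[R]_2) (Y : RxR2 R) :
  smooth_field (left_invariant theta Y).
Proof.
have -> : left_invariant theta Y = fun p => (Y.1, rho theta p.1 *m Y.2).
  by apply/funext => p; rewrite left_invariantE.
by split; [exact: smooth_cst|exact/smooth_rho_comp/smooth_fst|exact/smooth_rho_comp/smooth_fst].
Qed.

Lemma lie_mulmx (R : realType) (A : 'M[R]_2) (i : 'I_2) (F : RxR2 R -> RxR2 R) :
  smooth (fun p : RxR2 R => (A *m p.2) i 0) /\
  lie F (fun p => (A *m p.2) i 0) = (fun p => (A *m (F p).2) i 0).
Proof.
have E : (fun p : RxR2 R => (A *m p.2) i 0) = covec 0 (A i 0) (A i 1).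
  by apply/funext => p; rewrite mulmx_cV2 /covec; ring.
rewrite E; split; first exact: smooth_covec.
rewrite lie_covec; apply/funext => p.
by rewrite mulmx_cV2 /covec; ring.
Qed.

Lemma vector_field_coordE (R : realType) (theta : 'M[R]_2) (S : ARS R)
    (i : 'I_2) (p : RxR2 R) :
  (vector_field theta S p).2 i 0 =
  (ars_A S *m p.2) i 0 + Lambda theta p.1 (ars_xi S) i 0.
Proof. by rewrite mxE. Qed.

Lemma smooth_vector_field (R : realType) (theta : 'M[R]_2) (S : ARS R) :
  smooth_field (vector_field theta S).
Proof.
have s i : smooth (fun p => (vector_field theta S p).2 i 0).
  rewrite (_ : (fun p => _) = fun p => (ars_A S *m p.2) i 0 +
      Lambda theta p.1 (ars_xi S) i 0).
    by apply: smoothD; [exact: (lie_mulmx _ _ id).1|exact/smooth_Lambda_comp/smooth_fst].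
  by apply/funext => p; rewrite vector_field_coordE.
by split; [exact: smooth_cst|exact: s|exact: s].
Qed.

(** * Second-order Lie derivatives and commutators *)

Lemma lie_comb (R : realType) (L : RxR2 R -> RxR2 R)
    (h0 h1 h2 d0 d1 d2 : RxR2 R -> R) (p : RxR2 R) :
  smooth h0 -> smooth h1 -> smooth h2 -> smooth d0 -> smooth d1 -> smooth d2 ->
  lie L (fun q => h0 q * d0 q + h1 q * d1 q + h2 q * d2 q) p =
  h0 p * lie L d0 p + d0 p * lie L h0 p
  + (h1 p * lie L d1 p + d1 p * lie L h1 p)
  + (h2 p * lie L d2 p + d2 p * lie L h2 p).
Proof.
move=> sh0 sh1 sh2 sd0 sd1 sd2.
have S0 := smoothM sh0 sd0; have S1 := smoothM sh1 sd1; have S2 := smoothM sh2 sd2.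
by rewrite (lieD L (smoothD S0 S1) S2) (lieD L S0 S1) !lieM.
Qed.

(** The 2-jet of [g] at [p]: gradient and Hessian, the latter symmetric by [derive_comm]. Packed as
    plain numbers, it turns commutator identities into polynomial ones. *)
Lemma lie_second (R : realType) (g : RxR2 R -> R) (p : RxR2 R) :
  smooth g ->
  exists d0 d1 d2 : RxR2 R -> R, [/\ smooth d0, smooth d1, smooth d2,
    forall F, lie F g =
      fun q => (F q).1 * d0 q + (F q).2 0 0 * d1 q + (F q).2 1 0 * d2 q
  & exists h00 h01 h02 h11 h12 h22 : R, forall L,
    [/\ lie L d0 p = (L p).1 * h00 + (L p).2 0 0 * h01 + (L p).2 1 0 * h02,
        lie L d1 p = (L p).1 * h01 + (L p).2 0 0 * h11 + (L p).2 1 0 * h12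
      & lie L d2 p = (L p).1 * h02 + (L p).2 0 0 * h12 + (L p).2 1 0 * h22]].
Proof.
move=> sg; have sD v : smooth ('D_v g) by exact: smooth_D.
exists ('D_(basis_t R) g), ('D_(basis_x R) g), ('D_(basis_y R) g); split=> //.
  by move=> F; exact: lieE.
have [H Hsym HE] : exists2 H : RxR2 R -> RxR2 R -> R,
    forall u v, H u v = H v u & forall L v, lie L ('D_v g) p =
      (L p).1 * H (basis_t R) v + (L p).2 0 0 * H (basis_x R) v + (L p).2 1 0 * H (basis_y R) v.
  exists (fun u v => 'D_u ('D_v g) p) => [u v|L v]; first exact: derive_comm.
  by rewrite (lieE _ (sD v)).
exists (H (basis_t R) (basis_t R)), (H (basis_t R) (basis_x R)), (H (basis_t R) (basis_y R)), (H (basis_x R) (basis_x R)),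
  (H (basis_x R) (basis_y R)), (H (basis_y R) (basis_y R)) => L.
by rewrite !HE (Hsym (basis_x R) (basis_t R)) (Hsym (basis_y R) (basis_t R)) (Hsym (basis_y R) (basis_x R)).
Qed.

(** The terms with second derivatives of [g] cancel by symmetry of the Hessian. [B] has to agree
    with the commutator of the fields only at [p]. *)
Lemma lie_bracket (R : realType) (F K B : RxR2 R -> RxR2 R) (g : RxR2 R -> R)
    (p : RxR2 R) :
  smooth_field F -> smooth_field K -> smooth g ->
  (B p).1 = lie F (fun q => (K q).1) p - lie K (fun q => (F q).1) p ->
  (forall i, (B p).2 i 0 = lie F (fun q => (K q).2 i 0) p
                       - lie K (fun q => (F q).2 i 0) p) ->
  lie F (lie K g) p = lie K (lie F g) p + lie B g p.
Proof.
move=> [F0 F1 F2] [K0 K1 K2] sg B1 B2.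
have [d0 [d1 [d2 [s0 s1 s2 gE]]]] := lie_second p sg.
move=> [h00 [h01 [h02 [h11 [h12 [h22 HE]]]]]].
rewrite !gE !lie_comb//.
have [-> -> ->] := HE F; have [-> -> ->] := HE K.
rewrite B1 !B2.
move: (lie _ _ _) (lie _ _ _) (lie _ _ _) (lie _ _ _) (lie _ _ _) (lie _ _ _).
move: (F p) (K p) => [f0 fv] [k0 kv] /=; move: (fv _ _) (fv _ _) (kv _ _) (kv _ _).
by move=> *; ring.
Qed.

Lemma lie_left_invariant_bracket (R : realType) (theta : 'M[R]_2)
    (Y Z : RxR2 R) (g : RxR2 R -> R) (p : RxR2 R) :
  smooth g ->
  lie (left_invariant theta Y) (lie (left_invariant theta Z) g) p =
  lie (left_invariant theta Z) (lie (left_invariant theta Y) g) p +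
  lie (left_invariant theta (bracket theta Y Z)) g p.
Proof.
move=> sg; apply: lie_bracket => //; try exact: smooth_left_invariant.
  have E W : (fun q => (left_invariant theta W q).1) = fun=> W.1.
    by apply/funext => q; rewrite left_invariantE.
  by rewrite !E !lie_cst left_invariantE subr0.
move=> i.
have E W : (fun q => (left_invariant theta W q).2 i 0) =
    fun q => (rho theta q.1 *m W.2) i 0.
  by apply/funext => q; rewrite left_invariantE.
rewrite !E !lie_rho !left_invariantE /= mulmxBr -!scalemxAr !mxE.
by rewrite mulrC [_ * Z.1]mulrC.
Qed.

(** The commutator [Y^L, X] is the left-invariant field of D Y: [Lambda] differentiates to rho
    applied to xi, and A passes through rho because it commutes with theta. *)
Lemma lie_left_invariant_vector_field (R : realType) (theta : 'M[R]_2)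
    (S : ARS R) (Y : RxR2 R) (g : RxR2 R -> R) (p : RxR2 R) :
  ars_A S *m theta = theta *m ars_A S -> smooth g ->
  lie (left_invariant theta Y) (lie (vector_field theta S) g) p =
  lie (vector_field theta S) (lie (left_invariant theta Y) g) p +
  lie (left_invariant theta (derivation (ars_xi S) (ars_A S) Y)) g p.
Proof.
move=> AC sg; apply: lie_bracket => //.
- exact: smooth_left_invariant.
- exact: smooth_vector_field.
- have -> : (fun q => (left_invariant theta Y q).1) = fun=> Y.1.
    by apply/funext => q; rewrite left_invariantE.
  by rewrite left_invariantE /= !lie_cst subr0.
move=> i.
have -> : (fun q => (left_invariant theta Y q).2 i 0) =
    fun q => (rho theta q.1 *m Y.2) i 0.
  by apply/funext => q; rewrite left_invariantE.
have -> : (fun q => (vector_field theta S q).2 i 0) =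
    fun q => (ars_A S *m q.2) i 0 + Lambda theta q.1 (ars_xi S) i 0.
  by apply/funext => q; rewrite vector_field_coordE.
rewrite lieD; [|exact: (lie_mulmx _ _ id).1|exact/smooth_Lambda_comp/smooth_fst].
rewrite (lie_mulmx _ _ _).2 lie_Lambda lie_rho !left_invariantE /= mulr0 subr0.
have -> : ars_A S *m (rho theta p.1 *m Y.2) = rho theta p.1 *m (ars_A S *m Y.2).
  by rewrite (@rho_intertwine _ _ _ 1) ?mul1r ?scale1r.
by rewrite mulmxDr -scalemxAr !mxE addrC mulrC.
Qed.
(** * The cometric of an almost-Riemannian structure *)

Lemma ar_norm_le (R : realType) (theta : 'M[R]_2) (S : ARS R)
    (Y1 Y2 : subvs_of (ars_Delta S)) (p : RxR2 R) (a0 a1 a2 : R) :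
  orthonormal_basis Y1 Y2 ->
  (ar_norm theta S p (a0 *: vector_field theta S p
     + a1 *: left_invariant theta (vsval Y1) p
     + a2 *: left_invariant theta (vsval Y2) p)%R
   <= (Num.sqrt (a0 ^+ 2 + a1 ^+ 2 + a2 ^+ 2))%:E)%E.
Proof.
move=> onY; apply: ereal_inf_lbound; exists Y1, Y2; split=> //.
by exists a0, a1, a2.
Qed.

(** A strict bound on the infimum yields actual coefficients, so that attainment of the minimum
    never has to be proved. *)
Lemma ar_norm_lt (R : realType) (theta : 'M[R]_2) (S : ARS R)
    (Y1 Y2 : subvs_of (ars_Delta S)) (p Z : RxR2 R) (r : R) :
  inner_product (@ars_ip R S) -> orthonormal_basis Y1 Y2 ->
  (ar_norm theta S p Z < r%:E)%E ->
  exists a0 a1 a2 : R, a0 *: vector_field theta S p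
     + a1 *: left_invariant theta (vsval Y1) p
     + a2 *: left_invariant theta (vsval Y2) p = Z /\
     a0 ^+ 2 + a1 ^+ 2 + a2 ^+ 2 < r ^+ 2.
Proof.
move=> ipS onY; rewrite (ar_normE _ _ _ ipS onY) => /ereal_inf_lt[l].
move=> [a0 [a1 [a2 [E ->]]]]; rewrite lte_fin => lt.
exists a0, a1, a2; split=> //.
have sq0 : 0 <= a0 ^+ 2 + a1 ^+ 2 + a2 ^+ 2 by rewrite !addr_ge0 ?sqr_ge0.
by rewrite -(sqr_sqrtr sq0) ltrXn2r// ?sqrtr_ge0//.
Qed.

(** Cauchy-Schwarz gives N^2 <= (N + e) N' for every e > 0, where N and N' are the two sums of
    squares; the slack e is what working with an infimum costs. *)
Lemma sum_sqr_le (R : realType) (g0 g1 g2 h0 h1 h2 : R) :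
  (forall e, 0 < e -> exists a0 a1 a2 : R,
     a0 ^+ 2 + a1 ^+ 2 + a2 ^+ 2 < (g0 ^+ 2 + g1 ^+ 2 + g2 ^+ 2) + e /\
     g0 ^+ 2 + g1 ^+ 2 + g2 ^+ 2 = a0 * h0 + a1 * h1 + a2 * h2) ->
  g0 ^+ 2 + g1 ^+ 2 + g2 ^+ 2 <= h0 ^+ 2 + h1 ^+ 2 + h2 ^+ 2.
Proof.
set N := g0 ^+ 2 + _ + _; set N' := h0 ^+ 2 + _ + _ => H.
rewrite leNgt; apply/negP => NN'.
have N'0 : 0 <= N' by rewrite !addr_ge0 ?sqr_ge0.
have D0 : 0 < N * (N - N') by rewrite mulr_gt0 ?subr_gt0// (le_lt_trans N'0).
have n1 : 0 < N' + 1 by rewrite ltr_wpDl.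
(* This e satisfies e N' < N (N - N'), which contradicts the Cauchy-Schwarz bound. *)
have [|a0 [a1 [a2 [aN NE]]]] := H (N * (N - N') / (N' + 1)).
  by rewrite divr_gt0.
have CS : N ^+ 2 <= (a0 ^+ 2 + a1 ^+ 2 + a2 ^+ 2) * N'.
  rewrite NE /N' -subr_ge0.
  rewrite (_ : _ - _ = (a0 * h1 - a1 * h0) ^+ 2 + (a0 * h2 - a2 * h0) ^+ 2
    + (a1 * h2 - a2 * h1) ^+ 2); last by ring.
  by rewrite !addr_ge0 ?sqr_ge0.
have le1 : N ^+ 2 <= (N + N * (N - N') / (N' + 1)) * N'.
  by apply: (le_trans CS); rewrite ler_wpM2r// ltW.
have : N * (N - N') / (N' + 1) * N' < N * (N - N').
  by rewrite mulrAC ltr_pdivrMr// ltr_pM2l// ltrDl.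
nra.
Qed.

Lemma diff_cancel (R : realType) (V W : normedModType R) (f : V -> W) (g : W -> V)
    (q : W) : smooth f -> smooth g -> cancel g f ->
  forall z, 'd f (g q) ('d g q z) = z.
Proof.
move=> sf sg gK z; have dg := smooth_differentiable q sg.
have df := smooth_differentiable (g q) sf.
rewrite -[LHS](_ : 'd (f \o g) q z = _); last by rewrite diff_comp.
rewrite (_ : f \o g = id); last by apply/funext => x /=; rewrite gK.
by rewrite diff_val.
Qed.

Lemma diffeomorphism_diff (R : realType) (V W : normedModType R) (f : V -> W)
    (p : V) : diffeomorphism f ->
  (forall u, 'd f p u = 0 -> u = 0) /\ (forall z, exists u, 'd f p u = z).
Proof.
move=> [sf [g [fK gK sg]]]; split=> [u u0|z].
  by rewrite -(diff_cancel p sg sf fK u) u0 linear0.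
exists ('d g (f p) z).
by have := diff_cancel (f p) sf sg gK z; rewrite fK.
Qed.

(* The squared dual norm of the almost-Riemannian norm, polarized: unlike the
   norm it is finite, smooth across the singular locus, and it is preserved by
   isometries because the open unit balls correspond. *)
Definition cometric_map (R : realType) (theta : 'M[R]_2) (S S' : ARS R)
    (Y1 Y2 Z1 Z2 : RxR2 R) (psi : RxR2 R -> RxR2 R) : Prop :=
  forall (a b c a' b' c' : R) (p : RxR2 R),
    lie (vector_field theta S) (covec a b c \o psi) p *
    lie (vector_field theta S) (covec a' b' c' \o psi) p +
    lie (left_invariant theta Y1) (covec a b c \o psi) p *
    lie (left_invariant theta Y1) (covec a' b' c' \o psi) p +
    lie (left_invariant theta Y2) (covec a b c \o psi) p *
    lie (left_invariant theta Y2) (covec a' b' c' \o psi) p =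
    covec a b c (vector_field theta S' (psi p)) *
    covec a' b' c' (vector_field theta S' (psi p)) +
    covec a b c (left_invariant theta Z1 (psi p)) *
    covec a' b' c' (left_invariant theta Z1 (psi p)) +
    covec a b c (left_invariant theta Z2 (psi p)) *
    covec a' b' c' (left_invariant theta Z2 (psi p)).

(** A covector is tested on its own gradient, whose coefficients in the frame are the values of the
    covector on the frame. Its norm is at most the dual norm, and the pairing with it is the square
    of the dual norm; transported by the isometry, this bounds one dual norm by the other, in both
    directions. *)
Lemma isometry_cometric_map (R : realType) (theta : 'M[R]_2) (S S' : ARS R)
    (Y1 Y2 : subvs_of (ars_Delta S)) (Z1 Z2 : subvs_of (ars_Delta S'))
    (psi : RxR2 R -> RxR2 R) :
  inner_product (@ars_ip R S) -> inner_product (@ars_ip R S') ->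
  orthonormal_basis Y1 Y2 -> orthonormal_basis Z1 Z2 ->
  Defs.isometry theta S S' psi ->
  cometric_map theta S S' (vsval Y1) (vsval Y2) (vsval Z1) (vsval Z2) psi.
Proof.
move=> ipS ipS' onY onZ [dpsi iso].
have sp := dpsi.1.
have diag a b c p :
    covec a b c ('d psi p (vector_field theta S p)) ^+ 2 +
    covec a b c ('d psi p (left_invariant theta (vsval Y1) p)) ^+ 2 +
    covec a b c ('d psi p (left_invariant theta (vsval Y2) p)) ^+ 2 =
    covec a b c (vector_field theta S' (psi p)) ^+ 2 +
    covec a b c (left_invariant theta (vsval Z1) (psi p)) ^+ 2 +
    covec a b c (left_invariant theta (vsval Z2) (psi p)) ^+ 2.
  have [inj surj] := diffeomorphism_diff p dpsi.
  have cov3 (x0 x1 x2 : R) (u0 u1 u2 : RxR2 R) :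
      covec a b c (x0 *: u0 + x1 *: u1 + x2 *: u2) =
      x0 * covec a b c u0 + x1 * covec a b c u1 + x2 * covec a b c u2.
    by rewrite !linearD !linearZ.
  apply/eqP; rewrite eq_le; apply/andP; split; apply: sum_sqr_le => e e0.
    set g0 := covec a b c _; set g1 := covec a b c _; set g2 := covec a b c _.
    have q0 : 0 <= g0 ^+ 2 + g1 ^+ 2 + g2 ^+ 2 by rewrite !addr_ge0 ?sqr_ge0.
    have lt : (ar_norm theta S' (psi p) ('d psi p (g0 *: vector_field theta S p
       + g1 *: left_invariant theta (vsval Y1) p
       + g2 *: left_invariant theta (vsval Y2) p))%R
       < (Num.sqrt (g0 ^+ 2 + g1 ^+ 2 + g2 ^+ 2 + e))%:E)%E.
      rewrite iso; apply: le_lt_trans (ar_norm_le _ _ _ _ _ onY) _.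
      by rewrite lte_fin ltr_sqrt ?ltrDl// ltr_wpDl.
    have [a0 [a1 [a2 [E lt2]]]] := ar_norm_lt ipS' onZ lt.
    exists a0, a1, a2; split.
      by move: lt2; rewrite sqr_sqrtr// addr_ge0// ltW.
    rewrite -cov3 E !linearD !linearZ /GRing.scale /= -/g0 -/g1 -/g2.
    by rewrite !expr2.
  set g0 := covec a b c _; set g1 := covec a b c _; set g2 := covec a b c _.
  have q0 : 0 <= g0 ^+ 2 + g1 ^+ 2 + g2 ^+ 2 by rewrite !addr_ge0 ?sqr_ge0.
  have [u uE] := surj (g0 *: vector_field theta S' (psi p)
     + g1 *: left_invariant theta (vsval Z1) (psi p)
     + g2 *: left_invariant theta (vsval Z2) (psi p)).
  have lt : (ar_norm theta S p u
      < (Num.sqrt (g0 ^+ 2 + g1 ^+ 2 + g2 ^+ 2 + e))%:E)%E.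
    rewrite -iso uE; apply: le_lt_trans (ar_norm_le _ _ _ _ _ onZ) _.
    by rewrite lte_fin ltr_sqrt ?ltrDl// ltr_wpDl.
  have [a0 [a1 [a2 [E lt2]]]] := ar_norm_lt ipS onY lt.
  exists a0, a1, a2; split.
    by move: lt2; rewrite sqr_sqrtr// addr_ge0// ltW.
  rewrite -cov3; have := congr1 (covec a b c) uE.
  rewrite -E !linearD !linearZ /GRing.scale /= -/g0 -/g1 -/g2 => ->.
  by rewrite !expr2.
move=> a b c a' b' c' p.
(* Polarization: the mixed identity is half the difference between the identity for the sum and the
   two diagonal ones. *)
have covD u : covec (a + a') (b + b') (c + c') u = covec a b c u + covec a' b' c' u.
  by rewrite /covec; ring.
have D := diag a b c p; have D' := diag a' b' c' p.
have D2 := diag (a + a') (b + b') (c + c') p.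
rewrite !covD in D2; rewrite !lie_covec_comp//.
move: D D' D2.
move: (covec a b c _) (covec a b c _) (covec a b c _).
move: (covec a b c _) (covec a b c _) (covec a b c _).
move: (covec a' b' c' _) (covec a' b' c' _) (covec a' b' c' _).
move: (covec a' b' c' _) (covec a' b' c' _) (covec a' b' c' _).
move=> x0 x1 x2 x3 x4 x5 y0 y1 y2 y3 y4 y5 D D' D2.
lra.
Qed.

(** The rank condition excludes Delta = {0} x R^2, which is an abelian ideal containing the image of
    D. Hence Delta meets {0} x R^2 in a line, and Gram-Schmidt started on that line keeps the first
    vector in it. *)
Lemma orthonormal_frame (R : realType) (theta : 'M[R]_2) (S : ARS R) :
  simple_ARS theta S ->
  exists (Y1 Y2 : subvs_of (ars_Delta S)) (w eta : 'cV[R]_2) (s : R),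
    [/\ orthonormal_basis Y1 Y2, vsval Y1 = (0, w), vsval Y2 = (s, eta),
        w != 0 & s != 0].
Proof.
move=> [_ dimD /inner_productP[lin sym pos] _ LARC].
have [k kD k0] : exists2 k, k \in ars_Delta S & k.1 != 0.
  apply: contrapT => nk.
  have h Y : Y \in ars_Delta S -> Y.1 = 0.
    by move=> YD; apply/eqP/negP => /negP Y0; apply: nk; exists Y.
  have sub : (ars_Delta S <= <<[:: basis_x R; basis_y R]>>)%VS.
    apply/subvP => Y /h Y0.
    rewrite (RxR2_basis Y) Y0 scale0r add0r.
    by rewrite rpredD// rpredZ// memv_span// !inE eqxx ?orbT.
  have eqD : ars_Delta S = <<[:: basis_x R; basis_y R]>>%VS.
    apply/eqP; rewrite eqEdim sub dimD.
    exact: (leq_trans (dim_span _)).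
  have inD (v : 'cV[R]_2) : (0, v) \in ars_Delta S.
    rewrite eqD (RxR2_basis (0, v)) /= scale0r add0r.
    by rewrite rpredD// rpredZ// memv_span// !inE eqxx ?orbT.
  case: LARC => [nsub|[_ ninv]].
    by apply: nsub => X Y XD YD; exact: inD.
  by apply: ninv => Y YD; exact: inD.
have [w w0 wD] : exists2 w : 'cV[R]_2, w != 0 & (0, w) \in ars_Delta S.
  (* Otherwise the first coordinate would be injective on Delta, which would be a line. *)
  apply: contrapT => nw.
  have sub : (ars_Delta S <= <[k]>)%VS.
    apply/subvP => Y YD; apply/vlineP; exists (Y.1 / k.1).
    have : Y - (Y.1 / k.1) *: k \in ars_Delta S by rewrite rpredB// rpredZ.
    set Z := _ - _; have Z1 : Z.1 = 0.
      by apply/eqP; rewrite subr_eq0; apply/eqP/esym; exact: (divfK k0 Y.1).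
    case: (eqVneq Z.2 0) => [Z2 _|Z2 ZD].
      by apply/eqP; rewrite -subr_eq0 -/Z; apply/eqP; case: (Z) Z1 Z2 => ? ? /= -> ->.
    by case: nw; exists Z.2 => //; rewrite -Z1; case: (Z) ZD.
  by have := dimvS sub; rewrite dimD dim_vline; case: (k != 0).
set ip := @ars_ip R S in lin sym pos *.
have ipD (u v z : subvs_of (ars_Delta S)) : ip (u + v) z = ip u z + ip v z.
  by have := lin z 1 u v; rewrite scale1r mul1r.
have ip0 (z : subvs_of (ars_Delta S)) : ip 0 z = 0.
  by apply: (addrI (ip 0 z)); rewrite -ipD !addr0.
have ipZ a (u z : subvs_of (ars_Delta S)) : ip (a *: u) z = a * ip u z.
  by have := lin z a u 0; rewrite !addr0 ip0 addr0.
pose W : subvs_of (ars_Delta S) := Subvs wD.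
pose K : subvs_of (ars_Delta S) := Subvs kD.
have W0 : W != 0 by apply/eqP => /(congr1 vsval) [] /eqP; rewrite (negPf w0).
have WW := pos _ W0.
pose V := K - (ip K W / ip W W) *: W.
have V1 : (vsval V).1 = k.1 by rewrite /= scaler0 subr0.
have V0 : V != 0 by apply/eqP => e; move: k0; rewrite -V1 e /= eqxx.
have VV := pos _ V0.
have VW : ip V W = 0.
  by rewrite /V -scaleNr ipD ipZ mulNr mulfVK ?subrr// gt_eqF.
pose x := (Num.sqrt (ip W W))^-1; pose y := (Num.sqrt (ip V V))^-1.
have x0 : x != 0 by rewrite invr_eq0 sqrtr_eq0 -ltNge.
have y0 : y != 0 by rewrite invr_eq0 sqrtr_eq0 -ltNge.
exists (x *: W), (y *: V), (x *: w), (y *: (vsval V).2), (y * k.1).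
have nx (U : subvs_of (ars_Delta S)) : U != 0 -> 0 < ip U U ->
    ip ((Num.sqrt (ip U U))^-1 *: U) ((Num.sqrt (ip U U))^-1 *: U) = 1.
  move=> U0 UU; rewrite ipZ sym ipZ mulrA -expr2 exprVn sqr_sqrtr ?(ltW UU)//.
  by rewrite mulVf// gt_eqF.
have x1 : vsval (x *: W) = (0, x *: w) by congr pair; exact: mulr0.
have y1 : vsval (y *: V) = (y * k.1, y *: (vsval V).2).
  by congr pair; rewrite /= scaler0 subr0.
split=> //.
- split; [|exact: nx|exact: nx|].
    rewrite basisEfree dimD leqnn andbT; apply/andP; split; last first.
      apply/subvP => u; rewrite span_cons span_seq1 => /memv_addP[_ /vlineP[a ->]].
      by move=> [_ /vlineP[b ->] ->]; rewrite rpredD// rpredZ//; exact: subvsP.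
    rewrite free_cons free_cons nil_free span_nil andbT span_seq1.
    rewrite memv0; apply/andP; split; last first.
      apply/eqP => /(congr1 fst); rewrite y1 /= => /eqP.
      by rewrite mulf_eq0 (negPf k0) (negPf y0).
    apply/vlineP => -[a]; rewrite x1 y1 => -[] /esym/eqP.
    rewrite -[a *: _]/(a * (y * k.1)) !mulf_eq0 (negPf k0) (negPf y0) !orbF => /eqP ->.
    by rewrite scale0r => /eqP; rewrite scaler_eq0 (negPf x0) (negPf w0).
  by rewrite -[ars_ip _ _]/(ip (x *: W) (y *: V)) ipZ sym ipZ VW !mulr0.
- by rewrite scaler_eq0 (negPf x0).
- by rewrite mulf_eq0 negb_or y0.
Qed.
(** * Isometries fixing the origin *)

(** For nonzero w, [det2 w (theta *m w) = 0] says that w spans an eigenline of theta. *)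
Definition det2 (R : realType) (v w : 'cV[R]_2) : R :=
  v 0 0 * w 1 0 - v 1 0 * w 0 0.

Lemma det2_eq0 (R : realType) (w v : 'cV[R]_2) :
  w != 0 -> det2 w v = 0 -> exists r, v = r *: w.
Proof.
move=> w0 d0; case: (eqVneq (w 0 0) 0) => [w00|w00].
  have w10 : w 1 0 != 0.
    by apply: contra w0 => /eqP w10; apply/eqP/cV2_eq; rewrite mxE.
  have v00 : v 0 0 = 0.
    move: d0; rewrite /det2 w00 mul0r sub0r => /eqP.
    by rewrite oppr_eq0 mulf_eq0 (negPf w10) => /eqP.
  exists (v 1 0 / w 1 0); apply: cV2_eq; rewrite !mxE ?divfK//.
  by rewrite w00 v00 mulr0.
exists (v 0 0 / w 0 0); apply: cV2_eq; rewrite !mxE ?divfK//.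
apply: (mulfI w00); rewrite mulrA mulrCA divff// mulr1.
by apply/eqP; rewrite -subr_eq0 (mulrC (v 0 0)); apply/eqP.
Qed.

Lemma mulmx_expr_eigen (R : comPzRingType) (theta : 'M[R]_2) (w : 'cV[R]_2)
    (r : R) (k : nat) :
  theta *m w = r *: w -> theta ^+ k *m w = r ^+ k *: w.
Proof.
move=> tw; elim: k => [|k IH]; first by rewrite !expr0 mul1mx scale1r.
have -> : theta ^+ k.+1 = theta ^+ k *m theta by rewrite exprSr.
by rewrite -mulmxA tw -scalemxAr IH scalerA -exprS.
Qed.

Lemma rho_eigen (R : realType) (theta : 'M[R]_2) (w : 'cV[R]_2) (r t : R) :
  theta *m w = r *: w -> rho theta t *m w = expR (r * t) *: w.
Proof.
move=> tw; apply/matrixP => i j; rewrite (ord1 j) rho_vE mxE mulrC.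
have -> : vseq theta w i = fun k => w i 0 * r ^+ k.
  by apply/funext => k; rewrite /vseq (mulmx_expr_eigen k tw) mxE mulrC.
rewrite egfZ; last by exists 1, `|r| => k; rewrite mul1r normrX.
congr (_ * _); rewrite /egf /expR; congr (limn _).
apply/funext => n; rewrite /pseries /series /=; apply: eq_bigr => k _.
by rewrite /egf_coef /exp_coeff /= exprMn; ring.
Qed.

Lemma left_invariant0 (R : realType) (theta : 'M[R]_2) (Y : RxR2 R) :
  left_invariant theta Y 0 = Y.
Proof. by rewrite left_invariantE rho0 mul1mx; case: Y. Qed.

Lemma vector_field0 (R : realType) (theta : 'M[R]_2) (S : ARS R) :
  vector_field theta S 0 = 0.
Proof. by rewrite /vector_field /linear_field /= mulmx0 Lambda0 addr0. Qed.

Lemma smooth_vector_field_comp (R : realType) (theta : 'M[R]_2) (S : ARS R)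
    (psi : RxR2 R -> RxR2 R) (a b c : R) :
  smooth psi -> smooth (fun p => covec a b c (vector_field theta S (psi p))).
Proof.
move=> sp; have st := smooth_covec_comp 1 0 0 sp.
have s i : smooth (fun p => (vector_field theta S (psi p)).2 i 0).
  rewrite (_ : (fun p => _) = fun p => (covec 0 (ars_A S i 0) (ars_A S i 1) \o psi) p +
      Lambda theta ((covec 1 0 0 \o psi) p) (ars_xi S) i 0).
    by apply: smoothD; [exact: smooth_covec_comp|exact: smooth_Lambda_comp].
  apply/funext => p; rewrite vector_field_coordE mulmx_cV2 /covec /=.
  by congr (_ + Lambda _ _ _ _ _); ring.
rewrite (_ : (fun p => _) = fun p => b * (vector_field theta S (psi p)).2 0 0
    + c * (vector_field theta S (psi p)).2 1 0).
  by apply: smoothD; apply: smoothM => //; exact: smooth_cst.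
by apply/funext => p; rewrite /covec /= mulr0 add0r.
Qed.

Lemma covec_inj (R : realType) (u : RxR2 R) :
  (forall a b c, covec a b c u = 0) -> u = 0.
Proof.
move=> h; have := (h 1 0 0, h 0 1 0, h 0 0 1).
rewrite /covec !mul1r !mul0r !addr0 !add0r => -[[u0 u1] u2].
by case: u u0 u1 u2 {h} => x v /= -> v0 v1; congr pair; apply: cV2_eq; rewrite mxE.
Qed.

(* [Y] is the pullback of a covector that kills [Delta'] at the origin. Correcting
   its derivatives by [e / s'] times those of [T] leaves quantities [ct F] that
   vanish to second order at the origin, so that [F1, F2] Y = 0 there. *)
Lemma isometry_eigen (R : realType) (theta : 'M[R]_2) (S S' : ARS R)
    (w eta w' eta' : 'cV[R]_2) (s s' : R) (psi : RxR2 R -> RxR2 R) :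
  diffeomorphism psi -> psi 0 = 0 ->
  cometric_map theta S S' (0, w) (s, eta) (0, w') (s', eta') psi ->
  w != 0 -> s != 0 -> w' != 0 -> s' != 0 ->
  det2 w' (theta *m w') = 0 -> det2 w (theta *m w) = 0.
Proof.
move=> dpsi psi0 H w0 s0 w'0 s'0 /(det2_eq0 w'0)[r' tw'].
have sp := dpsi.1; have [inj surj] := diffeomorphism_diff 0 dpsi.
pose X := vector_field theta S.
pose F1 := left_invariant theta (0, w).
pose F2 := left_invariant theta (s, eta).
(* (b, c) is w' turned by a right angle, and [a] is solved for so that (s', eta') is killed too. *)
pose b := - w' 1 0; pose c := w' 0 0.
pose a := - (b * eta' 0 0 + c * eta' 1 0) / s'.
pose T := covec 1 0 0 \o psi; pose Y := covec a b c \o psi.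
have sT : smooth T by exact: smooth_covec_comp.
have sY : smooth Y by exact: smooth_covec_comp.
have sX : smooth_field X by exact: smooth_vector_field.
have sF1 : smooth_field F1 by exact: smooth_left_invariant.
have sF2 : smooth_field F2 by exact: smooth_left_invariant.
(* The value of the covector on the second frame field of S' at psi p. It depends on p only through
   [T], hence the form of [lie_e]. *)
pose e (p : RxR2 R) := a * s' + (b * (rho theta (T p) *m eta') 0 0
                  + c * (rho theta (T p) *m eta') 1 0).
have se (i : 'I_2) := smooth_rho_comp theta eta' i sT.
have see : smooth e.
  apply: smoothD; first exact: smooth_cst.
  by apply: smoothD; apply: smoothM => //; exact: smooth_cst.
have T0 : T 0 = 0 by rewrite /T /= psi0 linear0.
have e0 : e 0 = 0 by rewrite /e T0 rho0 mul1mx /a mulfVK// addNr.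
have [e' lie_e] : exists e', forall L, lie L e 0 = e' * lie L T 0.
  exists (b * (theta *m eta') 0 0 + c * (theta *m eta') 1 0) => L.
  have sb : smooth (fun _ : RxR2 R => b) by exact: smooth_cst.
  have sc : smooth (fun _ : RxR2 R => c) by exact: smooth_cst.
  have sas : smooth (fun _ : RxR2 R => a * s') by exact: smooth_cst.
  rewrite /e (lieD L sas (smoothD (smoothM sb (se 0)) (smoothM sc (se 1)))).
  rewrite (lieD L (smoothM sb (se 0)) (smoothM sc (se 1))).
  rewrite (lieM L sb (se 0)) (lieM L sc (se 1)) !lie_cst !lie_rho_comp//.
  by rewrite T0 rho0 !mul1mx; ring.
have TE p : (psi p).1 = T p by rewrite /T /covec /=; ring.
(* The eigenline hypothesis enters here: rho preserves the line of w', so the first frame field is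
   killed at every point and not only at 0. *)
have bF1 p : covec a b c (left_invariant theta (0, w') (psi p)) = 0.
  rewrite left_invariantE /= (rho_eigen _ tw') /covec /= !mxE /b /c; ring.
have bF2 p : covec a b c (left_invariant theta (s', eta') (psi p)) = e p.
  by rewrite left_invariantE /= TE /covec /e /=; ring.
have X0 : X 0 = 0 by exact: vector_field0.
have F10 : F1 0 = (0, w) by exact: left_invariant0.
have F20 : F2 0 = (s, eta) by exact: left_invariant0.
have YE F : lie F Y 0 = covec a b c ('d psi 0 (F 0)) by rewrite lie_covec_comp.
have brYE := lie_left_invariant_bracket theta (0, w) (s, eta) 0 sY.
rewrite -/F1 -/F2 YE left_invariant0 in brYE.
have HY a' b' c' p := H a' b' c' a b c p; rewrite -/Y -/X -/F1 -/F2 in HY.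
have HYY := HY a b c 0; rewrite -/Y in HYY.
have HT a' b' c' p := H a' b' c' 1 0 0 p; rewrite -/T -/X -/F1 -/F2 in HT.
clearbody X F1 F2 e Y T.
pose ct (F : RxR2 R -> RxR2 R) p := lie F Y p - e p / s' * lie F T p.
have sct F : smooth_field F -> smooth (ct F).
  move=> sF; rewrite (_ : ct F = fun p => lie F Y p + e p * (- s'^-1) * lie F T p).
    apply: smoothD; first exact: smooth_lie.
    apply: smoothM; last exact: smooth_lie.
    by apply: smoothM => //; exact: smooth_cst.
  by apply/funext => p; rewrite /ct mulrN mulNr.
(* The identity for [T] has right-hand side s' times the second frame component, so subtracting e /
   s' times it removes the frame of S'. A product of two components of X' remains, and both vanish
   at 0. *)
have Hct a' b' c' p :
    lie X (covec a' b' c' \o psi) p * ct X p +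
    lie F1 (covec a' b' c' \o psi) p * ct F1 p +
    lie F2 (covec a' b' c' \o psi) p * ct F2 p =
    covec a' b' c' (vector_field theta S' (psi p)) *
    covec a b c (vector_field theta S' (psi p)).
  have h1 := HY a' b' c' p; have h2 := HT a' b' c' p.
  rewrite bF1 bF2 in h1.
  have t1 : covec 1 0 0 (vector_field theta S' (psi p)) = 0.
    by rewrite /covec /=; ring.
  have t2 : covec 1 0 0 (left_invariant theta (0, w') (psi p)) = 0.
    by rewrite left_invariantE /covec /=; ring.
  have t3 : covec 1 0 0 (left_invariant theta (s', eta') (psi p)) = s'.
    by rewrite left_invariantE /covec /=; ring.
  rewrite t1 t2 t3 in h2.
  transitivity (lie X (covec a' b' c' \o psi) p * lie X Y p +
      lie F1 (covec a' b' c' \o psi) p * lie F1 Y p +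
      lie F2 (covec a' b' c' \o psi) p * lie F2 Y p - e p / s' *
     (lie X (covec a' b' c' \o psi) p * lie X T p +
      lie F1 (covec a' b' c' \o psi) p * lie F1 T p +
      lie F2 (covec a' b' c' \o psi) p * lie F2 T p)).
    rewrite /ct.
    move: (lie X (covec a' b' c' \o psi) p) (lie F1 (covec a' b' c' \o psi) p) => x y.
    move: (lie F2 (covec a' b' c' \o psi) p) => z; move: (lie X Y p) (lie F1 Y p) => k l.
    move: (lie F2 Y p) (lie X T p) (lie F1 T p) (lie F2 T p) (e p) => m n o q r.
    by ring.
  rewrite h1 h2.
  by move: (covec _ _ _ _) (covec _ _ _ _) (covec _ _ _ _) (covec _ _ _ _) => *; field.
have Y0 : [/\ lie F1 Y 0 = 0 & lie F2 Y 0 = 0].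
  have := HYY.
  rewrite bF1 bF2 e0 psi0 vector_field0 linear0 !mulr0 !addr0 -!expr2 => h.
  have q0 (x : R) : 0 <= x ^+ 2 by exact: sqr_ge0.
  have := q0 (lie X Y 0); have := q0 (lie F1 Y 0); have := q0 (lie F2 Y 0) => *.
  by split; apply/eqP; rewrite -sqrf_eq0; apply/eqP; lra.
have ct0 F : lie F Y 0 = 0 -> ct F 0 = 0.
  by rewrite /ct e0 mul0r mul0r subr0.
(* Differentiating [Hct] at 0, where X, [ct F1], [ct F2] and X' vanish, shows that d psi kills this
   combination of the independent vectors (0, w) and (s, eta). *)
have dct L : lie L (ct F1) 0 = 0 /\ lie L (ct F2) 0 = 0.
  suff : lie L (ct F1) 0 *: (0, w) + lie L (ct F2) 0 *: (s, eta) = 0 :> RxR2 R.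
    move=> [/eqP]; rewrite -[_ *: s]/(_ * s) -[_ *: 0]/(_ * 0) mulr0 add0r.
    rewrite mulf_eq0 (negPf s0) orbF => /eqP ->; rewrite scale0r addr0 => /eqP.
    by rewrite scaler_eq0 (negPf w0) orbF => /eqP ->.
  apply: inj; apply: covec_inj => a' b' c'.
  have E := congr1 (fun h => lie L h 0) (funext (Hct a' b' c')).
  rewrite /= in E.
  have sk F : smooth_field F -> smooth (lie F (covec a' b' c' \o psi)).
    by move=> sF; apply: smooth_lie => //; exact: smooth_covec_comp.
  rewrite lie_comb in E; try by [exact: sk|exact: sct].
  rewrite (lieM L (smooth_vector_field_comp theta S' a' b' c' sp)
    (smooth_vector_field_comp theta S' a b c sp)) in E.
  rewrite psi0 vector_field0 !linear0 !mul0r addr0 in E.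
  rewrite (ct0 _ Y0.1) (ct0 _ Y0.2) !mul0r !addr0 in E.
  rewrite (lie_at0 _ X0) mul0r add0r in E.
  rewrite {1}/ct !(lie_at0 _ X0) mulr0 subr0 mul0r add0r in E.
  rewrite !lie_covec_comp// F10 F20 in E.
  rewrite !linearD !linearZ /= -[RHS]E /GRing.scale /=.
  by congr (_ + _); rewrite mulrC.
(* Both second derivatives equal e' / s' times the product of the two derivatives of [T], which is
   symmetric in the fields. *)
have brY : lie F1 (lie F2 Y) 0 = lie F2 (lie F1 Y) 0.
  have h F G : smooth_field F -> lie G (ct F) 0 = 0 ->
      lie G (lie F Y) 0 = e' / s' * lie G T 0 * lie F T 0.
    move=> sF; rewrite /ct.
    have s1 := smoothM see (smooth_cst _ (s'^-1)); have s2 := smooth_lie sF sT.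
    have s3 := smoothM (smooth_cst _ (-1 : R)) (smoothM s1 s2).
    rewrite (_ : (fun p => _) = fun p => lie F Y p + -1 * (e p * s'^-1 * lie F T p)).
      rewrite (lieD G (smooth_lie sF sY) s3) (lieM G (smooth_cst _ (-1 : R)) (smoothM s1 s2)).
      rewrite (lieM G s1 s2) (lieM G see (smooth_cst _ s'^-1)) !lie_cst lie_e e0.
      move: (lie G (lie F Y) 0) (lie G (lie F T) 0) (lie G T 0) (lie F T 0) (e' : R).
      by move=> x0 x1 x2 x3 x4 h; apply/eqP; rewrite -subr_eq0 -h; apply/eqP; ring.
    by apply/funext => p; rewrite mulN1r.
  rewrite (h F2 F1)//; last exact: (dct F1).2.
  by rewrite (h F1 F2)//; [ring|exact: (dct F2).1].
have kill : covec a b c ('d psi 0 (0, theta *m w)) = 0.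
  move: brYE; rewrite brY -[LHS]addr0 => /addrI/esym.
  rewrite /bracket /= scale0r sub0r.
  have -> : (0, - (s *: (theta *m w))) = (- s) *: ((0, theta *m w) : RxR2 R).
    by congr pair; [exact: (esym (mulr0 (- s)))|rewrite /= scaleNr].
  rewrite !linearZ /GRing.scale /= => /eqP.
  by rewrite mulf_eq0 oppr_eq0 (negPf s0) => /eqP.
(* Were w not an eigenvector, (0, w), (0, theta w) and (s, eta) would span the tangent space, and a
   nonzero covector would vanish. *)
apply: contrapT => /eqP d0.
have k1 : covec a b c ('d psi 0 (0, w)) = 0.
  by have := Y0.1; rewrite YE F10.
have k2 : covec a b c ('d psi 0 (s, eta)) = 0.
  by have := Y0.2; rewrite YE F20.
have kv (v : 'cV[R]_2) : covec a b c ('d psi 0 (0, v)) = 0.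
  pose d := det2 w (theta *m w).
  have -> : (0, v) = (det2 v (theta *m w) / d) *: ((0, w) : RxR2 R)
      + (det2 w v / d) *: ((0, theta *m w) : RxR2 R).
    congr pair; first by rewrite /= /GRing.scale /=; ring.
    move: d0; rewrite /d; move: (theta *m w) => z d0.
    by apply: cV2_eq; rewrite !mxE /det2; field.
  by rewrite !linearD !linearZ /= k1 kill !scaler0 addr0.
have kt : covec a b c ('d psi 0 (basis_t R)) = 0.
  have -> : basis_t R = s^-1 *: ((s, eta) : RxR2 R) + (0, - (s^-1 *: eta)).
    congr pair; last by rewrite /= subrr.
    by rewrite /= /GRing.scale /=; field.
  by rewrite !linearD !linearZ /= k2 kv scaler0 addr0.
have all u : covec a b c u = 0.
  have [z <-] := surj u.
  have -> : z = z.1 *: basis_t R + (0, z.2).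
    case: z => x v; congr pair; last by rewrite /= scaler0 add0r.
    by rewrite /= /GRing.scale /=; ring.
  by rewrite !linearD !linearZ /= kt kv scaler0 addr0.
move: w'0; apply/negP; rewrite negbK; apply/eqP/cV2_eq; rewrite mxE.
  by have := all (0, ev2 R); rewrite /covec /= !mxE /= /c mulr0 add0r mulr0 add0r mulr1.
have := all (0, ev1 R); rewrite /covec /= !mxE /= /b !mulr0 add0r addr0 mulr1.
by move=> /eqP; rewrite oppr_eq0 => /eqP.
Qed.

(** * Eigenvalues of theta along and across the line of Delta *)

Definition dot2 (R : realType) (n v : 'cV[R]_2) : R :=
  n 0 0 * v 0 0 + n 1 0 * v 1 0.

(** A left eigenvector [n] that annihilates the line of Delta sees the action of theta on the
    quotient of R^2 by that line. *)
Lemma rho_left_eigen (R : realType) (theta : 'M[R]_2) (n z : 'cV[R]_2) (q t : R) :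
  (forall v, dot2 n (theta *m v) = q * dot2 n v) ->
  dot2 n (rho theta t *m z) = expR (q * t) * dot2 n z.
Proof.
move=> nq; rewrite /dot2 !rho_vE.
rewrite -(egfZ _ _ (vseq_bounded theta z 0)) -(egfZ _ _ (vseq_bounded theta z 1)).
rewrite -egfD; try by apply: exp_boundedZ; exact: vseq_bounded.
have -> : (fun k => n 0 0 * vseq theta z 0 k + n 1 0 * vseq theta z 1 k) =
    (fun k => dot2 n z * q ^+ k).
  apply/funext => k; rewrite /vseq -/(dot2 _ _).
  elim: k => [|k IH]; first by rewrite !expr0 mul1mx mulr1.
  have -> : theta ^+ k.+1 = theta *m theta ^+ k by rewrite exprS.
  by rewrite -mulmxA nq IH exprS; ring.
rewrite egfZ; last by exists 1, `|q| => k; rewrite mul1r normrX.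
rewrite mulrC; congr (_ * _); rewrite /egf /expR; congr (limn _).
apply/funext => m; rewrite /pseries /series /=; apply: eq_bigr => k _.
by rewrite /egf_coef /exp_coeff /= exprMn; ring.
Qed.

(** The transpose of an isomorphism is onto; the coefficients are the values of the given covector
    on the preimages of the basis. *)
Lemma covec_pullback (R : realType) (f : {linear RxR2 R -> RxR2 R}) (a b c : R) :
  (forall u, f u = 0 -> u = 0) -> (forall z, exists u, f u = z) ->
  exists a' b' c', forall u, covec a' b' c' (f u) = covec a b c u.
Proof.
move=> inj surj; have [u0 E0] := surj (basis_t R); have [u1 E1] := surj (basis_x R).
have [u2 E2] := surj (basis_y R).
exists (covec a b c u0), (covec a b c u1), (covec a b c u2) => u.
have fv (y : RxR2 R) : f (y.1 *: u0 + y.2 0 0 *: u1 + y.2 1 0 *: u2) = y.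
  by rewrite [RHS]RxR2_basis -E0 -E1 -E2 !linearD !linearZ.
have uE : u = (f u).1 *: u0 + (f u).2 0 0 *: u1 + (f u).2 1 0 *: u2.
  by apply/eqP; rewrite -subr_eq0; apply/eqP/inj; rewrite linearB fv subrr.
rewrite [in RHS]uE; move: (f u) => y.
rewrite [RHS]linearD [X in _ = X + _]linearD !linearZ /=.
by rewrite {1}/covec /GRing.scale /=; ring.
Qed.

Lemma lie_comb_eq (R : realType) (L : RxR2 R -> RxR2 R)
    (h0 h1 h2 d0 d1 d2 f : RxR2 R -> R) (p : RxR2 R) :
  smooth h0 -> smooth h1 -> smooth h2 -> smooth d0 -> smooth d1 -> smooth d2 ->
  (forall q, h0 q * d0 q + h1 q * d1 q + h2 q * d2 q = f q) ->
  h0 p * lie L d0 p + d0 p * lie L h0 p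
  + (h1 p * lie L d1 p + d1 p * lie L h1 p)
  + (h2 p * lie L d2 p + d2 p * lie L h2 p) = lie L f p.
Proof.
by move=> sh0 sh1 sh2 sd0 sd1 sd2 E; rewrite -lie_comb//; congr (lie L _ p); exact/funext.
Qed.

(** At a zero of [g] few Leibniz terms survive; the third derivative of the square is the first in
    which a second derivative of [g] appears. *)
Lemma lie_sqr (R : realType) (F : RxR2 R -> RxR2 R) (g : RxR2 R -> R) (p : RxR2 R) :
  smooth_field F -> smooth g -> g p = 0 ->
  lie F (lie F (fun q => g q * g q)) p = 2 * lie F g p ^+ 2 /\
  lie F (lie F (lie F (fun q => g q * g q))) p =
    6 * lie F g p * lie F (lie F g) p.
Proof.
move=> sF sg g0; have s1 := smooth_lie sF sg; have s2 := smooth_lie sF s1.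
have s3 := smooth_lie sF s2.
rewrite (lieM F sg sg) (lieD F (smoothM sg s1) (smoothM sg s1)) !(lieM F sg s1).
split; first by rewrite g0; ring.
rewrite (lieD F (smoothD (smoothM sg s2) (smoothM s1 s1)) (smoothD (smoothM sg s2) (smoothM s1 s1))).
rewrite (lieD F (smoothM sg s2) (smoothM s1 s1)) (lieM F sg s2) (lieM F s1 s1) g0.
move: (lie F g p) (lie F (lie F g) p) (lie F (lie F (lie F g)) p) => x y z.
by ring.
Qed.

Lemma lie_line (R : realType) (F : RxR2 R -> RxR2 R) (g : RxR2 R -> R)
    (u : RxR2 R) : smooth g -> (forall x, F (x *: u) = u) ->
  forall x : R, is_derive x 1 (fun s : R => g (s *: u)) (lie F g (x *: u)).
Proof.
move=> sg Fu x; have dg := smooth_differentiable (x *: u) sg.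
have := @is_derive_line R _ _ g 0 u x; rewrite add0r => /(_ dg).
rewrite lie.unlock Fu deriveE//.
by rewrite (_ : (fun s => _) = fun s : R => g (s *: u))//; apply/funext => s; rewrite add0r.
Qed.

Lemma lie_line_eq0 (R : realType) (F : RxR2 R -> RxR2 R) (g : RxR2 R -> R)
    (u : RxR2 R) (k : R) : smooth g -> (forall x, F (x *: u) = u) ->
  (forall x, g (x *: u) = k) -> forall x, lie F g (x *: u) = 0.
Proof.
move=> sg Fu gk x; have [_ <-] := lie_line sg Fu x.
have -> : (fun s : R => g (s *: u)) = fun=> k by apply/funext => s; exact: gk.
by rewrite derive_cst.
Qed.

Lemma line_eq0 (R : realType) (F : RxR2 R -> RxR2 R) (g : RxR2 R -> R)
    (u : RxR2 R) : smooth g -> (forall x, F (x *: u) = u) -> g 0 = 0 ->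
  (forall x, lie F g (x *: u) = 0) -> forall x, g (x *: u) = 0.
Proof.
move=> sg Fu g0 lg x.
have d (y : R) : is_derive y 1 (fun s : R => g (s *: u)) 0.
  by rewrite -(lg y); exact: lie_line.
have gz : g (0 *: u) = 0 by rewrite scale0r.
case: (ltrgtP 0 x) => [x0|x0|<-//].
  have [c _] := MVT_is_derive x0 d; rewrite gz subr0 => ->.
  by rewrite mul0r.
have [c _] := MVT_is_derive x0 d; rewrite gz sub0r mul0r => /eqP.
by rewrite oppr_eq0 => /eqP.
Qed.

Lemma dot_rho_comp (R : realType) (theta : 'M[R]_2) (n z : 'cV[R]_2)
    (g : RxR2 R -> R) : smooth g ->
  smooth (fun p => dot2 n (rho theta (g p) *m z)) /\
  forall F, lie F (fun p => dot2 n (rho theta (g p) *m z)) =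
    fun p => dot2 n (rho theta (g p) *m (theta *m z)) * lie F g p.
Proof.
move=> sg; have s i := smoothM (smooth_cst _ (n i 0)) (smooth_rho_comp theta z i sg).
split=> [|F]; first exact: smoothD.
rewrite (lieD F (s 0) (s 1)).
rewrite (lieM F (smooth_cst _ (n 0 0)) (smooth_rho_comp theta z 0 sg)).
rewrite (lieM F (smooth_cst _ (n 1 0)) (smooth_rho_comp theta z 1 sg)).
by apply/funext => p; rewrite !lie_cst !lie_rho_comp// /dot2; ring.
Qed.

Lemma dot_Lambda_comp (R : realType) (theta : 'M[R]_2) (n z : 'cV[R]_2)
    (g : RxR2 R -> R) : smooth g ->
  smooth (fun p => dot2 n (Lambda theta (g p) z)) /\
  forall F, lie F (fun p => dot2 n (Lambda theta (g p) z)) =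
    fun p => dot2 n (rho theta (g p) *m z) * lie F g p.
Proof.
move=> sg; have s i := smoothM (smooth_cst _ (n i 0)) (smooth_Lambda_comp theta z i sg).
split=> [|F]; first exact: smoothD.
rewrite (lieD F (s 0) (s 1)).
rewrite (lieM F (smooth_cst _ (n 0 0)) (smooth_Lambda_comp theta z 0 sg)).
rewrite (lieM F (smooth_cst _ (n 1 0)) (smooth_Lambda_comp theta z 1 sg)).
by apply/funext => p; rewrite !lie_cst !lie_Lambda_comp// /dot2; ring.
Qed.

Lemma lie_comb_field (R : realType) (F G H : RxR2 R -> RxR2 R) (g : RxR2 R -> R)
    (p : RxR2 R) (a b : R) :
  F p = a *: G p + b *: H p -> lie F g p = a * lie G g p + b * lie H g p.
Proof. by move=> E; rewrite lie.unlock E linearD !linearZ. Qed.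

(* [r] and [q] are the eigenvalues of theta on and transversally to the line
   [w] of [Delta], and [t] is the derivative of the first coordinate of [psi]
   along the unit field [F2] orthogonal to that line. On the line spanned by
   [(0, w)], which lies in the singular locus, the identities between the
   components of the cometric give [r] after one derivative along [F2]; [q] comes
   from the third derivative of the identity for [Y], the two sides of which
   vanish to second order. *)
Lemma isometry_eigenvalues (R : realType) (theta : 'M[R]_2) (S S' : ARS R)
    (w eta w' n' m' : 'cV[R]_2) (s sigma r q d a r' q' b' : R)
    (psi : RxR2 R -> RxR2 R) :
  diffeomorphism psi -> psi 0 = 0 ->
  cometric_map theta S S' (0, w) (s, eta) (1, 0) (sigma, w') psi ->
  w != 0 -> s != 0 -> theta *m w = r *: w -> ars_A S *m w = a *: w ->
  ars_A S *m theta = theta *m ars_A S ->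
  theta *m (s *: ars_xi S + ars_A S *m eta) =
    q *: (s *: ars_xi S + ars_A S *m eta) + d *: w ->
  theta *m w' = r' *: w' -> dot2 m' w' = 1 -> dot2 n' w' = 0 ->
  (forall v, dot2 n' (theta *m v) = q' * dot2 n' v) ->
  (forall v, dot2 n' (ars_A S' *m v) = b' * dot2 n' v) ->
  dot2 n' (ars_xi S') != 0 ->
  exists2 t, t != 0 & s * r = t * r' /\ s * q = t * q'.
Proof.
move=> dpsi psi0 H w0 s0 tw Aw AC tk tw' mw' nw' nt nA nxi.
(* [kappa] is the R^2 component of D (s, eta), so that [F2, X] = [V]. *)
set kappa := s *: ars_xi S + _ in tk.
have sp := dpsi.1.
pose X := vector_field theta S.
pose F1 := left_invariant theta (0, w); pose F2 := left_invariant theta (s, eta).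
pose V := left_invariant theta (0, kappa).
(* Pullbacks of three linear functions on the target: time, a function equal to 1 on w', and one
   that kills w'. [M] and [L] are the corresponding components of X'. *)
pose T := covec 1 0 0 \o psi; pose U := covec 0 (m' 0 0) (m' 1 0) \o psi.
pose Y := covec 0 (n' 0 0) (n' 1 0) \o psi.
pose M (p : RxR2 R) := covec 0 (m' 0 0) (m' 1 0) (vector_field theta S' (psi p)).
pose L (p : RxR2 R) := covec 0 (n' 0 0) (n' 1 0) (vector_field theta S' (psi p)).
have sX : smooth_field X by exact: smooth_vector_field.
have sF1 : smooth_field F1 by exact: smooth_left_invariant.
have sF2 : smooth_field F2 by exact: smooth_left_invariant.
have sV : smooth_field V by exact: smooth_left_invariant.
have sT : smooth T by exact: smooth_covec_comp.
have sU : smooth U by exact: smooth_covec_comp.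
have sY : smooth Y by exact: smooth_covec_comp.
have sM : smooth M by exact: smooth_vector_field_comp.
have sL : smooth L by exact: smooth_vector_field_comp.
have TE p : (psi p).1 = T p by rewrite /T /covec /=; ring.
have cdot (x : R) (n v : 'cV[R]_2) : covec 0 (n 0 0) (n 1 0) (x, v) = dot2 n v.
  by rewrite /covec /dot2 /=; ring.
have T1 p : covec 1 0 0 (left_invariant theta (1, 0) (psi p)) = 1.
  by rewrite left_invariantE /covec /=; ring.
have T2 p : covec 1 0 0 (left_invariant theta (sigma, w') (psi p)) = sigma.
  by rewrite left_invariantE /covec /=; ring.
have T3 p : covec 1 0 0 (vector_field theta S' (psi p)) = 0.
  by rewrite /covec /=; ring.
pose Ex (p : RxR2 R) := dot2 m' (rho theta (T p) *m w').
have U1 p : covec 0 (m' 0 0) (m' 1 0) (left_invariant theta (1, 0) (psi p)) = 0.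
  by rewrite left_invariantE cdot mulmx0 /dot2 !mxE; ring.
have U2 p : covec 0 (m' 0 0) (m' 1 0) (left_invariant theta (sigma, w') (psi p))
    = Ex p.
  by rewrite left_invariantE cdot TE.
have Y1 p : covec 0 (n' 0 0) (n' 1 0) (left_invariant theta (1, 0) (psi p)) = 0.
  by rewrite left_invariantE cdot mulmx0 /dot2 !mxE; ring.
have Y2 p : covec 0 (n' 0 0) (n' 1 0) (left_invariant theta (sigma, w') (psi p)) = 0.
  by rewrite left_invariantE cdot (rho_left_eigen _ _ nt) nw' mulr0.
pose E (p : RxR2 R) := dot2 n' (rho theta (T p) *m ars_xi S').
have lL F : lie F L = fun p => b' * lie F Y p + E p * lie F T p.
  have [sN lN] := dot_Lambda_comp theta n' (ars_xi S') sT.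
  have sb : smooth (fun _ : RxR2 R => b') by exact: smooth_cst.
  have -> : L = fun p => b' * Y p + dot2 n' (Lambda theta (T p) (ars_xi S')).
    apply/funext => p; rewrite /L.
    have -> : vector_field theta S' (psi p) =
        (0, ars_A S' *m (psi p).2 + Lambda theta (T p) (ars_xi S')).
      by rewrite -TE.
    rewrite cdot; have -> : Y p = dot2 n' (psi p).2 by rewrite /Y /covec /dot2 /=; ring.
    by rewrite -nA /dot2 !mxE; ring.
  rewrite (lieD F (smoothM sb sY) sN) (lieM F sb sY) lN lie_cst.
  by apply/funext => p; rewrite /E; ring.
have X0 : X 0 = 0 by exact: vector_field0.
have F10 : F1 0 = (0, w) by exact: left_invariant0.
have F20 : F2 0 = (s, eta) by exact: left_invariant0.
have T0 : T 0 = 0 by rewrite /T /= psi0 linear0.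
have Y0 : Y 0 = 0 by rewrite /Y /= psi0 linear0.
have M0 : M 0 = 0 by rewrite /M psi0 vector_field0 linear0.
have L0 : L 0 = 0 by rewrite /L psi0 vector_field0 linear0.
have [sEx lEx'] := dot_rho_comp theta m' w' sT; rewrite -/Ex in sEx lEx'.
have [sE lE'] := dot_rho_comp theta n' (ars_xi S') sT; rewrite -/E in sE lE'.
have lEx F : lie F Ex 0 = r' * lie F T 0.
  rewrite lEx' T0 rho0 mul1mx tw'; congr (_ * _).
  by rewrite -[RHS]mulr1 -mw' /dot2 !mxE; ring.
have lE F : lie F E 0 = q' * dot2 n' (ars_xi S') * lie F T 0.
  by rewrite lE' T0 rho0 mul1mx nt.
have E0 : E 0 = dot2 n' (ars_xi S') by rewrite /E T0 rho0 mul1mx.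
have Ex0 p : T p = 0 -> Ex p = 1 by move=> Tp; rewrite /Ex Tp rho0 mul1mx.
have En p : E p != 0.
  by rewrite /E (rho_left_eigen _ _ nt) mulf_neq0// gt_eqF// expR_gt0.
pose u : RxR2 R := (0, w).
have lineF x : F1 (x *: u) = u.
  by rewrite /F1 left_invariantE /u /= -[_ *: 0]/(_ * 0) mulr0 rho0 mul1mx.
have lineX x : X (x *: u) = (x * a) *: u.
  rewrite /X /vector_field /linear_field /u /= -[_ *: 0]/(_ * 0) mulr0 Lambda0 addr0.
  by rewrite -scalemxAr Aw scalerA; congr pair; exact: (esym (mulr0 _)).
have sq0 (x y z : R) : x ^+ 2 + y ^+ 2 + z ^+ 2 = 0 -> [/\ x = 0, y = 0 & z = 0].
  move=> h; have := sqr_ge0 x; have := sqr_ge0 y; have := sqr_ge0 z => *.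
  by split; apply/eqP; rewrite -sqrf_eq0; apply/eqP; lra.
(* On this line X is tangent to Delta, so some nonzero covector kills the whole source frame. Its
   transport kills the target frame and X'; killing (1, 0) and (sigma, w') makes it a multiple of
   n', whence [L] vanishes. *)
have lineL x : L (x *: u) = 0.
  set p := x *: u; have [inj surj] := diffeomorphism_diff p dpsi.
  pose k0 := - (- w 1 0 * eta 0 0 + w 0 0 * eta 1 0) / s.
  have [al [be [ga B]]] := covec_pullback k0 (- w 1 0) (w 0 0) inj surj.
  have Bu y : covec k0 (- w 1 0) (w 0 0) (y *: u) = 0.
    by rewrite /u /covec /= !mxE -[_ *: 0]/(_ * 0); ring.
  have BL F : lie F (covec al be ga \o psi) p = covec k0 (- w 1 0) (w 0 0) (F p).
    by rewrite (lie_covec_comp _ _ _ F sp); exact: B.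
  have := H al be ga al be ga p.
  rewrite !BL.
  rewrite -/X -/F1 -/F2 lineX lineF Bu -[X in covec k0 _ _ X]scale1r Bu.
  have -> : covec k0 (- w 1 0) (w 0 0) (F2 p) = 0.
    rewrite /F2 left_invariantE /p /u /= -[_ *: 0]/(_ * 0) mulr0 rho0 mul1mx.
    by rewrite /covec /k0 /=; field.
  rewrite !mulr0 !addr0 -!expr2 => /esym/sq0[BX B1 B2].
  have al0 : al = 0.
    by move: B1; rewrite left_invariantE mulmx0 /covec /= !mxE !mulr0 !addr0 mulr1.
  have Bw : be * w' 0 0 + ga * w' 1 0 = 0.
    move: B2; rewrite left_invariantE /= (rho_eigen _ tw') /covec al0 /= !mxE.
    rewrite mul0r add0r => /eqP; set ex := expR _.
    rewrite (_ : _ + _ = ex * (be * w' 0 0 + ga * w' 1 0)); last by ring.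
    by rewrite mulf_eq0 gt_eqF ?expR_gt0//= => /eqP.
  have det0 : n' 0 0 * ga = n' 1 0 * be.
    apply/eqP; rewrite -subr_eq0; apply/eqP; rewrite -[LHS]mulr1 -mw'.
    transitivity (m' 0 0 * (ga * dot2 n' w' - n' 1 0 * (be * w' 0 0 + ga * w' 1 0))
      + m' 1 0 * (n' 0 0 * (be * w' 0 0 + ga * w' 1 0) - be * dot2 n' w')).
      by rewrite /dot2; ring.
    by rewrite nw' Bw !mulr0 subrr !mulr0 addr0.
  move: BX; rewrite al0 /covec mul0r add0r => BX.
  rewrite /L /covec mul0r add0r.
  set Lx := (vector_field _ _ _).2 0 0 in BX *.
  set Ly := (vector_field _ _ _).2 1 0 in BX *.
  apply/eqP/negPn/negP => Lne.
  have be0 : be = 0.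
    apply: (mulIf Lne); rewrite mul0r.
    transitivity (n' 0 0 * (be * Lx + ga * Ly) + (n' 1 0 * be - n' 0 0 * ga) * Ly).
      by ring.
    by rewrite BX det0 subrr mulr0 mul0r addr0.
  have ga0 : ga = 0.
    apply: (mulIf Lne); rewrite mul0r.
    transitivity (n' 1 0 * (be * Lx + ga * Ly) + (n' 0 0 * ga - n' 1 0 * be) * Lx).
      by ring.
    by rewrite BX det0 subrr mulr0 mul0r addr0.
  move: w0; apply/negP; rewrite negbK; apply/eqP/cV2_eq; rewrite mxE.
    have := B (0, ev2 R); rewrite al0 be0 ga0 /covec /= !mxE /= => h.
    by apply/esym; move: h; rewrite !mul0r !addr0 !mulr0 !add0r mulr1.
  have := B (0, ev1 R); rewrite al0 be0 ga0 /covec /= !mxE /= => h.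
  apply/eqP; rewrite -oppr_eq0; apply/eqP/esym.
  by move: h; rewrite !mul0r !mulr0 !addr0 !add0r mulr1.
have br1 g : smooth g -> lie F2 (lie F1 g) 0 = lie F1 (lie F2 g) 0 + s * r * lie F1 g 0.
  move=> sg; rewrite (lie_left_invariant_bracket theta (s, eta) (0, w) 0 sg).
  congr (_ + _); rewrite (@lie_comb_field _ _ F1 F1 g 0 (s * r) 0) ?mul0r ?addr0//.
  rewrite left_invariant0 F10 /bracket /= scale0r subr0 scale0r addr0 tw scalerA.
  by congr pair; exact: (esym (mulr0 _)).
have brX g : smooth g -> lie F2 (lie X g) = fun p => lie X (lie F2 g) p + lie V g p.
  move=> sg; apply/funext => p.
  by rewrite (lie_left_invariant_vector_field (s, eta) p AC sg).
have brV g : smooth g -> lie F2 (lie V g) 0 =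
    lie V (lie F2 g) 0 + s * (q * lie V g 0 + d * lie F1 g 0).
  move=> sg; rewrite (lie_left_invariant_bracket theta (s, eta) (0, kappa) 0 sg).
  congr (_ + _); rewrite (@lie_comb_field _ _ V F1 g 0 (s * q) (s * d)).
    by rewrite mulrDr !mulrA.
  rewrite /V !left_invariant0 F10 /bracket /= scale0r subr0 tk scalerDr !scalerA.
  by congr pair; rewrite /= /GRing.scale /=; ring.
have HTT p : lie X T p * lie X T p + lie F1 T p * lie F1 T p + lie F2 T p * lie F2 T p
    = 1 + sigma ^+ 2.
  by have := H 1 0 0 1 0 0 p; rewrite T1 T2 T3 => ->; ring.
have HTU p : lie X T p * lie X U p + lie F1 T p * lie F1 U p + lie F2 T p * lie F2 U p
    = sigma * Ex p.
  by have := H 1 0 0 0 (m' 0 0) (m' 1 0) p; rewrite T1 T2 T3 U1 U2 => ->; ring.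
have HUU p : lie X U p * lie X U p + lie F1 U p * lie F1 U p + lie F2 U p * lie F2 U p
    = Ex p * Ex p + M p * M p.
  have := H 0 (m' 0 0) (m' 1 0) 0 (m' 0 0) (m' 1 0) p.
  by rewrite U1 U2 -/(M p) => ->; ring.
have HTY p : lie X T p * lie X Y p + lie F1 T p * lie F1 Y p + lie F2 T p * lie F2 Y p = 0.
  by have := H 1 0 0 0 (n' 0 0) (n' 1 0) p; rewrite T1 T2 T3 Y1 Y2 => ->; ring.
have HUY p : lie X U p * lie X Y p + lie F1 U p * lie F1 Y p + lie F2 U p * lie F2 Y p
    = M p * L p.
  have := H 0 (m' 0 0) (m' 1 0) 0 (n' 0 0) (n' 1 0) p.
  by rewrite U1 U2 Y1 Y2 -/(M p) -/(L p) => ->; ring.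
have HYY p : lie X Y p * lie X Y p + lie F1 Y p * lie F1 Y p + lie F2 Y p * lie F2 Y p
    = L p * L p.
  have := H 0 (n' 0 0) (n' 1 0) 0 (n' 0 0) (n' 1 0) p.
  by rewrite Y1 Y2 -/(L p) => ->; ring.
clear H T1 T2 T3 U1 U2 Y1 Y2 TE.
clear lEx' lE'.
clearbody X F1 F2 V T U Y M L E Ex u.
have lF1Y x : lie F1 Y (x *: u) = 0.
  by have := HYY (x *: u); rewrite lineL mul0r -!expr2 => /sq0[].
(* [L] is constant along the line and its derivative there is [E] times that of [T], with [E]
   nowhere zero. *)
have lF1T x : lie F1 T (x *: u) = 0.
  have := lie_line_eq0 sL lineF lineL x; rewrite lL lF1Y mulr0 add0r => /eqP.
  by rewrite mulf_eq0 (negPf (En _)) => /eqP.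
have Tl x : T (x *: u) = 0 by exact: line_eq0 sT lineF T0 lF1T x.
have lXT x : lie X T (x *: u) = 0.
  rewrite (@lie_comb_field _ X F1 F1 T (x *: u) (x * a) 0) ?lF1T ?mulr0 ?addr0//.
  by rewrite lineX lineF scale0r addr0.
have at0 g : (forall x, g (x *: u) = 0 :> R) -> g 0 = 0.
  by move=> gu; rewrite -(scale0r u) gu.
have aF1T := at0 _ lF1T; have aXT := at0 _ lXT; have aF1Y := at0 _ lF1Y.
have sF2T := smooth_lie sF2 sT; have sF2U := smooth_lie sF2 sU; have sF2Y := smooth_lie sF2 sY.
have sF1T := smooth_lie sF1 sT; have sF1U := smooth_lie sF1 sU; have sF1Y := smooth_lie sF1 sY.
have sXT := smooth_lie sX sT; have sXU := smooth_lie sX sU; have sXY := smooth_lie sX sY.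
have sVY := smooth_lie sV sY.
have aX g : lie X g 0 = 0 by exact: lie_at0.
(* With t and y the derivatives of [T] and [U] along [F2], the line satisfies t^2 = 1 + sigma^2 and
   t y = sigma, so t and y are constant along it. *)
have ttl x : lie F2 T (x *: u) * lie F2 T (x *: u) = 1 + sigma ^+ 2.
  by have := HTT (x *: u); rewrite lF1T lXT !mul0r !add0r.
have tul x : lie F2 T (x *: u) * lie F2 U (x *: u) = sigma.
  by have := HTU (x *: u); rewrite lF1T lXT !mul0r !add0r Ex0// mulr1.
have tt0 : lie F2 T 0 * lie F2 T 0 = 1 + sigma ^+ 2 by rewrite -(ttl 0) scale0r.
have tu0 : lie F2 T 0 * lie F2 U 0 = sigma by rewrite -(tul 0) scale0r.
have tn : lie F2 T 0 != 0.
  apply/eqP => t0; move: tt0; rewrite t0 mul0r => /eqP; apply/negP.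
  by rewrite lt_eqF// ltr_pwDl// sqr_ge0.
have f12T : lie F1 (lie F2 T) 0 = 0.
  have := lie_line_eq0 (smoothM sF2T sF2T) lineF ttl 0.
  rewrite scale0r (lieM F1 sF2T sF2T) -mulr2n => /eqP.
  by rewrite mulrn_eq0 /= mulf_eq0 (negPf tn) => /eqP.
have f12U : lie F1 (lie F2 U) 0 = 0.
  have := lie_line_eq0 (smoothM sF2T sF2U) lineF tul 0.
  rewrite scale0r (lieM F1 sF2T sF2U) f12T mulr0 addr0 => /eqP.
  by rewrite mulf_eq0 (negPf tn) => /eqP.
have f21T : lie F2 (lie F1 T) 0 = 0 by rewrite br1// f12T aF1T mulr0 addr0.
have f21U : lie F2 (lie F1 U) 0 = s * r * lie F1 U 0 by rewrite br1// f12U add0r.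
have f22T : lie F2 (lie F2 T) 0 = 0.
  have := lie_comb_eq F2 0 sXT sF1T sF2T sXT sF1T sF2T HTT.
  rewrite lie_cst aX aF1T !mul0r !add0r -mulr2n => /eqP.
  by rewrite mulrn_eq0 /= mulf_eq0 (negPf tn) => /eqP.
have f22U : lie F2 (lie F2 U) 0 = sigma * r'.
  have := lie_comb_eq F2 0 sXT sF1T sF2T sXU sF1U sF2U HTU.
  rewrite (lieM F2 (smooth_cst _ sigma) sEx) lie_cst lEx f22T f21T !aX aF1T.
  rewrite !mul0r !mulr0 !add0r !addr0 => h.
  by apply: (mulfI tn); rewrite h; ring.
have f1U : lie F2 T 0 ^+ 2 * lie F1 U 0 ^+ 2 = 1.
  have := HUU 0; rewrite aX mul0r add0r M0 mulr0 addr0 Ex0// mulr1 => h.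
  rewrite -!expr2 in h; rewrite (_ : lie F1 U 0 ^+ 2 = 1 - lie F2 U 0 ^+ 2); last first.
    by rewrite -h addrK.
  rewrite mulrBr mulr1 -exprMn tu0 (_ : lie F2 T 0 ^+ 2 = 1 + sigma ^+ 2) ?addrK//.
exists (lie F2 T 0) => //; split.
  (* With x the derivative of [U] along [F1], this gives s r x^2 + y sigma r' = r' t. Multiplying by
     t^2 and using t^2 x^2 = 1, t y = sigma and t^2 = 1 + sigma^2 leaves s r = t r'. *)
  have := lie_comb_eq F2 0 sXU sF1U sF2U sXU sF1U sF2U HUU.
  rewrite (lieD F2 (smoothM sEx sEx) (smoothM sM sM)) (lieM F2 sEx sEx).
  rewrite (lieM F2 sM sM) lEx f22U f21U aX M0 Ex0// !mul0r !addr0 add0r !mul1r => h.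
  have h' : s * r * lie F1 U 0 ^+ 2 + lie F2 U 0 * sigma * r' = r' * lie F2 T 0.
    by apply: (mulIf (x := 2)); rewrite ?pnatr_eq0//; lra.
  move: f1U h' tu0 tt0.
  move: (lie F1 U 0) (lie F2 U 0) (lie F2 T 0) => x y t f1U h' tu0 tt0.
  rewrite -[LHS]mulr1 -f1U.
  have -> : s * r * (t ^+ 2 * x ^+ 2) = t ^+ 2 * (s * r * x ^+ 2) by ring.
  have -> : s * r * x ^+ 2 = r' * t - y * sigma * r' by rewrite -h' addrK.
  have -> : t ^+ 2 * (r' * t - y * sigma * r') = t * r' * (t * t - t * y * sigma) by ring.
  by rewrite tt0 tu0 expr2 addrK mulr1.
have f1Un : lie F1 U 0 != 0.
  by apply/eqP => z; move: f1U; rewrite z expr0n mulr0 => /eqP; rewrite eq_sym oner_eq0.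
have aF2Y : lie F2 Y 0 = 0.
  by have := HYY 0; rewrite L0 mul0r -!expr2 => /sq0[].
have f22Y : lie F2 (lie F2 Y) 0 = 0.
  have := lie_comb_eq F2 0 sXT sF1T sF2T sXY sF1Y sF2Y HTY.
  rewrite lie_cst !aX aF1T aF1Y aF2Y !mul0r !add0r addr0 => /eqP.
  by rewrite mulf_eq0 (negPf tn) => /eqP.
have f21Y : lie F2 (lie F1 Y) 0 = 0.
  have := lie_comb_eq F2 0 sXU sF1U sF2U sXY sF1Y sF2Y HUY.
  rewrite (lieM F2 sM sL) M0 L0 !aX aF1Y aF2Y f22Y !mul0r mulr0 !add0r !addr0 => /eqP.
  by rewrite mulf_eq0 (negPf f1Un) => /eqP.
have v2Y : lie V (lie F2 Y) 0 = 0.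
  have := lie_comb_eq V 0 sXT sF1T sF2T sXY sF1Y sF2Y HTY.
  rewrite lie_cst !aX aF1T aF1Y aF2Y !mul0r !add0r addr0 => /eqP.
  by rewrite mulf_eq0 (negPf tn) => /eqP.
(* X vanishes at 0, so only the commutator [F2, X] = [V] contributes. *)
have f2C : lie F2 (lie X Y) 0 = lie V Y 0 by rewrite brX// aX add0r.
have f22C : lie F2 (lie F2 (lie X Y)) 0 = s * q * lie V Y 0.
  rewrite (brX _ sY) (lieD F2 (smooth_lie sX sF2Y) sVY) (brX _ sF2Y) aX v2Y brV// v2Y aF1Y.
  by ring.
have f2L : lie F2 L 0 = dot2 n' (ars_xi S') * lie F2 T 0.
  by rewrite lL aF2Y E0; ring.
have f22L : lie F2 (lie F2 L) 0 = dot2 n' (ars_xi S') * q' * lie F2 T 0 ^+ 2.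
  rewrite (lL F2) (lieD F2 (smoothM (smooth_cst _ b') sF2Y) (smoothM sE sF2T)).
  rewrite (lieM F2 (smooth_cst _ b') sF2Y) (lieM F2 sE sF2T) lie_cst lE f22Y f22T.
  by ring.
have [C2 C3] := lie_sqr sF2 sXY (aX Y).
have [B2 B3] := lie_sqr sF2 sF1Y aF1Y.
have [A2 A3] := lie_sqr sF2 sF2Y aF2Y.
have [L2 L3] := lie_sqr sF2 sL L0.
have EYY : (fun p => lie X Y p * lie X Y p + lie F1 Y p * lie F1 Y p
    + lie F2 Y p * lie F2 Y p) = fun p => L p * L p by exact: funext.
have split3 f g h : smooth f -> smooth g -> smooth h ->
    lie F2 (fun p => f p + g p + h p) = fun p => lie F2 f p + lie F2 g p + lie F2 h p.
  by move=> sf sg sh; rewrite (lieD F2 (smoothD sf sg) sh) (lieD F2 sf sg).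
have Q0 := smoothM sXY sXY; have Q1 := smoothM sF1Y sF1Y; have Q2 := smoothM sF2Y sF2Y.
have P0 := smooth_lie sF2 Q0; have P1 := smooth_lie sF2 Q1; have P2 := smooth_lie sF2 Q2.
have O0 := smooth_lie sF2 P0; have O1 := smooth_lie sF2 P1; have O2 := smooth_lie sF2 P2.
have E2 := congr1 (fun h => lie F2 (lie F2 h) 0) EYY.
have E3 := congr1 (fun h => lie F2 (lie F2 (lie F2 h)) 0) EYY.
rewrite /= (split3 _ _ _ Q0 Q1 Q2) (split3 _ _ _ P0 P1 P2) in E2 E3.
rewrite (split3 _ _ _ O0 O1 O2) C3 B3 A3 L3 in E3; rewrite C2 B2 A2 L2 in E2.
rewrite f2C f2L f21Y f22Y in E2; rewrite f2C f22C f2L f22L f21Y f22Y in E3.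
(* The second derivative now reads v^2 = (x t)^2, which is nonzero, and the third one s q v^2 = t q'
   (x t)^2. *)
move: E2 E3 tn nxi; move: (lie V Y 0) (lie F2 T 0) (dot2 _ _) => v t x E2 E3 tn xn.
have v2 : v ^+ 2 = x ^+ 2 * t ^+ 2.
  by apply: (mulfI (x := 2)); rewrite ?pnatr_eq0// -exprMn; lra.
have xt : x ^+ 2 * t ^+ 2 != 0 by rewrite mulf_neq0// sqrf_eq0.
apply: (mulIf xt); rewrite -{1}v2.
apply: (mulfI (x := 6)); rewrite ?pnatr_eq0//.
rewrite (_ : 6 * (t * q' * (x ^+ 2 * t ^+ 2)) = 6 * (x * t) * (x * q' * t ^+ 2)); last by ring.
by rewrite -E3; ring.
Qed.
(** * Automorphisms *)

Lemma LambdaD (R : realType) (theta : 'M[R]_2) (t : R) (y z : 'cV[R]_2) :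
  Lambda theta t (y + z) = Lambda theta t y + Lambda theta t z.
Proof.
apply/matrixP => i j; rewrite (ord1 j) [RHS]mxE !LambdaE -egfD; try
  by apply: int_seq_bounded; exact: vseq_bounded.
congr (egf _ t); apply/funext => -[|k] /=; first by rewrite addr0.
by rewrite /vseq mulmxDr mxE.
Qed.

Lemma LambdaZ (R : realType) (theta : 'M[R]_2) (t c : R) (z : 'cV[R]_2) :
  Lambda theta t (c *: z) = c *: Lambda theta t z.
Proof.
rewrite -!mul_scalar_mx -{1}[t]mul1r Lambda_intertwine ?scale1r//.
by rewrite scalar_mxC.
Qed.

Lemma smooth_scalel (R : realType) (V W : normedModType R) (g : V -> R) (e : W) :
  smooth g -> smooth (fun p => g p *: e).
Proof.
move=> sg k; elim: k g sg => [|k IH] g sg.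
  move=> p; apply: cvgZr_tmp.
  exact: (differentiable_continuous (smooth_differentiable p sg)).
split=> [p|v]; first exact/differentiableZl/smooth_differentiable.
rewrite (_ : 'D_v _ = fun p => 'D_v g p *: e); first exact/IH/smooth_D.
apply/funext => p; have dg := smooth_differentiable p sg.
by rewrite deriveE ?diffZl//= -?deriveE//; exact: differentiableZl.
Qed.

Lemma smooth_RxR2 (R : realType) (psi : RxR2 R -> RxR2 R) :
  smooth_field psi -> smooth psi.
Proof.
move=> [s0 s1 s2].
have -> : psi = fun p => (psi p).1 *: basis_t R + (psi p).2 0 0 *: basis_x R + (psi p).2 1 0 *: basis_y R.
  by apply/funext => p; rewrite -RxR2_basis.
by apply: smoothD; [apply: smoothD|]; exact: smooth_scalel.
Qed.

Definition aut (R : realType) (theta P : 'M[R]_2) (e : R) (zeta : 'cV[R]_2)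
    (p : RxR2 R) : RxR2 R :=
  (e * p.1, P *m p.2 + Lambda theta (e * p.1) zeta).

(** The differential of [aut] at the identity, hence the induced map of the Lie algebra. *)
Definition aut_diff (R : realType) (P : 'M[R]_2) (e : R) (zeta : 'cV[R]_2)
    (Y : RxR2 R) : RxR2 R :=
  (e * Y.1, P *m Y.2 + (e * Y.1) *: zeta).

Lemma aut_diff_is_linear (R : realType) (P : 'M[R]_2) (e : R) (zeta : 'cV[R]_2) :
  linear (aut_diff P e zeta).
Proof.
move=> a [x v] [y w]; congr pair; rewrite /= ?mulmxDr -?scalemxAr.
  by rewrite /GRing.scale /=; ring.
by apply: cV2_eq; rewrite !mxE /GRing.scale /=; ring.
Qed.

HB.instance Definition _ (R : realType) (P : 'M[R]_2) (e : R) (zeta : 'cV[R]_2) :=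
  GRing.isLinear.Build R (RxR2 R) (RxR2 R) *:%R (aut_diff P e zeta)
    (aut_diff_is_linear P e zeta).

Lemma smooth_aut (R : realType) (theta P : 'M[R]_2) (e : R) (zeta : 'cV[R]_2) :
  smooth (aut theta P e zeta).
Proof.
have s0 : smooth (fun p : RxR2 R => e * p.1).
  by apply: smoothM; [exact: smooth_cst|exact: smooth_fst].
have si i : smooth (fun p : RxR2 R => (aut theta P e zeta p).2 i 0).
  rewrite (_ : (fun p => _) = fun p : RxR2 R => (P *m p.2) i 0 +
      Lambda theta (e * p.1) zeta i 0); last by apply/funext => p; rewrite mxE.
  by apply: smoothD; [exact: (lie_mulmx P i id).1|exact: smooth_Lambda_comp].
by apply: smooth_RxR2; split.
Qed.

Lemma diff_aut (R : realType) (theta P : 'M[R]_2) (e : R) (zeta : 'cV[R]_2)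
    (p u : RxR2 R) :
  'd (aut theta P e zeta) p u =
  (e * u.1, P *m u.2 + (e * u.1) *: (rho theta (e * p.1) *m zeta)).
Proof.
have sa := smooth_aut theta P e zeta.
have s0 : smooth (fun p : RxR2 R => e * p.1).
  by apply: smoothM; [exact: smooth_cst|exact: smooth_fst].
have l0 : lie (fun=> u) (fun p : RxR2 R => e * p.1) = fun=> e * u.1.
  rewrite (lieM _ (smooth_cst _ e) (smooth_fst R)) lie_cst lie_fst.
  by apply/funext => q; rewrite mulr0 addr0.
have li i : lie (fun=> u) (fun p : RxR2 R => (aut theta P e zeta p).2 i 0) p =
    (P *m u.2) i 0 + (e * u.1) * (rho theta (e * p.1) *m zeta) i 0.
  rewrite (_ : (fun p => _) = fun p : RxR2 R => (P *m p.2) i 0 +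
      Lambda theta (e * p.1) zeta i 0); last by apply/funext => q; rewrite mxE.
  rewrite (lieD _ (lie_mulmx P i id).1 (smooth_Lambda_comp theta zeta i s0)).
  by rewrite (lie_mulmx P i _).2 (lie_Lambda_comp _ _ _ _ s0) l0 mulrC.
have key a b c : covec a b c ('d (aut theta P e zeta) p u) =
    lie (fun=> u) (covec a b c \o aut theta P e zeta) p by rewrite lie_covec_comp.
have sc i : smooth (fun p : RxR2 R => (aut theta P e zeta p).2 i 0).
  rewrite (_ : (fun p => _) = fun p : RxR2 R => (P *m p.2) i 0 +
      Lambda theta (e * p.1) zeta i 0); last by apply/funext => q; rewrite mxE.
  by apply: smoothD; [exact: (lie_mulmx P i id).1|exact: smooth_Lambda_comp].
move: ('d _ p u) key => x key.
have k0 := key 1 0 0; have k1 := key 0 1 0; have k2 := key 0 0 1.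
rewrite (_ : _ \o _ = fun p : RxR2 R => e * p.1) in k0; last first.
  by apply/funext => q; rewrite /covec /=; ring.
rewrite (_ : _ \o _ = fun p : RxR2 R => (aut theta P e zeta p).2 0 0) in k1; last first.
  by apply/funext => q; rewrite /covec /=; ring.
rewrite (_ : _ \o _ = fun p : RxR2 R => (aut theta P e zeta p).2 1 0) in k2; last first.
  by apply/funext => q; rewrite /covec /=; ring.
rewrite l0 in k0; rewrite li in k1; rewrite li in k2.
rewrite /covec !mul0r !mul1r ?addr0 ?add0r in k0 k1 k2.
by case: x k0 k1 k2 {key} => y v /= -> v0 v1; congr pair; apply: cV2_eq;
  rewrite ?v0 ?v1 [RHS]mxE; congr (_ + _); rewrite [RHS]mxE.
Qed.

(** The translation part of the inverse is forced by cancellation of the two [Lambda] terms; e is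
    its own inverse. *)
Lemma aut_cancel (R : realType) (theta P Q : 'M[R]_2) (e : R) (zeta : 'cV[R]_2) :
  e * e = 1 -> P *m Q = 1%:M -> P *m theta = e *: (theta *m P) ->
  cancel (aut theta Q e zeta) (aut theta P e (- e *: (P *m zeta))).
Proof.
move=> ee PQ Pt [t v]; rewrite /aut /= mulrA ee mul1r; congr pair.
rewrite mulmxDr mulmxA PQ mul1mx -addrA LambdaZ -[X in Lambda _ X (P *m _)]mul1r.
rewrite -ee -mulrA Lambda_intertwine// scalerA mulNr ee scaleN1r.
by rewrite subrr addr0.
Qed.

Lemma diffeomorphism_aut (R : realType) (theta P : 'M[R]_2) (e : R)
    (zeta : 'cV[R]_2) :
  e * e = 1 -> P \in unitmx -> P *m theta = e *: (theta *m P) ->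
  diffeomorphism (aut theta P e zeta).
Proof.
move=> ee Pu Pt; split; first exact: smooth_aut.
have Qt : invmx P *m theta = e *: (theta *m invmx P).
  apply: (can_inj (mulKmx Pu)); apply: (can_inj (mulmxK Pu)).
  rewrite mulmxA mulmxV// mul1mx -scalemxAr -scalemxAl -!mulmxA mulVmx// mulmx1.
  by rewrite Pt scalerA ee scale1r.
exists (aut theta (invmx P) e (- e *: (invmx P *m zeta))); split.
- by apply: aut_cancel; rewrite ?mulVmx.
- have -> : zeta = - e *: (P *m (- e *: (invmx P *m zeta))).
    by rewrite -scalemxAr scalerA mulrNN ee scale1r mulmxA mulmxV// mul1mx.
  rewrite -[X in aut _ (invmx P) _ X](_ : - e *: (invmx P *m zeta) = _); last first.
    rewrite -!scalemxAr scalerA mulrNN ee scale1r mulmxA.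
    by rewrite !mulmxA mulVmx// mul1mx.
  by apply: aut_cancel; rewrite ?mulmxV.
- exact: smooth_aut.
Qed.

Lemma aut0 (R : realType) (theta P : 'M[R]_2) (e : R) (zeta : 'cV[R]_2) :
  aut theta P e zeta 0 = 0.
Proof. by rewrite /aut /= mulr0 mulmx0 Lambda0 addr0. Qed.

Lemma diff_aut_left_invariant (R : realType) (theta P : 'M[R]_2) (e : R)
    (zeta : 'cV[R]_2) (Y p : RxR2 R) :
  P *m theta = e *: (theta *m P) ->
  'd (aut theta P e zeta) p (left_invariant theta Y p) =
  left_invariant theta (aut_diff P e zeta Y) (aut theta P e zeta p).
Proof.
move=> Pt; rewrite diff_aut !left_invariantE /=; congr pair.
by rewrite (rho_intertwine _ _ Pt) mulmxDr -scalemxAr.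
Qed.

Lemma bracket_aut_diff (R : realType) (theta P : 'M[R]_2) (e : R)
    (zeta : 'cV[R]_2) (Y Z : RxR2 R) :
  P *m theta = e *: (theta *m P) ->
  bracket theta (aut_diff P e zeta Y) (aut_diff P e zeta Z) =
  aut_diff P e zeta (bracket theta Y Z).
Proof.
move=> Pt; rewrite /bracket /aut_diff /= mulr0 scale0r addr0; congr pair.
rewrite !mulmxDr !mulmxN -!scalemxAr !mulmxA Pt -!scalemxAl.
move: (theta *m P *m Z.2) (theta *m P *m Y.2) (theta *m zeta) => x y z.
by apply: cV2_eq; rewrite !mxE; ring.
Qed.

(** Conjugation of D by the automorphism phi = [aut_diff P e zeta]: the new xi is obtained by
    solving D' phi = phi D on (1, 0), where phi (1, 0) = (e, e zeta). *)
Lemma derivation_aut_diff (R : realType) (P A : 'M[R]_2) (e : R)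
    (zeta xi : 'cV[R]_2) (Y : RxR2 R) :
  e * e = 1 -> P \in unitmx ->
  derivation (e *: (P *m xi) - (P *m A *m invmx P) *m zeta) (P *m A *m invmx P)
    (aut_diff P e zeta Y) =
  aut_diff P e zeta (derivation xi A Y).
Proof.
move=> ee Pu; rewrite /derivation /aut_diff /= mulr0 scale0r addr0; congr pair.
rewrite !mulmxDr -!scalemxAr !mulmxA mulmxKV// scalerBr scalerA.
rewrite (_ : e * Y.1 * e = Y.1); last by rewrite mulrAC ee mul1r.
move: (P *m xi) (P *m A *m invmx P *m zeta) (P *m A *m Y.2) => x y z.
by apply: cV2_eq; rewrite !mxE; ring.
Qed.

Lemma conj_comm (R : realType) (theta P A : 'M[R]_2) (e : R) :
  e * e = 1 -> P \in unitmx -> P *m theta = e *: (theta *m P) ->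
  A *m theta = theta *m A ->
  (P *m A *m invmx P) *m theta = theta *m (P *m A *m invmx P).
Proof.
move=> ee Pu Pt AC.
apply: (can_inj (mulmxK Pu)); rewrite -[RHS]mulmxA (mulmxKV Pu) -!mulmxA.
have tP : theta *m P = e *: (P *m theta) by rewrite Pt scalerA ee scale1r.
rewrite tP -!scalemxAr !mulmxA (mulmxKV Pu) -[P *m A *m theta]mulmxA AC mulmxA Pt.
by rewrite -!scalemxAl scalerA ee scale1r -mulmxA.
Qed.

Lemma diff_aut_vector_field (R : realType) (theta P : 'M[R]_2) (e : R)
    (zeta : 'cV[R]_2) (S S' : ARS R) (p : RxR2 R) :
  e * e = 1 -> P \in unitmx -> P *m theta = e *: (theta *m P) ->
  ars_A S *m theta = theta *m ars_A S ->
  ars_A S' = P *m ars_A S *m invmx P ->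
  ars_xi S' = e *: (P *m ars_xi S) - ars_A S' *m zeta ->
  'd (aut theta P e zeta) p (vector_field theta S p) =
  vector_field theta S' (aut theta P e zeta p).
Proof.
move=> ee Pu Pt AC A' xi'.
rewrite diff_aut /vector_field /linear_field /= mulr0 scale0r addr0; congr pair.
rewrite mulmxDr mulmxDr -addrA.
have -> : ars_A S' *m Lambda theta (e * p.1) zeta =
    Lambda theta (e * p.1) (ars_A S' *m zeta).
  rewrite -[in RHS](mul1r (e * p.1)) Lambda_intertwine ?scale1r//.
  by rewrite ?scale1r A'; exact: (conj_comm ee Pu Pt AC).
rewrite -LambdaD xi' (addrC (ars_A S' *m zeta)) subrK LambdaZ Lambda_intertwine// scalerA ee scale1r.
by rewrite A' !mulmxA mulmxKV.
Qed.

(** * Transport of structures by automorphisms *)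

Lemma mem_span2 (R : realType) (Y1 Y2 Y : RxR2 R) :
  reflect (exists a b : R, Y = a *: Y1 + b *: Y2) (Y \in <<[:: Y1; Y2]>>%VS).
Proof.
apply: (iffP idP) => [|[a [b ->]]].
  rewrite span_cons span_seq1 => /memv_addP[_ /vlineP[a ->] [_ /vlineP[b ->] ->]].
  by exists a, b.
by rewrite rpredD// rpredZ// memv_span// !inE eqxx ?orbT.
Qed.

(** The automorphism carries X, Y1, Y2 to the corresponding fields of S' at every point, so a vector
    and its image admit the same coefficients. *)
Lemma isometry_aut (R : realType) (theta P : 'M[R]_2) (e : R)
    (zeta : 'cV[R]_2) (S S' : ARS R) (Y1 Y2 : subvs_of (ars_Delta S))
    (Z1 Z2 : subvs_of (ars_Delta S')) :
  e * e = 1 -> P \in unitmx -> P *m theta = e *: (theta *m P) ->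
  ars_A S *m theta = theta *m ars_A S ->
  ars_A S' = P *m ars_A S *m invmx P ->
  ars_xi S' = e *: (P *m ars_xi S) - ars_A S' *m zeta ->
  inner_product (@ars_ip R S) -> inner_product (@ars_ip R S') ->
  orthonormal_basis Y1 Y2 -> orthonormal_basis Z1 Z2 ->
  aut_diff P e zeta (vsval Y1) = vsval Z1 ->
  aut_diff P e zeta (vsval Y2) = vsval Z2 ->
  Defs.isometry theta S S' (aut theta P e zeta).
Proof.
move=> ee Pu Pt AC A' xi' ipS ipS' onY onZ YZ1 YZ2.
have dphi := diffeomorphism_aut zeta ee Pu Pt; split=> // p Z.
have [inj _] := diffeomorphism_diff p dphi.
rewrite (ar_normE _ _ _ ipS onY) (ar_normE _ _ _ ipS' onZ).
have E a0 a1 a2 : 'd (aut theta P e zeta) p (a0 *: vector_field theta S p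
     + a1 *: left_invariant theta (vsval Y1) p + a2 *: left_invariant theta (vsval Y2) p) =
   a0 *: vector_field theta S' (aut theta P e zeta p)
     + a1 *: left_invariant theta (vsval Z1) (aut theta P e zeta p)
     + a2 *: left_invariant theta (vsval Z2) (aut theta P e zeta p).
  have lin3 (f : {linear RxR2 R -> RxR2 R}) x0 x1 x2 y0 y1 y2 :
      f x0 = y0 -> f x1 = y1 -> f x2 = y2 ->
      f (a0 *: x0 + a1 *: x1 + a2 *: x2) = a0 *: y0 + a1 *: y1 + a2 *: y2.
    by move=> <- <- <-; rewrite !linearD !linearZ.
  rewrite -YZ1 -YZ2; apply: lin3.
  - exact: (@diff_aut_vector_field _ theta P e zeta S S' p ee Pu Pt AC A' xi').
  - exact: diff_aut_left_invariant.
  - exact: diff_aut_left_invariant.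
congr ereal_inf; apply/seteqP; split=> r [a0 [a1 [a2 [EZ ->]]]]; exists a0, a1, a2; split=> //.
  by apply/eqP; rewrite -subr_eq0; apply/eqP/inj; rewrite linearB E EZ subrr.
by rewrite -EZ -E.
Qed.

Lemma aut_diff_inj (R : realType) (P : 'M[R]_2) (e : R) (zeta : 'cV[R]_2) :
  e * e = 1 -> P \in unitmx -> injective (aut_diff P e zeta).
Proof.
move=> ee Pu [x v] [y w] [/= exy]; have e0 : e != 0.
  by apply: contra_eq_neq ee => ->; rewrite mul0r eq_sym oner_eq0.
have xy := mulfI e0 exy; rewrite xy => /addIr h; congr pair.
exact: (can_inj (mulKmx Pu) h).
Qed.

Lemma rank_two_aut_diff (R : realType) (P : 'M[R]_2) (e : R)
    (zeta xi xi' : 'cV[R]_2) (A A' : 'M[R]_2) :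
  injective (aut_diff P e zeta) ->
  (forall Y, derivation xi' A' (aut_diff P e zeta Y) = aut_diff P e zeta (derivation xi A Y)) ->
  rank_two xi A -> rank_two xi' A'.
Proof.
move=> inj comm; rewrite /rank_two => <-.
set Phi := linfun (aut_diff P e zeta).
have ker0 : lker Phi == 0%VS.
  by apply/lker0P => x y; rewrite !lfunE; exact: inj.
have full : limg Phi = fullv.
  apply/eqP; rewrite eqEdim subvf /= -(limg_ker_dim Phi fullv).
  by rewrite (eqP ker0) capv0 dimv0 add0n leqnn.
rewrite -[X in (_ @: X)%VS]full -limg_comp.
have -> : (linfun (derivation xi' A') \o Phi)%VF = (Phi \o linfun (derivation xi A))%VF.
  by apply/lfunP => Y; rewrite !comp_lfunE !lfunE /= comm.
rewrite limg_comp limg_dim_eq// (eqP ker0) capv0//.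
Qed.

Lemma model_inner_product (R : realType) (xi : 'cV[R]_2) (A : 'M[R]_2)
    (w : 'cV[R]_2) (sigma : R) : inner_product (@ars_ip R (model xi A w sigma)).
Proof.
apply/inner_productP; split.
- move=> v a x y /=; rewrite mulr_sumr -big_split /=; apply: eq_bigr => k _.
  by rewrite !linearD !linearZ /= mulrDl mulrA.
- by move=> u v /=; apply: eq_bigr => k _; rewrite mulrC.
- move=> u u0 /=; rewrite lt_neqAle; apply/andP; split; last first.
    by apply: sumr_ge0 => k _; rewrite -expr2 sqr_ge0.
  apply: contra u0; rewrite eq_sym psumr_eq0; last first.
    by move=> k _; rewrite -expr2 sqr_ge0.
  move=> /allP h; apply/eqP/val_inj => /=.
  rewrite (coord_span (subvsP u)) big1// => k _.
  have := h k (mem_index_enum k); rewrite mulf_eq0 orbb => /eqP ->.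
  by rewrite scale0r.
Qed.
Lemma RxR2_eq (R : realType) (p q : RxR2 R) :
  p.1 = q.1 -> p.2 0 0 = q.2 0 0 -> p.2 1 0 = q.2 1 0 -> p = q.
Proof.
by case: p q => x v [y w] /= -> v0 v1; congr pair; exact: cV2_eq.
Qed.

Lemma rescale_rank_two_simple (R : realType) (theta : 'M[R]_2) (S : ARS R) (c : R) :
  0 < c -> rank_two_simple_ARS theta S -> rank_two_simple_ARS theta (rescale c S).
Proof.
move=> c0 [[AC dimD /inner_productP[lin sym pos] gen LARC] rk]; split=> //.
split=> //; apply/inner_productP; split.
- by move=> v a x y /=; rewrite lin mulrDr mulrCA.
- by move=> u v /=; rewrite sym.
- by move=> u u0 /=; rewrite mulr_gt0// pos.
Qed.

(** Every clause is expressed by brackets, the derivation and left-invariant fields, all of which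
    the automorphism intertwines. *)
Lemma simple_ARS_aut (R : realType) (theta P : 'M[R]_2) (e : R)
    (zeta : 'cV[R]_2) (S S' : ARS R) :
  e * e = 1 -> P \in unitmx -> P *m theta = e *: (theta *m P) ->
  ars_A S' = P *m ars_A S *m invmx P ->
  ars_xi S' = e *: (P *m ars_xi S) - ars_A S' *m zeta ->
  inner_product (@ars_ip R S') -> \dim (ars_Delta S') = 2 ->
  (forall Y, Y \in ars_Delta S -> aut_diff P e zeta Y \in ars_Delta S') ->
  (forall Z, Z \in ars_Delta S' -> exists2 Y, Y \in ars_Delta S & aut_diff P e zeta Y = Z) ->
  rank_two_simple_ARS theta S -> rank_two_simple_ARS theta S'.
Proof.
move=> ee Pu Pt A' xi' ip' dim' memS surS [[AC _ _ [p pD] LARC] rk].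
have inj := @aut_diff_inj _ P e zeta ee Pu.
have comm Y : derivation (ars_xi S') (ars_A S') (aut_diff P e zeta Y) =
    aut_diff P e zeta (derivation (ars_xi S) (ars_A S) Y).
  by rewrite xi' A' derivation_aut_diff.
split; last exact: rank_two_aut_diff inj comm rk.
split=> //.
- by rewrite A'; exact: (conj_comm ee Pu Pt AC).
- exists (aut theta P e zeta p) => -[Z ZD].
  have [Y YD <-] := surS Z ZD.
  rewrite -diff_aut_left_invariant//.
  rewrite -(@diff_aut_vector_field _ theta P e zeta S S' p ee Pu Pt AC A' xi') => h.
  apply: pD; exists Y => //.
  have [injd _] := diffeomorphism_diff p (diffeomorphism_aut zeta ee Pu Pt).
  apply/eqP; rewrite -subr_eq0; apply/eqP/injd; rewrite linearB.
  by apply/eqP; rewrite subr_eq0; apply/eqP.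
- case: LARC => [nsub|[_ ninv]].
    left=> sub'; apply: nsub => X Y XD YD.
    have := sub' _ _ (memS X XD) (memS Y YD); rewrite bracket_aut_diff// => /surS[Z ZD].
    by move/inj <-.
  case: (pselect (subalgebra theta (ars_Delta S'))) => [sub'|]; last by left.
  right; split=> // inv'; apply: ninv => Y YD.
  have := inv' _ (memS Y YD); rewrite comm => /surS[Z ZD].
  by move/inj <-.
Qed.

(* The basis [(e Y2 - Y1) / s, (e Y2 + Y1) / s] is orthogonal with both vectors of
   the same length, and their difference lies in {0} x R^2: so [sigma = 1] is
   always possible. *)
Lemma model_class_rescale (R : realType) (theta P : 'M[R]_2) (e s : R)
    (S : ARS R) (Y1 Y2 : subvs_of (ars_Delta S)) (w eta w0 : 'cV[R]_2) :
  rank_two_simple_ARS theta S -> orthonormal_basis Y1 Y2 ->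
  vsval Y1 = (0, w) -> vsval Y2 = (s, eta) -> s != 0 ->
  e * e = 1 -> P \in unitmx -> P *m theta = e *: (theta *m P) ->
  w0 != 0 -> P *m ((2 / s) *: w) = w0 ->
  exists2 c, 0 < c & model_class theta w0 (rescale c S).
Proof.
move=> rS [bY y1 y2 y12] Y1E Y2E s0 ee Pu Pt w00 Pw.
have [[AC dimD ipS _ _] _] := rS.
have /inner_productP[lin sym pos] := ipS.
have spanY Y : Y \in ars_Delta S -> exists a b, Y = a *: vsval Y1 + b *: vsval Y2.
  by rewrite -{1}(span_basis bY) => /mem_span2.
(* In the original inner product [V1] and [V2] have squared length 2 / s^2. *)
pose c := s ^+ 2 / 2.
have c0 : 0 < c by rewrite divr_gt0// exprn_even_gt0.
have rcS := rescale_rank_two_simple c0 rS.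
exists c => //; split=> //.
pose V1 : subvs_of (ars_Delta (rescale c S)) := (e / s) *: Y2 - s^-1 *: Y1.
pose V2 : subvs_of (ars_Delta (rescale c S)) := (e / s) *: Y2 + s^-1 *: Y1.
set ip := @ars_ip R S in lin sym pos y1 y2 y12.
have ipD (u v z : subvs_of (ars_Delta S)) : ip (u + v) z = ip u z + ip v z.
  by have := lin z 1 u v; rewrite scale1r mul1r.
have ip0 (z : subvs_of (ars_Delta S)) : ip 0 z = 0.
  by apply: (addrI (ip 0 z)); rewrite -ipD !addr0.
have ipZ a (u z : subvs_of (ars_Delta S)) : ip (a *: u) z = a * ip u z.
  by have := lin z a u 0; rewrite !addr0 ip0 addr0.
have ipE a b a' b' : ip (a *: Y2 + b *: Y1) (a' *: Y2 + b' *: Y1) = a * a' + b * b'.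
  rewrite ipD !ipZ !(sym _ (_ + _)) !ipD !ipZ y1 y2 y12 (sym Y2) y12.
  by rewrite !mulr0 !mulr1 addr0 add0r.
have V1E : V1 = (e / s) *: Y2 + (- s^-1) *: Y1 by rewrite /V1 scaleNr.
have onV : orthonormal_basis V1 V2.
  split.
  - rewrite basisEdim [X in (_ <= X)%N]dimD leqnn andbT.
    apply/subvP => Y /spanY[a [b ->]].
    apply/mem_span2; exists (b * (s * e / 2) - a * (s / 2)), (b * (s * e / 2) + a * (s / 2)).
    rewrite /= -[in LHS](mulr1 b) -[in LHS]ee.
    by apply: RxR2_eq; rewrite /= ?mxE /GRing.scale /=; field.
  - rewrite -[ars_ip _ _]/(c * ip V1 V1) V1E ipE /c.
    rewrite (_ : _ * _ = (e * e + 1) / 2); last by field.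
    by rewrite ee; field.
  - rewrite -[ars_ip _ _]/(c * ip V2 V2) ipE /c.
    rewrite (_ : _ * _ = (e * e + 1) / 2); last by field.
    by rewrite ee; field.
  - rewrite -[ars_ip _ _]/(c * ip V1 V2) V1E ipE /c.
    rewrite (_ : _ * _ = (e * e - 1) / 2); last by field.
    by rewrite ee subrr mul0r.
(* [V1] has first coordinate e, so its image has R^2 component P applied to that of [V1], plus e * e
   * zeta; this choice makes it 0. *)
pose zeta := - (P *m (vsval V1).2).
pose A' := P *m ars_A S *m invmx P.
pose xi' := e *: (P *m ars_xi S) - A' *m zeta.
have [Z1 [Z2 [onZ Z1E Z2E]]] := model_orthonormal xi' A' 1 w00.
have PV1 : aut_diff P e zeta (vsval V1) = (1, 0).
  rewrite /aut_diff /zeta; have -> : (vsval V1).1 = e.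
    by rewrite /= Y1E Y2E /= /GRing.scale /=; field.
  by rewrite ee scale1r subrr.
(* The difference of [V2] and [V1] is (2 / s) Y1, which explains the factor in the hypothesis on
   [P]. *)
have PV2 : aut_diff P e zeta (vsval V2) = (1, w0).
  rewrite /aut_diff /zeta; have -> : (vsval V2).1 = e.
    by rewrite /= Y1E Y2E /= /GRing.scale /=; field.
  rewrite ee scale1r -mulmxBr -Pw; congr (_, _ *m _).
  by rewrite /= Y1E Y2E /=; apply: cV2_eq; rewrite !mxE; field.
have lin2 a b x y : aut_diff P e zeta (a *: x + b *: y) =
    a *: aut_diff P e zeta x + b *: aut_diff P e zeta y.
  by rewrite linearD !linearZ.
have [bV _ _ _] := onV; have [bZ _ _ _] := onZ.
have ipM := model_inner_product xi' A' w0 1.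
exists xi', A', 1; split=> //; last first.
  exists (aut theta P e zeta); split; last exact: aut0.
  have [[_ _ ipR _ _] _] := rcS.
  apply: (@isometry_aut R theta P e zeta (rescale c S) (model xi' A' w0 1) V1 V2 Z1 Z2
    ee Pu Pt AC erefl erefl ipR ipM onV onZ); first by rewrite PV1.
  by rewrite PV2.
apply: (@simple_ARS_aut R theta P e zeta (rescale c S) (model xi' A' w0 1)
  ee Pu Pt erefl erefl ipM _ _ _ rcS).
- exact: (@size_basis _ _ _ _ [tuple vsval Z1; vsval Z2] bZ).
- move=> Y; rewrite -{1}(span_basis bV) => /mem_span2[a [b ->]].
  rewrite lin2 PV1 PV2.
  have m1 := subvsP Z1; have m2 := subvsP Z2; rewrite Z1E in m1; rewrite Z2E in m2.
  by apply: rpredD; exact: rpredZ.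
- move=> Z /mem_span2[a [b ->]]; exists (a *: vsval V1 + b *: vsval V2).
    by apply: rpredD; apply: rpredZ; [exact: (subvsP V1)|exact: (subvsP V2)].
  by rewrite lin2 PV1 PV2.
Qed.
(** * The classes are disjoint *)

Lemma isometry_inv (R : realType) (theta : 'M[R]_2) (S S' : ARS R)
    (psi : RxR2 R -> RxR2 R) :
  Defs.isometry theta S S' psi -> psi 0 = 0 ->
  exists2 phi, Defs.isometry theta S' S phi & phi 0 = 0.
Proof.
move=> [[sp [g [fK gK sg]]] iso] psi0; exists g; last by rewrite -psi0 fK.
split=> [|p Z]; first by split=> //; exists psi.
have E : 'd psi (g p) ('d g p Z) = Z by exact: diff_cancel.
have h := iso (g p) ('d g p Z); rewrite gK in h.
exact: (etrans (esym h) (congr1 (ar_norm theta S' p) E)).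
Qed.

Lemma model_mem0 (R : realType) (xi : 'cV[R]_2) (A : 'M[R]_2) (w : 'cV[R]_2)
    (sigma : R) (v : 'cV[R]_2) :
  (0, v) \in ars_Delta (model xi A w sigma) <-> exists k, v = k *: w.
Proof.
split=> [/mem_span2[a [b [_ ->]]]|[k ->]].
  by exists b; rewrite scaler0 add0r.
apply/mem_span2; exists (- (k * sigma)), k; congr pair.
  by rewrite /= /GRing.scale /=; ring.
by rewrite /= scaler0 add0r.
Qed.

Lemma det2Z (R : realType) (theta : 'M[R]_2) (k : R) (w : 'cV[R]_2) :
  det2 (k *: w) (theta *m (k *: w)) = k ^+ 2 * det2 w (theta *m w).
Proof. by rewrite -scalemxAr /det2 !mxE; ring. Qed.

(** One implication comes from the isometry onto the model, the other from its inverse. *)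
Lemma model_class_eigen (R : realType) (theta : 'M[R]_2) (S : ARS R)
    (Y1 Y2 : subvs_of (ars_Delta S)) (w eta w' : 'cV[R]_2) (s : R) :
  orthonormal_basis Y1 Y2 -> vsval Y1 = (0, w) -> vsval Y2 = (s, eta) ->
  w != 0 -> s != 0 -> model_class theta w' S ->
  det2 w (theta *m w) = 0 <-> det2 w' (theta *m w') = 0.
Proof.
move=> onY Y1E Y2E w0 s0 [[sS _] [xi [A [sigma [_ [sM _] [psi [iso psi0]]]]]]].
(* The basis (1, 0), (sigma, w') of the model need not contain a vector of {0} x R^2, so an adapted
   one is taken; its first vector is a multiple of (0, w'). *)
have [Z1 [Z2 [v [eta' [s' [onZ Z1E Z2E v0 s'0]]]]]] := orthonormal_frame sM.
have /model_mem0[k vE] : (0, v) \in ars_Delta (model xi A w' sigma).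
  by rewrite -Z1E subvsP.
have k0 : k != 0 by apply: contra v0 => /eqP k0; rewrite vE k0 scale0r.
have [_ _ ipS _ _] := sS; have [_ _ ipM _ _] := sM.
have eqv : det2 v (theta *m v) = 0 <-> det2 w' (theta *m w') = 0.
  rewrite vE det2Z; split=> [/eqP|->]; last by rewrite mulr0.
  by rewrite mulf_eq0 sqrf_eq0 (negPf k0) => /eqP.
rewrite -eqv; split.
  have [phi iso' phi0] := isometry_inv iso psi0.
  have := isometry_cometric_map ipM ipS onZ onY iso'; rewrite Y1E Y2E Z1E Z2E => H.
  exact: (isometry_eigen iso'.1 phi0 H).
have := isometry_cometric_map ipS ipM onY onZ iso; rewrite Y1E Y2E Z1E Z2E => H.
exact: (isometry_eigen iso.1 psi0 H).
Qed.

Lemma model_class_disjoint (R : realType) (theta : 'M[R]_2) (w w' : 'cV[R]_2) :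
  det2 w (theta *m w) = 0 -> det2 w' (theta *m w') != 0 ->
  model_class theta w `&` model_class theta w' = set0.
Proof.
move=> d0 d1; apply/seteqP; split=> // S [Sw Sw'].
have [Y1 [Y2 [v [eta [s [onY Y1E Y2E v0 s0]]]]]] := orthonormal_frame Sw.1.1.
have h := proj2 (model_class_eigen onY Y1E Y2E v0 s0 Sw) d0.
move/eqP: d1; apply.
exact: (proj1 (model_class_eigen onY Y1E Y2E v0 s0 Sw') h).
Qed.

Lemma ord2_neq (i j k : 'I_2) : i != j -> (k == i) || (k == j).
Proof. by case: i j k => -[|[|//]] ? [[|[|//]] ?] [[|[|//]] ?]. Qed.

Lemma dot2_delta (R : realType) (i : 'I_2) (v : 'cV[R]_2) :
  dot2 (delta_mx i 0) v = v i 0.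
Proof.
case: (boolP (i == 0)) => [/eqP ->|i0].
  by rewrite /dot2 !mxE /= mul1r mul0r addr0.
have -> : i = 1 by apply/eqP; have := @ord2_neq 0 1 i isT; rewrite (negPf i0).
by rewrite /dot2 !mxE /= mul1r mul0r add0r.
Qed.

Lemma cV2_delta (R : realType) (i j : 'I_2) (v : 'cV[R]_2) : i != j ->
  v = v i 0 *: delta_mx i 0 + v j 0 *: delta_mx j 0.
Proof.
move=> ij; apply/matrixP => k l; rewrite (ord1 l) !mxE !andbT.
have /orP[/eqP ->|/eqP ->] := ord2_neq k ij.
  by rewrite eqxx (negPf ij) mulr1 mulr0 addr0.
by rewrite eqxx eq_sym (negPf ij) mulr1 mulr0 add0r.
Qed.

Lemma diag_delta (R : realType) (theta : 'M[R]_2) (lam : 'I_2 -> R) (k : 'I_2) :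
  (forall k (v : 'cV[R]_2), (theta *m v) k 0 = lam k * v k 0) ->
  theta *m (delta_mx k 0 : 'cV[R]_2) = lam k *: delta_mx k 0.
Proof.
move=> th; apply/matrixP => l m; rewrite (ord1 m) th !mxE eqxx andbT.
by case: eqP => [->|_]; rewrite ?mulr1 ?mulr0.
Qed.

(** For distinct eigenvalues a matrix commuting with theta preserves each eigenline. *)
Lemma comm_diag_eigen (R : realType) (theta A : 'M[R]_2) (lam : 'I_2 -> R)
    (i j : 'I_2) :
  (forall k (v : 'cV[R]_2), (theta *m v) k 0 = lam k * v k 0) -> i != j -> lam i != lam j ->
  A *m theta = theta *m A ->
  A *m (delta_mx j 0 : 'cV[R]_2) = (A *m (delta_mx j 0 : 'cV[R]_2)) j 0 *: delta_mx j 0.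
Proof.
move=> th ij lij AC; rewrite [LHS](cV2_delta _ ij).
suff -> : (A *m (delta_mx j 0 : 'cV[R]_2)) i 0 = 0 by rewrite scale0r add0r.
have tj := diag_delta j th.
have := th i (A *m (delta_mx j 0 : 'cV[R]_2)).
rewrite mulmxA -AC -mulmxA tj -scalemxAr mxE => /eqP.
rewrite -subr_eq0 -mulrBl mulf_eq0 subr_eq0 eq_sym (negPf lij) /= => /eqP.
exact.
Qed.

(** Delta is a subalgebra here, so D must not preserve it. As A preserves the axis i, only a
    component of xi off that axis can move Delta. *)
Lemma model_LARC (R : realType) (theta : 'M[R]_2) (lam : 'I_2 -> R)
    (i j : 'I_2) (xi : 'cV[R]_2) (A : 'M[R]_2) (sigma : R) :
  (forall k (v : 'cV[R]_2), (theta *m v) k 0 = lam k * v k 0) -> i != j -> lam i != lam j ->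
  simple_ARS theta (model xi A (delta_mx i 0) sigma) -> xi j 0 != 0.
Proof.
move=> th ij lij [AC _ _ _ LARC]; apply/eqP => xj.
rewrite /= in AC; have ji : j != i by rewrite eq_sym.
have lji : lam j != lam i by rewrite eq_sym.
have [a AE] : exists a, A *m (delta_mx i 0 : 'cV[R]_2) = a *: delta_mx i 0.
  by eexists; exact: comm_diag_eigen th ji lji AC.
have [x xiE] : exists x, xi = x *: delta_mx i 0.
  by exists (xi i 0); rewrite {1}(cV2_delta xi ij) xj scale0r addr0.
have ti := diag_delta i th.
have two Y : Y \in ars_Delta (model xi A (delta_mx i 0) sigma) ->
    exists b, Y.2 = b *: delta_mx i 0.
  by move=> /mem_span2[? [b ->]]; exists b; rewrite /= scaler0 add0r.
have sub : subalgebra theta (ars_Delta (model xi A (delta_mx i 0) sigma)).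
  move=> X Y /two[c Xc] /two[b Yb]; apply/model_mem0.
  exists (X.1 * b * lam i - Y.1 * c * lam i).
  by rewrite Xc Yb -!scalemxAr ti !scalerA scalerBl.
have inv : derivation_invariant (model xi A (delta_mx i 0) sigma).
  move=> Y /two[b Yb]; apply/model_mem0.
  exists (Y.1 * x + b * a).
  by rewrite /= Yb -scalemxAr AE xiE !scalerA scalerDl.
by case: LARC => [|[]].
Qed.

(** If w lay on the axis j, theta would have eigenvalues (lam j, lam i) along and across the line of
    Delta in S, but (lam i, lam j) in the model; proportionality of these pairs contradicts the
    hypothesis on squares. *)
Lemma model_class_axis (R : realType) (theta : 'M[R]_2) (lam : 'I_2 -> R)
    (i j : 'I_2) (S : ARS R) (Y1 Y2 : subvs_of (ars_Delta S))
    (w eta : 'cV[R]_2) (s : R) :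
  (forall k (v : 'cV[R]_2), (theta *m v) k 0 = lam k * v k 0) -> i != j ->
  lam i ^+ 2 != lam j ^+ 2 ->
  orthonormal_basis Y1 Y2 -> vsval Y1 = (0, w) -> vsval Y2 = (s, eta) ->
  w != 0 -> s != 0 -> model_class theta (delta_mx i 0) S -> w i 0 != 0.
Proof.
move=> th ij l2 onY Y1E Y2E w0 s0.
move=> [[sS _] [xi [A [sigma [_ [sM _] [psi [iso psi0]]]]]]].
apply/eqP => wi.
have lij : lam i != lam j by apply: contra l2 => /eqP ->.
have lji : lam j != lam i by rewrite eq_sym.
have ji : j != i by rewrite eq_sym.
have wE : w = w j 0 *: delta_mx j 0.
  by rewrite {1}(cV2_delta w ij) wi scale0r add0r.
have wj : w j 0 != 0 by apply: contra w0 => /eqP wj; rewrite wE wj scale0r.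
have d0 : (delta_mx i 0 : 'cV[R]_2) != 0.
  by apply/eqP => /matrixP /(_ i 0) /eqP; rewrite !mxE !eqxx oner_eq0.
have [Z1 [Z2 [onZ Z1E Z2E]]] := model_orthonormal xi A sigma d0.
have [ACS _ ipS _ _] := sS; have [ACM _ ipM _ _] := sM.
have H := isometry_cometric_map ipS ipM onY onZ iso; rewrite Y1E Y2E Z1E Z2E in H.
have td k := diag_delta k th.
set kappa := s *: ars_xi S + ars_A S *m eta.
(* Modulo w, which spans the axis j, theta acts as lam i. *)
have tk : theta *m kappa = lam i *: kappa + ((lam j - lam i) * kappa j 0 / w j 0) *: w.
  rewrite {2}wE scalerA divfK// {1 2}(cV2_delta kappa ij) mulmxDr -!scalemxAr !td.
  rewrite scalerDr !scalerA -addrA -scalerDl; congr (_ *: _ + _ *: _); ring.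
have Aw : ars_A S *m w = (ars_A S *m (delta_mx j 0 : 'cV[R]_2)) j 0 *: w.
  by rewrite wE -scalemxAr {1}(comm_diag_eigen th ij lij ACS) !scalerA mulrC.
have tw : theta *m w = lam j *: w by rewrite wE -scalemxAr td !scalerA mulrC.
have nA v : dot2 (delta_mx j 0) (A *m v) =
    (A *m (delta_mx j 0 : 'cV[R]_2)) j 0 * dot2 (delta_mx j 0) v.
  rewrite !dot2_delta {1}(cV2_delta v ij) mulmxDr -!scalemxAr.
  rewrite (comm_diag_eigen th ji lji ACM) !mxE eqxx (negPf ji) /=.
  by rewrite !mulr0 add0r mulrC.
have [t t0 [e1 e2]] : exists2 t, t != 0 & s * lam j = t * lam i /\ s * lam i = t * lam j.
  apply: (isometry_eigenvalues (n' := delta_mx j 0) (m' := delta_mx i 0)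
    iso.1 psi0 H w0 s0 tw Aw ACS tk (td i)).
  - by rewrite dot2_delta !mxE !eqxx.
  - by rewrite dot2_delta !mxE (negPf ji).
  - by move=> v; rewrite !dot2_delta th.
  - exact: nA.
  - by rewrite dot2_delta; exact: (model_LARC th ij lij sM).
(* Both s lam i^2 and s lam j^2 equal t lam i lam j. *)
move/eqP: l2; apply; apply: (mulfI s0).
by rewrite !expr2 !mulrA e1 e2 mulrAC.
Qed.
(** * The normal forms *)

Lemma mx2_mulmx (R : realType) (a b c d a' b' c' d' : R) :
  mx2 a b c d *m mx2 a' b' c' d' =
  mx2 (a * a' + b * c') (a * b' + b * d') (c * a' + d * c') (c * b' + d * d').
Proof.
by apply/matrixP => i j; rewrite !mxE sum_ord2 !mxE /=; case: (i == 0); case: (j == 0).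
Qed.

Lemma mx2_scale (R : realType) (e a b c d : R) :
  e *: mx2 a b c d = mx2 (e * a) (e * b) (e * c) (e * d).
Proof. by apply/matrixP => i j; rewrite !mxE; case: (i == 0); case: (j == 0). Qed.

Lemma mx2_1 (R : realType) : mx2 1 0 0 1 = 1%:M :> 'M[R]_2.
Proof.
by apply/matrixP => -[[|[|//]] ?] [[|[|//]] ?]; rewrite !mxE.
Qed.

Lemma mx2_unit (R : realType) (a b c d : R) :
  a * d - b * c != 0 -> mx2 a b c d \in unitmx.
Proof.
move=> D; apply: (@mulmx1_unit _ _ _ (let k := a * d - b * c in
  mx2 (d / k) (- b / k) (- c / k) (a / k)) _).1.
by rewrite mx2_mulmx -mx2_1; congr mx2; field.
Qed.

Lemma mx2_mul_cV (R : realType) (a b c d : R) (v : 'cV[R]_2) :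
  (mx2 a b c d *m v) 0 0 = a * v 0 0 + b * v 1 0 /\
  (mx2 a b c d *m v) 1 0 = c * v 0 0 + d * v 1 0.
Proof. by rewrite !mulmx_cV2 !mxE. Qed.

Lemma mx2_mul_eq (R : realType) (a b c d x y : R) (v : 'cV[R]_2) :
  a * v 0 0 + b * v 1 0 = x -> c * v 0 0 + d * v 1 0 = y ->
  mx2 a b c d *m v = x *: ev1 R + y *: ev2 R.
Proof.
move=> xE yE; have [e1 e2] := mx2_mul_cV a b c d v.
by apply: cV2_eq; rewrite ?e1 ?e2 ?xE ?yE !mxE /=; ring.
Qed.

Lemma ev_neq0 (R : realType) :
  [/\ ev1 R != 0, ev2 R != 0 & ev1 R + ev2 R != 0].
Proof.
have n (v : 'cV[R]_2) i : v i 0 = 1 -> v != 0.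
  by move=> vi; apply/eqP => v0; move: vi; rewrite v0 mxE => /eqP; rewrite eq_sym oner_eq0.
split; [apply: (n _ 0)|apply: (n _ 1)|apply: (n _ 0)]; rewrite !mxE//=.
by rewrite addr0.
Qed.

(* [v] spans the line of [Delta] inside {0} x R^2, and the pairs [(e, P)] are the
   linear parts of the automorphisms that carry it to the line of a model. *)
Lemma model_class_of_orbit (R : realType) (theta : 'M[R]_2)
    (U : set (ARS R)) :
  (forall v : 'cV[R]_2, v != 0 -> exists P e w, [/\ e * e = 1, P \in unitmx,
     P *m theta = e *: (theta *m P), w != 0 & P *m v = w /\ model_class theta w `<=` U]) ->
  all_up_to_rescaling theta U.
Proof.
move=> orb S rS.
have [Y1 [Y2 [w [eta [s [onY Y1E Y2E w0 s0]]]]]] := orthonormal_frame rS.1.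
have v0 : (2 / s) *: w != 0.
  by rewrite scaler_eq0 negb_or w0 andbT mulf_neq0// ?invr_eq0// pnatr_eq0.
have [P [e [w' [ee Pu Pt w'0 [Pv sub]]]]] := orb _ v0.
have [c c0 cS] := model_class_rescale rS onY Y1E Y2E s0 ee Pu Pt w'0 Pv.
by exists c => //; exact: sub.
Qed.

Lemma cV2_neq0 (R : realType) (v : 'cV[R]_2) : v != 0 -> v 1 0 = 0 -> v 0 0 != 0.
Proof.
move=> v0 v1; apply: contra v0 => /eqP v00.
by apply/eqP/cV2_eq; rewrite mxE.
Qed.

Lemma scalar_or_rotation_E1 (R : realType) (theta : 'M[R]_2) :
  (theta = mx2 1 0 0 1 \/ exists gamma : R, theta = mx2 gamma (-1) 1 gamma) ->
  all_up_to_rescaling theta (E1 theta).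
Proof.
move=> th; apply: model_class_of_orbit => v v0.
have [e10 _ _] := ev_neq0 R.
pose n := v 0 0 ^+ 2 + v 1 0 ^+ 2.
have n0 : n != 0.
  apply/eqP => nz; have := sqr_ge0 (v 0 0); have := sqr_ge0 (v 1 0) => h1 h0.
  have z0 : v 0 0 ^+ 2 = 0 by move: nz; rewrite /n; lra.
  have z1 : v 1 0 ^+ 2 = 0 by move: nz; rewrite /n; lra.
  move/eqP: z1; rewrite sqrf_eq0 => /eqP /(cV2_neq0 v0).
  by rewrite -sqrf_eq0 z0 eqxx.
(* Multiplication by the inverse of the complex number v_1 + i v_2; such matrices commute with the
   identity and with every gamma + i. *)
exists (mx2 (v 0 0 / n) (v 1 0 / n) (- v 1 0 / n) (v 0 0 / n)), 1, (ev1 R); split=> //.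
- by rewrite mulr1.
- apply: mx2_unit; rewrite (_ : _ - _ = n^-1) ?invr_eq0//.
  by rewrite /n in n0 *; field.
- rewrite scale1r; case: th => [->|[g ->]]; rewrite !mx2_mulmx; congr mx2; ring.
- split=> //; rewrite (@mx2_mul_eq _ _ _ _ _ 1 0) ?scale1r ?scale0r ?addr0//.
  + by rewrite /n in n0 *; field.
  + by rewrite /n in n0 *; field.
Qed.

(** Diagonal matrices rescale the two coordinates independently. Recording [v 0 0 = 0] in the second
    case lets that case be discarded once v is known to lie off the second axis. *)
Lemma diag_orbit (R : realType) (a b : R) (v : 'cV[R]_2) : v != 0 ->
  exists P w, [/\ P \in unitmx, P *m mx2 a 0 0 b = 1 *: (mx2 a 0 0 b *m P),
    P *m v = w & [\/ w = ev1 R, v 0 0 = 0 /\ w = ev2 R | w = ev1 R + ev2 R]].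
Proof.
move=> v0.
have comm x y : mx2 x 0 0 y *m mx2 a 0 0 b = 1 *: (mx2 a 0 0 b *m mx2 x 0 0 y).
  by rewrite scale1r !mx2_mulmx; congr mx2; ring.
have unit x y : x != 0 -> y != 0 -> mx2 x 0 0 y \in unitmx.
  by move=> x0 y0; apply: mx2_unit; rewrite mulr0 subr0 mulf_neq0.
have n1 : (1 : R) != 0 by exact: oner_neq0.
have [v1|v1] := eqVneq (v 1 0) 0.
  have v00 := cV2_neq0 v0 v1.
  exists (mx2 (v 0 0)^-1 0 0 1), (ev1 R); split=> //; last by constructor 1.
    by apply: unit; rewrite ?invr_eq0.
  rewrite (@mx2_mul_eq _ _ _ _ _ 1 0) ?scale1r ?scale0r ?addr0// v1; last by ring.
  by rewrite mulVf// mulr0 addr0.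
have [v00|v00] := eqVneq (v 0 0) 0.
  exists (mx2 1 0 0 (v 1 0)^-1), (ev2 R); split=> //; last by constructor 2.
    by apply: unit; rewrite ?invr_eq0.
  rewrite (@mx2_mul_eq _ _ _ _ _ 0 1) ?scale1r ?scale0r ?add0r// v00; first by ring.
  by rewrite mulVf// mulr0 add0r.
exists (mx2 (v 0 0)^-1 0 0 (v 1 0)^-1), (ev1 R + ev2 R); split=> //; last by constructor 3.
  by apply: unit; rewrite ?invr_eq0.
by rewrite (@mx2_mul_eq _ _ _ _ _ 1 1) ?scale1r// ?mulVf// mul0r ?addr0 ?add0r.
Qed.

Lemma jordan_E1_E3 (R : realType) :
  all_up_to_rescaling (mx2 1 1 0 1 : 'M[R]_2)
    (E1 (mx2 1 1 0 1) `|` E3 (mx2 1 1 0 1)).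
Proof.
apply: model_class_of_orbit => v v0; have [e10 _ e30] := ev_neq0 R.
have comm x y : mx2 x y 0 x *m mx2 1 1 0 1 = 1 *: (mx2 1 1 0 1 *m mx2 x y 0 x) :> 'M[R]_2.
  by rewrite scale1r !mx2_mulmx; congr mx2; ring.
have unit (x y : R) : x != 0 -> mx2 x y 0 x \in unitmx.
  by move=> x0; apply: mx2_unit; rewrite mulr0 subr0 mulf_neq0.
have [v1|v1] := eqVneq (v 1 0) 0.
  have v00 := cV2_neq0 v0 v1.
  exists (mx2 (v 0 0)^-1 0 0 (v 0 0)^-1), 1, (ev1 R); split=> //.
  - by rewrite mulr1.
  - by apply: unit; rewrite invr_eq0.
  - split; last by left.
    rewrite (@mx2_mul_eq _ _ _ _ _ 1 0) ?scale1r ?scale0r ?addr0// v1.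
      by rewrite mulVf// mulr0 addr0.
    by ring.
(* The centralizer of the Jordan block consists of the matrices [mx2 x y 0 x]: x normalizes the
   second coordinate, then y is solved for to make the first one 1. *)
exists (mx2 (v 1 0)^-1 ((1 - v 0 0 / v 1 0) / v 1 0) 0 (v 1 0)^-1), 1, (ev1 R + ev2 R).
split=> //.
- by rewrite mulr1.
- by apply: unit; rewrite invr_eq0.
- split; last by right.
  rewrite (@mx2_mul_eq _ _ _ _ _ 1 1) ?scale1r//.
    by field.
  by rewrite mul0r add0r mulVf.
Qed.

Lemma saddle_E1_E3 (R : realType) :
  all_up_to_rescaling (mx2 1 0 0 (-1) : 'M[R]_2)
    (E1 (mx2 1 0 0 (-1)) `|` E3 (mx2 1 0 0 (-1))).
Proof.
apply: model_class_of_orbit => v v0; have [e10 _ e30] := ev_neq0 R.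
have [v00|v00] := eqVneq (v 0 0) 0.
  have v1 : v 1 0 != 0.
    by apply: contra v0 => /eqP v1; apply/eqP/cV2_eq; rewrite mxE.
  (* The swap of the axes conjugates theta to its opposite, which e = -1 allows, and brings the
     second axis to the first. *)
  exists (mx2 0 (v 1 0)^-1 1 0), (-1), (ev1 R); split=> //.
  - by rewrite mulrNN mulr1.
  - by apply: mx2_unit; rewrite mul0r mulr1 sub0r oppr_eq0 invr_eq0.
  - by rewrite !mx2_mulmx mx2_scale; congr mx2; ring.
  - split; last by left.
    rewrite (@mx2_mul_eq _ _ _ _ _ 1 0) ?scale1r ?scale0r ?addr0// v00.
      by rewrite mul0r add0r mulVf.
    by ring.
have [P [w [Pu Pt Pv wE]]] := diag_orbit 1 (-1) v0.
exists P, 1, w; split=> //; first by rewrite mulr1.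
  by case: wE => [->//|[/eqP]|->//]; rewrite (negPf v00).
split=> //; case: wE => [->|[/eqP]|->]; [by left|by rewrite (negPf v00)|by right].
Qed.

Lemma node_E1_E2_E3 (R : realType) (a b : R) :
  all_up_to_rescaling (mx2 a 0 0 b)
    (E1 (mx2 a 0 0 b) `|` E2 (mx2 a 0 0 b) `|` E3 (mx2 a 0 0 b)).
Proof.
apply: model_class_of_orbit => v v0; have [e10 e20 e30] := ev_neq0 R.
have [P [w [Pu Pt Pv wE]]] := diag_orbit a b v0.
exists P, 1, w; split=> //; first by rewrite mulr1.
  by case: wE => [->//|[_ ->]//|->//].
by split=> //; case: wE => [->|[_ ->]|->]; [left; left|left; right|right].
Qed.

Lemma det2_mx2 (R : realType) (a b c d x y : R) (v : 'cV[R]_2) :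
  v = x *: ev1 R + y *: ev2 R ->
  det2 v (mx2 a b c d *m v) = x * (c * x + d * y) - y * (a * x + b * y).
Proof.
have [e1 e2] := mx2_mul_cV a b c d v => vE.
have v0 : v 0 0 = x by rewrite vE !mxE /=; ring.
have v1 : v 1 0 = y by rewrite vE !mxE /=; ring.
by rewrite /det2 e1 e2 v0 v1.
Qed.

Lemma det2_ev (R : realType) (a b c d : R) :
  [/\ det2 (ev1 R) (mx2 a b c d *m ev1 R) = c,
      det2 (ev2 R) (mx2 a b c d *m ev2 R) = - b
    & det2 (ev1 R + ev2 R) (mx2 a b c d *m (ev1 R + ev2 R)) = (c + d) - (a + b)].
Proof.
split.
- rewrite (@det2_mx2 _ _ _ _ _ 1 0) ?scale1r ?scale0r ?addr0//; ring.
- rewrite (@det2_mx2 _ _ _ _ _ 0 1) ?scale1r ?scale0r ?add0r//; ring.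
- rewrite (@det2_mx2 _ _ _ _ _ 1 1) ?scale1r//; ring.
Qed.

Lemma E1_E3_disjoint (R : realType) (a b d : R) :
  d != a + b -> E1 (mx2 a b 0 d) `&` E3 (mx2 a b 0 d) = set0.
Proof.
move=> ne; have [d1 _ d3] := det2_ev a b 0 d.
by apply: model_class_disjoint => //; rewrite d3 add0r subr_eq0.
Qed.

Lemma E2_E3_disjoint (R : realType) (a d : R) :
  d != a -> E2 (mx2 a 0 0 d) `&` E3 (mx2 a 0 0 d) = set0.
Proof.
move=> ne; have [_ d2 d3] := det2_ev a 0 0 d.
by apply: model_class_disjoint; rewrite ?d2 ?oppr0// d3 add0r addr0 subr_eq0.
Qed.

(** In a common structure w would lie off both axes by [model_class_axis], and yet span an eigenline
    of a diagonal matrix with distinct entries. *)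
Lemma E1_E2_disjoint (R : realType) (a d : R) :
  a ^+ 2 != d ^+ 2 -> E1 (mx2 a 0 0 d) `&` E2 (mx2 a 0 0 d) = set0.
Proof.
move=> ne; apply/seteqP; split=> // S [S1 S2].
have [Y1 [Y2 [w [eta [s [onY Y1E Y2E w0 s0]]]]]] := orthonormal_frame S1.1.1.
pose lam (i : 'I_2) : R := if i == 0 then a else d.
have th k (v : 'cV[R]_2) : (mx2 a 0 0 d *m v) k 0 = lam k * v k 0.
  have [e1 e2] := mx2_mul_cV a 0 0 d v.
  have /orP[/eqP ->|/eqP ->] := @ord2_neq 0 1 k isT; rewrite ?e1 ?e2 /lam /=; ring.
have w00 : w 0 0 != 0.
  exact: (model_class_axis (i := 0) (j := 1) th _ _ onY Y1E Y2E w0 s0 S1).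
have w10 : w 1 0 != 0.
  apply: (model_class_axis (i := 1) (j := 0) th _ _ onY Y1E Y2E w0 s0 S2) => //.
  by rewrite eq_sym.
have [d1 _ _] := det2_ev a 0 0 d.
have := proj2 (model_class_eigen onY Y1E Y2E w0 s0 S1) d1.
have [e1 e2] := mx2_mul_cV a 0 0 d w.
rewrite /det2 e1 e2 (_ : _ - _ = (d - a) * (w 0 0 * w 1 0)); last by ring.
move=> /eqP; rewrite !mulf_eq0 (negPf w00) (negPf w10) !orbF subr_eq0 => /eqP da.
by rewrite da eqxx in ne.
Qed.

Theorem theorem3p9 (R : realType) (theta : 'M[R]_2) :
  [/\ (theta = mx2 1 0 0 1 \/ exists gamma : R, theta = mx2 gamma (-1) 1 gamma) ->
        all_up_to_rescaling theta (E1 theta),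
      (theta = mx2 1 1 0 1 \/ theta = mx2 1 0 0 (-1)) ->
        all_up_to_rescaling theta (E1 theta `|` E3 theta) /\
        E1 theta `&` E3 theta = set0
    & forall gamma : R, -1 < gamma < 1 -> theta = mx2 1 0 0 gamma ->
        all_up_to_rescaling theta (E1 theta `|` E2 theta `|` E3 theta) /\
        [/\ E1 theta `&` E2 theta = set0,
            E1 theta `&` E3 theta = set0
          & E2 theta `&` E3 theta = set0]].
Proof.
split=> [th|th|gamma /andP[g0 g1] ->].
- exact: scalar_or_rotation_E1.
- have n11 : (1 : R) != 1 + 1 by rewrite -subr_eq0 opprD addNKr oppr_eq0 oner_neq0.
  have nN1 : (-1 : R) != 1 + 0 by rewrite addr0 lt_eqF// ltrN10.
  case: th => ->; split; [exact: jordan_E1_E3|exact: E1_E3_disjoint|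
    exact: saddle_E1_E3|exact: E1_E3_disjoint].
have gn1 : gamma != 1 by rewrite lt_eqF.
have g2 : (1 : R) ^+ 2 != gamma ^+ 2.
  by rewrite eq_sym expr1n sqrf_eq1 negb_or gn1 gt_eqF.
split; first exact: node_E1_E2_E3.
split; first exact: E1_E2_disjoint.
  by apply: E1_E3_disjoint; rewrite addr0.
exact: E2_E3_disjoint.
Qed.
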